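(* Consider the following two assertions. (A) For every curve $X$ over $\mathbb{Q}$, every non-constant $t\in\mathbb{Q}(X)$ with $\mathbb{Q}(X)\neq\mathbb{Q}(t)$, such that either $t$ has at least one finite critical value not belonging to $\mathbb{Q}$ or the field extension $\bar{\mathbb{Q}}(X)/\bar{\mathbb{Q}}(t)$ is not abelian, and every choice, for each $n\in\mathbb{Z}$, of a point $P_n\in X(\bar{\mathbb{Q}})$ with $t(P_n)=n$, there exists a real number $c>0$ such that for every sufficiently large integer $N$ the number field $\mathbb{Q}(P_1,\ldots,P_N)$ is of degree at least $e^{cN}$ over $\mathbb{Q}$. (B) For every curve $X$ over $\mathbb{Q}$, every non-constant $t\in\mathbb{Q}(X)$ with $\mathbb{Q}(X)\neq\mathbb{Q}(t)$, and every choice, for each $n\in\mathbb{Z}$, of a point $P_n\in X(\bar{\mathbb{Q}})$ with $t(P_n)=n$, there exists a real number $c>0$ such that for every sufficiently large integer $N$, among the number fields $\mathbb{Q}(P_1),\ldots,\mathbb{Q}(P_N)$ there are at least $cN$ distinct ones. Then (A) implies (B).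
   Context: ''Curve'' means smooth geometrically irreducible projective algebraic curve. An algebraic closure $\bar{\mathbb{Q}}$ of $\mathbb{Q}$ is fixed, and all number fields are subfields of this $\bar{\mathbb{Q}}$; ''distinct'' means distinct as subfields of $\bar{\mathbb{Q}}$. For points $P_1,\ldots,P_N\in X(\bar{\mathbb{Q}})$, $\mathbb{Q}(P_1,\ldots,P_N)$ denotes the subfield of $\bar{\mathbb{Q}}$ generated over $\mathbb{Q}$ by the coordinates of these points. An element $\alpha\in\bar{\mathbb{Q}}\cup\{\infty\}$ is called a critical value (or branch point) of $t\in\bar{\mathbb{Q}}(X)$ if the rational function $t-\alpha$ has at least one multiple zero in $X(\bar{\mathbb{Q}})$, with the convention $t-\infty=t^{-1}$. A critical value is finite if it is not $\infty$. An abelian field extension is a Galois extension with abelian Galois group. *)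

(* Defs.v *)
From HB Require Import structures.
From mathcomp Require Import all_boot all_order all_algebra all_fingroup.
From mathcomp Require Import all_field ring_quotient mpoly.
From mathcomp Require Import boolp classical_sets.

Set Implicit Arguments.
Unset Strict Implicit.
Unset Printing Implicit Defensive.

Import Order.TTheory GRing.Theory Num.Theory.

Local Open Scope ring_scope.
Local Open Scope classical_set_scope.

(* The fixed algebraic closure of Q is algC. Subfields of a field are
   represented by their carriers, as sets. *)

Definition is_subfield (L : fieldType) (K : set L) : Prop :=
  GRing.divring_closed [pred x | x \in K].

Definition gen_subfield (L : fieldType) (A : set L) : set L :=
  smallest (@is_subfield L) A.

(* [number_field_degree K d]: the subfield K of algC is a finite extension of Q
   of degree d. *)
Definition number_field_degree (K : set algC) (d : nat) : Prop :=
  exists (E : fieldExtType rat) (phi : {rmorphism E -> algC}),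
    range phi = K /\ \dim {:E} = d.

(* [finite_abelian_ext K L], for subfields K and L of a common field M: L / K is
   a finite Galois extension with abelian Galois group. [phi] identifies the
   abstract extension E / F with L / K. *)
Definition finite_abelian_ext (M : fieldType) (K L : set M) : Prop :=
  exists (F : fieldType) (E : splittingFieldType F) (phi : {rmorphism E -> M}),
    [/\ range phi = L, phi @` [set` (1%VS : {vspace E})] = K,
        galois 1 {:E} & abelian 'Gal({:E} / 1)].

Definition alg_independent (k M : fieldType) (iota : {rmorphism k -> M})
    (n : nat) (f : 'I_n -> M) : Prop :=
  forall p : {mpoly k[n]}, mmap iota f p = 0 -> p = 0.

Definition has_trdeg (k M : fieldType) (iota : {rmorphism k -> M})
    (L : set M) (n : nat) : Prop :=
  (exists f : 'I_n -> M, (forall i, L (f i)) /\ alg_independent iota f) /\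
  (forall f : 'I_n.+1 -> M, (forall i, L (f i)) -> ~ alg_independent iota f).

Notation to_algC := (map_mpoly (ratr : rat -> algC)).

(* A point of the projective zero locus of [eqs] over algC, given by homogeneous
   coordinates. Two such points may be proportional, hence equal in projective
   space; all notions below are invariant under rescaling. *)
Record ppoint (n : nat) (eqs : seq {mpoly rat[n]}) := PPoint {
  hcoord :> 'I_n -> algC;
  _ : exists i, hcoord i != 0;
  _ : forall f, f \in eqs -> (to_algC f).@[hcoord] = 0 }.

(* As algC is infinite, a polynomial vanishes at all nonzero homogeneous
   coordinate vectors of the points iff all its homogeneous components do, so
   that this is the usual homogeneous ideal of the zero locus. *)
Definition vanishing (n : nat) (eqs : seq {mpoly rat[n]}) :
    pred {mpoly algC[n]} :=
  fun F => `[< forall P : ppoint eqs, F.@[P] = 0 >].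
Arguments vanishing [n] eqs.

(* A geometrically irreducible closed subset, in the projective space of
   dimension [pdim], of zeros of homogeneous polynomials over Q: its homogeneous
   ideal over algC is prime (and proper, the zero locus being nonempty). *)
Record variety := Variety {
  pdim : nat;
  eqns : seq {mpoly rat[pdim.+1]};
  _ : forall f, f \in eqns -> exists d : nat, f \is d.-homog;
  variety_inhabited : inhabited (ppoint eqns);
  variety_prime : prime_idealr_closed (vanishing eqns) }.

Definition var_point (X : variety) := ppoint (eqns X).

Definition ideal_of (X : variety) : pred {mpoly algC[(pdim X).+1]} :=
  vanishing (eqns X).
Arguments ideal_of X : clear implicits.

Section CoordRing.
Variable X : variety.

Lemma ideal_of_closed : idealr_closed (ideal_of X).
Proof.
split=> [||a F G].
- by apply/asboolP => P; rewrite meval0.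
- have [P] := variety_inhabited X.
  by apply/asboolP => /(_ P)/eqP; rewrite meval1 oner_eq0.
- move=> /asboolP F0 /asboolP G0; apply/asboolP => P.
  by rewrite mevalD mevalM F0 G0 mulr0 addr0.
Qed.

HB.instance Definition _ := isIdealr.Build _ (ideal_of X) ideal_of_closed.
HB.instance Definition _ :=
  isPrimeIdealrClosed.Build _ (ideal_of X) (@variety_prime X).

Definition coord_ideal : prime_idealr _ := PrimeIdealr.clone _ (ideal_of X) _.

Definition coord_ring : Type := {ideal_quot coord_ideal}.

HB.instance Definition _ := GRing.ComNzRing.on coord_ring.

Definition coord_unit : pred coord_ring := fun x => `[< exists y, y * x = 1 >].

Definition coord_inv (x : coord_ring) : coord_ring :=
  if pselect (exists y, y * x = 1) is left h then sval (cid h) else x.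

Lemma coord_mulVx : {in coord_unit, left_inverse 1 coord_inv *%R}.
Proof.
move=> x /asboolP h; rewrite /coord_inv.
by case: pselect => // h'; by case: cid.
Qed.

Lemma coord_unitPl (x y : coord_ring) : y * x = 1 -> coord_unit x.
Proof. by move=> xy; apply/asboolP; exists y. Qed.

Lemma coord_inv_out : {in [predC coord_unit], coord_inv =1 id}.
Proof.
move=> x /asboolP h; rewrite /coord_inv.
by case: pselect.
Qed.

HB.instance Definition _ := GRing.ComNzRing_hasMulInverse.Build coord_ring
  coord_mulVx coord_unitPl coord_inv_out.

Lemma coord_integral (x y : coord_ring) : x * y = 0 -> (x == 0) || (y == 0).
Proof. exact: Quotient.rquot_IdomainAxiom. Qed.

HB.instance Definition _ :=
  GRing.ComUnitRing_isIntegral.Build coord_ring coord_integral.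

Definition to_coord (F : {mpoly algC[(pdim X).+1]}) : coord_ring :=
  \pi_({ideal_quot coord_ideal})%qT F.

Lemma to_coord_is_zmod_morphism : zmod_morphism to_coord.
Proof. exact: rmorphB. Qed.

Lemma to_coord_is_monoid_morphism : monoid_morphism to_coord.
Proof. by split; [exact: rmorph1 | exact: rmorphM]. Qed.

HB.instance Definition _ :=
  GRing.isZmodMorphism.Build _ coord_ring to_coord to_coord_is_zmod_morphism.
HB.instance Definition _ :=
  GRing.isMonoidMorphism.Build _ coord_ring to_coord
    to_coord_is_monoid_morphism.

End CoordRing.

(* The fraction field of the homogeneous coordinate ring over algC. It contains
   the function field of X over algC as the subfield of elements of degree 0. *)
Definition hfrac (X : variety) : fieldType := {fraction (coord_ring X)}.

Definition to_hfrac (X : variety) :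
    {rmorphism {mpoly algC[(pdim X).+1]} -> hfrac X} :=
  (@tofrac (coord_ring X)) \o (@to_coord X).
Arguments to_hfrac X : clear implicits.

Definition cst_hfrac (X : variety) : {rmorphism algC -> hfrac X} :=
  to_hfrac X \o @mpolyC _ algC.
Arguments cst_hfrac X : clear implicits.

Definition represents (X : variety) (f : hfrac X)
    (F G : {mpoly algC[(pdim X).+1]}) : Prop :=
  [/\ exists d : nat, F \is d.-homog /\ G \is d.-homog,
      ~~ ideal_of X G & f = to_hfrac X F / to_hfrac X G].

(* The function field of X over algC, and the function field of X over Q as a
   subfield of it (X being geometrically integral). *)
Definition funfield (X : variety) : set (hfrac X) :=
  [set f | exists F G, represents f F G].
Arguments funfield X : clear implicits.

Definition funfieldQ (X : variety) : set (hfrac X) :=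
  [set f | exists F G, represents f (to_algC F) (to_algC G)].
Arguments funfieldQ X : clear implicits.

Definition jacobian (X : variety) (P : var_point X) :
    'M[algC]_(size (eqns X), (pdim X).+1) :=
  \matrix_(i, j) (to_algC (mderiv j (nth 0 (eqns X) i))).@[P].

(* Dimension 1 is the transcendence degree of the function field over algC.
   Smoothness is the Jacobian criterion at every point: the rank of the Jacobian
   matrix of the homogeneous equations is the codimension [pdim - 1]. *)
Record curve := Curve {
  curve_variety :> variety;
  _ : has_trdeg (cst_hfrac curve_variety) (funfield curve_variety) 1;
  _ : forall P : var_point curve_variety,
      (\rank (jacobian P) + 1)%N = pdim curve_variety }.

(* [has_value f P a]: f is regular at P, and f(P) = a. *)
Definition has_value (X : variety) (f : hfrac X) (P : var_point X) (a : algC) :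
    Prop :=
  exists F G, [/\ represents f F G, G.@[P] != 0 & a = F.@[P] / G.@[P]].

(* f belongs to the square of the maximal ideal of the local ring at P. *)
Definition multiple_zero (X : variety) (f : hfrac X) (P : var_point X) : Prop :=
  exists (k : nat) (u v : 'I_k -> hfrac X),
    (forall i, has_value (u i) P 0 /\ has_value (v i) P 0) /\
    f = \sum_i u i * v i.

(* The value [None] stands for infinity. *)
Definition critical_value (X : variety) (t : hfrac X) (alpha : option algC) :
    Prop :=
  exists P : var_point X,
    multiple_zero (if alpha is Some a then t - cst_hfrac X a else t^-1) P.

(* The field generated over Q by the ratios of the homogeneous coordinates of
   the points in A. *)
Definition point_field (X : variety) (A : set (var_point X)) : set algC :=
  gen_subfield
    [set x | exists2 P, A P & exists i j, P j != 0 /\ x = P i / P j].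

(* Main.v *)
Require Import Defs.
From HB Require Import structures.
From mathcomp Require Import all_boot all_order all_algebra all_fingroup.
From mathcomp Require Import cyclic all_field mpoly.
From mathcomp Require Import boolp classical_sets reals sequences exp.
From mathcomp Require Import ring zify.

Set Implicit Arguments.
Unset Strict Implicit.
Unset Printing Implicit Defensive.

Import Order.TTheory GRing.Theory Num.Theory.

Local Open Scope ring_scope.
Local Open Scope classical_set_scope.

(** Let m be the number of distinct fields among Q(P_1), ..., Q(P_N).

    If the covering t : X -> P^1 satisfies the additional hypothesis of the
    first assertion, the compositum of these fields has degree at least
    exp(c N). On the other hand each of them is generated by a bounded number
    of ratios of coordinates, and these have bounded degree: a ratio of
    coordinate functions is algebraic over Q(t), and the relation that it
    satisfies can be specialised at t = n ([points_degree]). So the compositum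
    has degree at most K^m for a constant K, and m is at least a constant
    times N ([degree_le_diversity]).

    Otherwise the function field of X over the algebraic numbers is an abelian
    extension of the field of rational functions of t, all finite critical
    values are rational, and the fields Q(P_n) can be compared by means of
    ramification. By Kummer theory every function is a sum of terms h(t) z, where
    z^e is a product of powers (t - a)^(m a) whose exponents are not divisible
    by e ([kummer_decomposition], [radical_normal_form]). Each a is a critical
    value ([kummer_root_critical]), hence rational. At the points P_n the
    radicals z take values whose e-th powers are rational, and over a fixed
    number field k they generate the same field as P_n ([specialise]). If
    Q(P_n) = Q(P_m), Kummer theory over k then shows that a large prime
    dividing the numerator of some n - a exactly once also divides the numerator
    of some m - b ([radical_valuation]). For a positive proportion of n all the
    numerators of the n - a are free of squares of large primes
    ([square_free_values]); their product is then determined by the field, up to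
    a factor that is constant on a suitable arithmetic progression, and n is
    determined by this product ([fields_from_ramification]). There is at least
    one a, since otherwise every function in Q(X) would be rational in t.

    That a is a critical value is proved at the centre P of a place of the
    function field at which t = a. As P is a smooth point, all functions
    vanishing at P are multiples of a single one ([uniformizer]), so that
    functions have an order at P. If t - a does not vanish to order 2,
    comparing orders in z^e = (t - a)^(m a) q(t) shows that e divides m a.

    The passages from algebraic to rational coefficients rest on the fact that
    rational functions over Q that are linearly dependent over the algebraic
    numbers are dependent over Q ([linear_relation_descent]). *)

(** * Radicals over finitely generated fields of algebraic numbers *)

(** The roots of the minimal polynomial of w generate a Galois extension of Q,
    and the elements of its Galois group extend to automorphisms of algC. *)
Lemma fixed_by_aut_rat (w : algC) :
  (forall nu : {rmorphism algC -> algC}, nu w = w) -> w \in Crat.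
Proof.
move=> fix_w; have [r Dr] := closed_field_poly_normal (minCpoly w).
have [q [Dq mon_q] dv_q] := minCpolyP w.
rewrite (monicP (minCpoly_monic w)) scale1r in Dr.
have [Qs [QsC [s1 Ds gens]]] := num_field_exists r.
have Qs_ax : FieldExt_isSplittingField _ Qs.
  constructor; exists (map_poly (in_alg Qs) q).
    by apply/polyOverP=> i; rewrite coef_map memvZ ?memv_line.
  exists s1; last exact: gens.
  congr (_ %= _): (eqpxx (map_poly (in_alg Qs) q)); apply/(map_poly_inj QsC).
  rewrite -map_poly_comp.
  have -> : map_poly (QsC \o in_alg Qs) q = map_poly ratr q.
    by apply: eq_map_poly => a /=; rewrite rmorphZ_num rmorph1 mulr1.
  rewrite -Dq Dr -Ds big_map rmorph_prod /=; apply: eq_bigr => zz _.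
  by rewrite map_polyXsubC.
pose L := HB.pack_for (splittingFieldType rat) Qs Qs_ax.
have galL : galois 1 {:L}.
  apply/and3P; split; [exact: subvf | | exact: normalFieldf].
  apply/separableP => y _; apply: pcharf0_separable.
  by move=> p; rewrite pchar_lalg; apply: pchar_num.
have [ww Dw] : exists ww : L, QsC ww = w.
  have : w \in r by rewrite -root_prod_XsubC -Dr root_minCpoly.
  by rewrite -Ds => /mapP[ww _ ->]; exists ww.
have : ww \in fixedField 'Gal({:L} / 1)%g.
  apply/fixedFieldP => [|s _]; first exact: memvf.
  have [nu Dnu] := extend_algC_subfield_aut QsC s.
  by apply: (fmorph_inj QsC); rewrite Dnu Dw fix_w.
rewrite (galois_fixedField galL) => /vlineP[a Da].
by rewrite -Dw Da rmorphZ_num rmorph1 mulr1 Crat_rat.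
Qed.

Lemma finite_words (T : eqType) (A : seq T) (n : nat) :
  exists L : seq (seq T), forall l, size l = n -> {subset l <= A} -> l \in L.
Proof.
elim: n => [|n [L HL]].
  by exists [:: [::]] => l /size0nil->; rewrite inE.
exists [seq x :: l | x <- A, l <- L] => -[|x l] // [sz_l] sub_l.
apply/allpairsP; exists (x, l); split=> //=; first by apply: sub_l; rewrite mem_head.
by apply: HL => // y ly; apply: sub_l; rewrite inE ly orbT.
Qed.

Lemma finite_classes (T U : eqType) (P : T -> Prop) (f : T -> U) (M : seq U) :
  (forall x, P x -> f x \in M) ->
  exists cs : seq T, (forall c, c \in cs -> P c) /\
    forall x, P x -> exists2 c, c \in cs & f x = f c.
Proof.
elim: M P => [|u M IH] P PM; first by exists [::]; split=> // x /PM.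
have PM' x : P x /\ f x != u -> f x \in M.
  by case=> /PM; rewrite inE => /orP[->|].
have [cs [csP csM]] := IH _ PM'.
have [[x0 [Px0 fx0]]|noP] := pselect (exists x, P x /\ f x = u).
- exists (x0 :: cs); split=> [c|x Px].
    by rewrite inE => /orP[/eqP->//|/csP[]].
  have [fx|nfx] := eqVneq (f x) u; first by exists x0; rewrite ?mem_head ?fx0.
  by have [c cs_c Dc] := csM x (conj Px nfx); exists c; rewrite ?inE ?cs_c ?orbT.
exists cs; split=> [c /csP[]//|x Px]; apply: csM; split=> //.
by apply/eqP=> fx; apply: noP; exists x.
Qed.

Definition fixes (s : seq algC) (nu : {rmorphism algC -> algC}) : Prop :=
  {in s, forall x, nu x = x}.

(** By Galois theory this says that c lies in the field generated by s; the
    arguments below only need this description by automorphisms. *)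
Definition fixed_by (s : seq algC) (c : algC) : Prop :=
  forall nu, fixes s nu -> nu c = c.

Lemma aut_expr_ratio (e : nat) (c : algC) (nu : {rmorphism algC -> algC}) :
  c != 0 -> c ^+ e \in Crat -> (nu c / c) ^+ e = 1.
Proof.
by move=> c0 /(aut_Crat nu); rewrite rmorphXn => Dc; rewrite expr_div_n Dc divff ?expf_neq0.
Qed.

Lemma fixed_by_agree (s : seq algC) (nu nu' : {rmorphism algC -> algC}) (c : algC) :
  {in s, nu =1 nu'} -> fixed_by s c -> nu c = nu' c.
Proof.
move=> eq_s fix_c; have : (algC_invaut nu' \o nu) c = c.
  by apply: (fix_c (algC_invaut nu' \o nu : {rmorphism _ -> _})) => x sx; rewrite /= eq_s // algC_autK.
by move=> /= {2}<-; rewrite algC_invautK.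
Qed.

(** Since only rational numbers are fixed by all automorphisms, c is determined
    up to a rational factor by the e-th roots of unity nu c / c. For c in the
    field generated by s these depend only on the values of nu on s, for which
    there are finitely many possibilities. *)
Lemma finite_radicals (s : seq algC) (e : nat) : (0 < e)%N ->
  exists cs : seq algC, (forall c, c \in cs -> c != 0 /\ c ^+ e \in Crat) /\
    forall c, fixed_by s c -> c != 0 -> c ^+ e \in Crat ->
      exists2 c', c' \in cs & c / c' \in Crat.
Proof.
move=> e_gt0.
have [zeta prim_z] := C_prim_root_exists e_gt0.
have [r Dr] : {r : algC -> seq algC | forall x, minCpoly x = \prod_(y <- r x) ('X - y%:P)}.
  have H x : {r : seq algC | minCpoly x = \prod_(y <- r) ('X - y%:P)}.
    have [r ->] := closed_field_poly_normal (minCpoly x).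
    by exists r; rewrite (monicP (minCpoly_monic x)) scale1r.
  by exists (fun x => sval (H x)) => x; case: (H x).
pose A := flatten [seq r x | x <- s].
have [L HL] := finite_words A (size s).
have nuL (nu : {rmorphism algC -> algC}) : map nu s \in L.
  apply: HL; first by rewrite size_map.
  move=> _ /mapP[x sx ->]; apply/flattenP; exists (r x); first exact: map_f.
  by rewrite -root_prod_XsubC -Dr -(minCpoly_aut nu) root_minCpoly.
have [g Hg] : exists g : seq algC -> {rmorphism algC -> algC},
    forall l (nu : {rmorphism algC -> algC}), map nu s = l -> map (g l) s = l.
  pose h l := if pselect (exists nu : {rmorphism algC -> algC}, map nu s = l) is left ex
    then projT1 (cid ex) else idfun.
  exists h => l nu Dnu; rewrite /h; case: pselect => [ex|[]]; last by exists nu.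
  by case: (cid ex).
pose P c := [/\ fixed_by s c, c != 0 & c ^+ e \in Crat].
pose f c := [seq g l c / c | l <- L].
have [M HM] := finite_words [seq zeta ^+ i | i <- iota 0 e] (size L).
have [|cs [csP csM]] := @finite_classes _ _ P f M.
  move=> c [_ c0 ce]; apply: HM; first by rewrite size_map.
  move=> _ /mapP[l _ ->]; have /(prim_rootP prim_z)[i ->] := aut_expr_ratio (g l) c0 ce.
  by apply/mapP; exists (i : nat); rewrite ?mem_iota ?ltn_ord.
exists cs; split=> [c /csP[]//|c fix_c c0 ce].
have [c' cs_c' Df] := csM c (And3 fix_c c0 ce); exists c' => //.
have [fix_c' c'0 _] := csP _ cs_c'.
apply: fixed_by_aut_rat => nu.
have eq_s : {in s, nu =1 g (map nu s)}.
  by move=> x sx; have /esym/eq_in_map := Hg _ nu erefl; apply.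
rewrite fmorph_div /= (fixed_by_agree eq_s fix_c) (fixed_by_agree eq_s fix_c').
have /eq_in_map/(_ _ (nuL nu)) Dg := Df.
set u := g _ c in Dg *; set v := g _ c' in Dg *.
have v0 : v != 0 by rewrite fmorph_eq0.
have -> : u = v / c' * c by rewrite -Dg divfK.
by field; rewrite c'0 v0.
Qed.

(** * Valuations of radicals *)

(** The p-adic valuation, with the default value 0 at r = 0. *)
Definition vp (p : nat) (r : rat) : int :=
  (logn p `|numq r|)%:Z - (logn p `|denq r|)%:Z.

Lemma vp_frac (p : nat) (a b : int) : a != 0 -> b != 0 ->
  vp p (a%:Q / b%:Q) = (logn p `|a|)%:Z - (logn p `|b|)%:Z.
Proof.
move=> a0 b0; set r := a%:Q / b%:Q; rewrite /vp.
have r0 : r != 0 by rewrite mulf_neq0 ?invr_eq0 ?intr_eq0.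
have n0 : numq r != 0 by rewrite numq_eq0.
have Dr : numq r * b = a * denq r.
  apply/eqP; rewrite -(eqr_int rat) !rmorphM /= numqE /r.
  by apply/eqP; field; rewrite intr_eq0.
have := congr1 (fun z : int => logn p `|z|%N) Dr.
by rewrite !abszM !lognM ?absz_gt0 ?denq_neq0 // => /(congr1 Posz); lia.
Qed.

Lemma vpM p (r s : rat) : r != 0 -> s != 0 -> vp p (r * s) = vp p r + vp p s.
Proof.
move=> r0 s0; have -> : r * s = (numq r * numq s)%:Q / (denq r * denq s)%:Q.
  by rewrite -[in LHS](divq_num_den r) -[in LHS](divq_num_den s) !rmorphM /= mulf_div.
rewrite vp_frac ?mulf_neq0 ?numq_eq0 ?denq_neq0 //.
rewrite !abszM !lognM ?absz_gt0 ?numq_eq0 ?denq_neq0 // /vp.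
by rewrite !PoszD; ring.
Qed.

Lemma vp1 p : vp p 1%R = 0. Proof. by rewrite /vp /= logn1. Qed.

Lemma vpX p (r : rat) n : r != 0 -> vp p (r ^+ n) = n%:Z * vp p r.
Proof.
move=> r0; elim: n => [|n IH]; first by rewrite expr0 vp1 mul0r.
by rewrite exprS vpM ?expf_neq0 // IH; lia.
Qed.

Lemma vpV p (r : rat) : r != 0 -> vp p r^-1 = - vp p r.
Proof.
move=> r0; have : vp p (r^-1 * r) = 0 by rewrite mulVf // vp1.
by rewrite vpM ?invr_eq0 //; lia.
Qed.

Lemma vp_eq0 p r : (`|numq r| < p)%N -> (`|denq r| < p)%N -> vp p r = 0.
Proof.
move=> n_lt d_lt; rewrite /vp; have small m : (m < p)%N -> logn p m = 0%N.
  case: m => [|m] lt_m; first by rewrite logn0.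
  by rewrite lognE gtnNdvd // !andbF.
by rewrite !small.
Qed.

(** Modulo e, the first components of the pairs in R are the multiples of a
    divisor g of e, and the second component of a pair (g, b) gives the slope. *)
Lemma additive_relation_linear (e : nat) (R : nat -> nat -> Prop) : (0 < e)%N ->
  R 0%N 0%N ->
  (forall i b j c, R i b -> R j c -> R (i + j)%N (b + c)%N) ->
  (forall i j b, i = j %[mod e] -> R i b -> R j b) ->
  (forall i b, R i b -> (e %| i)%N -> (e %| b)%N) ->
  exists a : nat, forall i b, R i b -> b = (a * i)%N %[mod e].
Proof.
move=> e_gt0 R0 RD Rmod Re.
have RM n i c : R i c -> R (n * i)%N (n * c)%N.
  by move=> Ric; elim: n => [|n IH] //; rewrite !mulSn; apply: RD.
have Ree : R e 0%N by apply: Rmod R0; rewrite modnn mod0n.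
have exP : exists i, (0 < i)%N && `[< exists b, R i b >].
  by exists e; rewrite e_gt0; apply/asboolP; exists 0%N.
case: (ex_minnP exP) => g /andP[g_gt0 /asboolP[b Rgb]] g_min.
have gdiv i c : R i c -> (g %| i)%N.
  move=> Ric; rewrite /dvdn; apply: contraT; rewrite -lt0n => r_gt0.
  suff : (g <= i %% g)%N by rewrite leqNgt ltn_pmod.
  apply: g_min; rewrite r_gt0; apply/asboolP.
  exists (c + e.-1 * (i %/ g) * b)%N; apply: Rmod (RD _ _ _ _ Ric (RM _ _ _ Rgb)).
  have -> : (i + e.-1 * (i %/ g) * g = i %/ g * g * e + i %% g)%N.
    by rewrite {1}(divn_eq i g) addnAC -mulnA -mulSn prednK // mulnC.
  by rewrite modnMDl.
have g_e := gdiv _ _ Ree.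
have g_b : (g %| b)%N.
  have := Re _ _ (RM (e %/ g)%N _ _ Rgb); rewrite divnK // => /(_ (dvdnn e)).
  rewrite -{1}(divnK g_e) dvdn_pmul2l // divn_gt0 //.
  exact: dvdn_leq.
exists (b %/ g)%N => i c Ric; have /dvdnP[q Dq] := gdiv _ _ Ric.
have -> : (b %/ g * i = q * b)%N by rewrite Dq mulnCA divnK.
have := Re _ _ (RD _ _ _ _ Ric (RM (e.-1 * q)%N _ _ Rgb)).
rewrite Dq -mulnA -mulSn prednK // dvdn_mulr // => /(_ isT) e_dvd.
apply/eqP; rewrite -(eqn_modDr (e.-1 * q * b)) (eqP e_dvd).
by rewrite -mulnA -mulSn prednK // modnMr.
Qed.

(** Automorphisms over the field generated by s multiply v and w by powers of
    zeta, and the exponent for w vanishes modulo e whenever the exponent for v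
    does; so it is a constant multiple of it. *)
Lemma kummer_single_radical (e : nat) (zeta : algC) (s : seq algC) (v w : algC) :
  (0 < e)%N -> e.-primitive_root zeta -> zeta \in s ->
  v != 0 -> w != 0 -> v ^+ e \in Crat -> w ^+ e \in Crat ->
  fixed_by (v :: s) w -> exists a : nat, fixed_by s (w / v ^+ a).
Proof.
move=> e_gt0 prim_z s_z v0 w0 ve we fix_w.
pose R i b := exists2 nu : {rmorphism algC -> algC}, fixes s nu &
  nu v = zeta ^+ i * v /\ nu w = zeta ^+ b * w.
have ze : zeta ^+ e = 1 := prim_expr_order prim_z.
have [|||| a Da] := @additive_relation_linear e R e_gt0.
- by exists idfun => //; rewrite !mul1r.
- move=> i b j c [nu fnu [nuv nuw]] [mu fmu [muv muw]].
  exists (nu \o mu : {rmorphism _ -> _}) => [x sx|] /=; first by rewrite fmu ?fnu.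
  by rewrite muv muw !rmorphM !rmorphXn /= fnu // nuv nuw !exprD; split; ring.
- move=> i j b eq_ij [nu fnu [nuv nuw]]; exists nu => //; split=> //.
  by rewrite nuv -(prim_expr_mod prim_z) eq_ij prim_expr_mod.
- move=> i b [nu fnu [nuv nuw]] /dvdnP[k Dk].
  have : nu w = w.
    apply: fix_w => x; rewrite inE => /orP[/eqP->|/fnu//].
    by rewrite nuv Dk mulnC exprM ze expr1n mul1r.
  rewrite nuw -[RHS]mul1r => /(mulIf w0)/eqP.
  by rewrite -(prim_order_dvd prim_z).
exists a => nu fnu.
have /(prim_rootP prim_z)[i Di] := aut_expr_ratio nu v0 ve.
have /(prim_rootP prim_z)[b Db] := aut_expr_ratio nu w0 we.
have nuv : nu v = zeta ^+ i * v by rewrite -Di divfK.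
have nuw : nu w = zeta ^+ b * w by rewrite -Db divfK.
have eq_b : zeta ^+ b = zeta ^+ (a * i).
  by rewrite -(prim_expr_mod prim_z) (Da i b) ?prim_expr_mod //; exists nu.
have za0 : (zeta ^+ i) ^+ a != 0.
  by rewrite -exprM expf_neq0 //; apply: contra_eq_neq ze => ->; rewrite expr0n gtn_eqF // eq_sym oner_eq0.
rewrite fmorph_div rmorphXn /= nuw nuv eq_b exprMn -exprM mulnC exprM.
by field; rewrite za0 expf_neq0.
Qed.

(** Kummer theory removes the radicals vs one at a time, and turns w into an
    element c of the field generated by s whose e-th power is rational. By
    [finite_radicals] there are finitely many such c up to a rational factor,
    and such a factor changes the valuation of c^e by a multiple of e. So this
    valuation is divisible by e at every large prime. *)
Theorem radical_valuation (e : nat) (zeta : algC) (s : seq algC) :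
  (0 < e)%N -> e.-primitive_root zeta -> zeta \in s ->
  exists p0 : nat, forall (vs : seq algC) (rs : seq rat) (w : algC) (r : rat),
    [seq v ^+ e | v <- vs] = [seq ratr r | r <- rs] ->
    0 \notin rs -> w ^+ e = ratr r -> r != 0 ->
    fixed_by (vs ++ s) w ->
    forall p, (p0 < p)%N -> (forall r', r' \in rs -> vp p r' = 0) ->
    (e %| vp p r)%Z.
Proof.
move=> e_gt0 prim_z s_z; have [cs [csP csM]] := finite_radicals s e_gt0.
have expR_eq0 (x : algC) (q : rat) : x ^+ e = ratr q -> (x == 0) = (q == 0).
  move=> Dx; rewrite -(fmorph_eq0 (@ratr algC : {rmorphism rat -> algC}) q) /= -Dx.
  by rewrite expf_eq0 e_gt0.
pose h c := getCrat (c ^+ e).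
exists (\max_(c <- cs) maxn `|numq (h c)| `|denq (h c)|).
elim=> [|v vs IH] [|r1 rs] w r //=; last first.
  move=> [Dv Dvs]; rewrite inE negb_or => /andP[r10 rs0] Dw r0 fix_w p p_gt p_rs.
  have v0 : v != 0 by rewrite (expR_eq0 _ _ Dv) eq_sym.
  have w0 : w != 0 by rewrite (expR_eq0 _ _ Dw).
  have vs_z : zeta \in vs ++ s by rewrite mem_cat s_z orbT.
  have ve : v ^+ e \in Crat by rewrite Dv Crat_rat.
  have we : w ^+ e \in Crat by rewrite Dw Crat_rat.
  have [a fix_wa] := kummer_single_radical e_gt0 prim_z vs_z v0 w0 ve we fix_w.
  have := IH rs (w / v ^+ a) (r / r1 ^+ a) Dvs rs0 _ _ fix_wa p p_gt.
  rewrite expr_div_n exprAC Dw Dv fmorph_div rmorphXn /=.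
  rewrite mulf_neq0 ?invr_eq0 ?expf_neq0 // 1?eq_sym //.
  rewrite vpM ?invr_eq0 ?expf_neq0 // 1?eq_sym // vpV ?expf_neq0 // 1?eq_sym //.
  rewrite vpX 1?eq_sym // (p_rs r1) ?mem_head // mulr0 subr0; apply=> // r' rs_r'.
  by apply: p_rs; rewrite inE rs_r' orbT.
move=> _ _ Dw r0 fix_w p p_gt _.
have w0 : w != 0 by rewrite (expR_eq0 _ _ Dw).
have [|c cs_c /CratP[q Dq]] := csM w fix_w w0; first by rewrite Dw Crat_rat.
have [c0 ce] := csP c cs_c.
have Dh : c ^+ e = ratr (h c) by rewrite /h getCratK.
have h0 : h c != 0 by rewrite -(expR_eq0 _ _ Dh).
have q0 : q != 0 by rewrite -(fmorph_eq0 (@ratr algC : {rmorphism rat -> algC}) q) /= -Dq mulf_neq0 ?invr_eq0.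
have -> : r = q ^+ e * h c.
  apply: (fmorph_inj (ratr : {rmorphism rat -> algC})).
  by rewrite rmorphM rmorphXn /= -Dq -Dh -Dw expr_div_n divfK ?expf_neq0.
have : (maxn `|numq (h c)| `|denq (h c)| < p)%N.
  by apply: leq_ltn_trans p_gt; rewrite (leq_bigmax_seq c).
rewrite gtn_max => /andP[n_lt d_lt].
by rewrite vpM ?expf_neq0 // vpX // (vp_eq0 n_lt d_lt) addr0 dvdz_mulr.
Qed.

(** * Square-free values of linear forms *)

(** Elements of one residue class are separated by their quotients by D. *)
Lemma count_residue (D T : nat) (P : pred nat) : (0 < D)%N ->
  (forall k k', P k -> P k' -> k = k' %[mod D]) ->
  (count P (iota 0 T) <= (T %/ D).+1)%N.
Proof.
move=> D_gt0 Pmod; rewrite -size_filter -(size_map (divn^~ D)).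
rewrite -[leqRHS](size_iota 0); apply: uniq_leq_size.
  rewrite map_inj_in_uniq ?filter_uniq ?iota_uniq // => k k'.
  rewrite !mem_filter => /andP[Pk _] /andP[Pk' _] eq_div.
  by rewrite (divn_eq k D) (divn_eq k' D) (Pmod k k') // eq_div.
move=> _ /mapP[k kT ->]; move: kT; rewrite mem_filter !mem_iota => /andP[_ /=].
rewrite !add0n => lt_kT.
by rewrite ltnS leq_div2r // ltnW.
Qed.

Lemma count_has_le (I : eqType) (s : seq I) (P : I -> pred nat) (Q : pred nat) l :
  (forall k, k \in l -> Q k -> has (P^~ k) s) ->
  (count Q l <= \sum_(x <- s) count (P x) l)%N.
Proof.
elim: l => [|k l IH] QP; first by rewrite big1.
rewrite /= big_split leq_add //=; last first.
  by apply: IH => k' lk'; apply: QP; rewrite inE lk' orbT.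
case Qk: (Q k) => //; have /hasP[x sx Px] := QP k (mem_head _ _) Qk.
by rewrite (big_rem x sx) /= Px.
Qed.

(** The sum telescopes, as 1 / (x + 1)^2 is at most 1 / x - 1 / (x + 1). *)
Lemma sum_inv_squares (q m : nat) : (0 < q)%N ->
  \sum_(i < m) ((q + i).+1%:R ^- 2) <= q%:R^-1 - (q + m)%:R^-1 :> rat.
Proof.
move=> q_gt0; elim: m => [|m IH]; first by rewrite big_ord0 addn0 subrr.
rewrite big_ord_recr /=; apply: (le_trans (lerD IH (lexx _))).
have : 0 < (q + m)%:R :> rat by rewrite ltr0n; lia.
have : 0 < q%:R :> rat by rewrite ltr0n.
rewrite addnS -!natr1; move: (q%:R) ((q + m)%:R) => y x y0 x0.
rewrite -subr_ge0.
have -> : y^-1 - (x + 1)^-1 - (y^-1 - x^-1 + (x + 1) ^- 2) = (x * (x + 1) ^+ 2)^-1.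
  by field; rewrite !gt_eqF ?addr_gt0.
by rewrite invr_ge0 mulr_ge0 ?exprn_ge0 ?addr_ge0 ?(ltW x0).
Qed.

Definition square_free_above (q : nat) (lf : seq (nat * nat)) (k : nat) : bool :=
  `[< forall AB p, AB \in lf -> prime p -> (q < p)%N -> ~~ (p ^ 2 %| AB.1 + AB.2 * k)%N >].

(** For each of the r forms a prime p > q excludes at most T / p^2 + 1 of the
    k < T, since it does not divide the slope. The sum of 1 / p^2 over p > q is
    at most 1 / q, and p^2 is bounded by a constant times T. So at most
    r T / q + O(sqrt T) of the k are excluded, and r / q is at most 1 / 2. *)
Lemma square_free_values (q : nat) (lf : seq (nat * nat)) :
  (0 < q)%N -> (2 * size lf <= q)%N ->
  (forall AB, AB \in lf -> (0 < AB.1)%N) ->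
  (forall AB p, AB \in lf -> prime p -> (q < p)%N -> ~~ (p %| AB.2)%N) ->
  exists T0 : nat, forall T : nat, (T0 <= T)%N ->
    (T <= 4 * count (square_free_above q lf) (iota 0 T))%N.
Proof.
move=> q_gt0 q_ge A_gt0 B_cop; set r := size lf in q_ge.
pose C := (\sum_(AB <- lf) (AB.1 + AB.2)).+1.
exists (16 * r ^ 2 * C).+1 => T T_ge; set good := square_free_above q lf.
have T_gt0 : (0 < T)%N by lia.
(* a prime whose square divides a value at some k < T is at most K *)
have [K K2_le K2_gt] : exists2 K, (K ^ 2 <= C * T)%N & (C * T < K.+1 ^ 2)%N.
  have ex0 : exists K, (K ^ 2 <= C * T)%N by exists 0%N.
  have bnd K : (K ^ 2 <= C * T)%N -> (K <= C * T)%N.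
    by apply: leq_trans; case: K => // K; rewrite -mulnn leq_pmulr.
  case: (ex_maxnP ex0 bnd) => K K2 Kmax; exists K => //.
  by rewrite ltnNge; apply/negP => /Kmax; rewrite ltnn.
pose S := [seq (AB, p) | AB <- lf, p <- iota q.+1 K].
pose bad (x : nat * nat * nat) k := prime x.2 && (x.2 ^ 2 %| x.1.1 + x.1.2 * k)%N.
have bad_le : (count (predC good) (iota 0 T) <= \sum_(x <- S) count (bad x) (iota 0 T))%N.
  apply: count_has_le => k; rewrite mem_iota add0n /= => kT /asboolPn/existsNP[AB].
  move=> /existsNP[p] /not_implyP[lfAB] /not_implyP[p_pr] /not_implyP[qp] /negP/negPn p2.
  apply/hasP; exists (AB, p); last by rewrite /bad /= p_pr.
  apply/allpairsP; exists (AB, p); split=> //=; rewrite mem_iota qp /=.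
  suff : (p <= K)%N by lia.
  rewrite -ltnS -ltn_sqr; apply: leq_ltn_trans K2_gt.
  have A0 := A_gt0 _ lfAB; apply: leq_trans (dvdn_leq _ p2) _; first by lia.
  have : (AB.1 + AB.2 <= C)%N.
    by rewrite /C (big_rem AB lfAB) /=; lia.
  by nia.
have cnt x : x \in S -> (count (bad x) (iota 0 T) <= (T %/ x.2 ^ 2).+1)%N.
  case/allpairsP=> -[AB p] [/= lfAB]; rewrite mem_iota => /andP[qp _] ->.
  have [p_pr|np] := boolP (prime p); last first.
    by rewrite (eq_count (a2 := pred0)) ?count_pred0 // => k; rewrite /bad /= (negPf np).
  apply: count_residue => [|k k' /andP[_ /= dk] /andP[_ /= dk']].
    by rewrite expn_gt0 prime_gt0.
  have cop : coprime (p ^ 2) AB.2.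
    by rewrite coprimeXl // prime_coprime // B_cop.
  wlog le_kk' : k k' dk dk' / (k <= k')%N.
    by move=> W; have [/W->//|/ltnW/W<-//] := leqP k k'.
  apply/eqP; rewrite eq_sym eqn_mod_dvd // -(Gauss_dvdr _ cop).
  have -> : (AB.2 * (k' - k) = (AB.1 + AB.2 * k') - (AB.1 + AB.2 * k))%N by nia.
  exact: dvdn_sub.
have sum_le : (\sum_(x <- S) count (bad x) (iota 0 T) <= r * (\sum_(i < K) (T %/ (q + i).+1 ^ 2) + K))%N.
  have : (\sum_(x <- S) count (bad x) (iota 0 T) <= \sum_(x <- S) (T %/ x.2 ^ 2).+1)%N.
    by rewrite big_seq [leqRHS]big_seq; apply: leq_sum => x /cnt.
  move/leq_trans; apply; rewrite big_allpairs_dep /=.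
  rewrite (eq_bigr (fun=> \sum_(i < K) (T %/ (q + i).+1 ^ 2) + K)%N).
    by rewrite big_const_seq count_predT iter_addn_0 mulnC.
  move=> AB _; rewrite -[q.+1]addn0 iotaDl big_map.
  have -> : iota 0 K = index_iota 0 K by rewrite /index_iota subn0.
  rewrite big_mkord; under eq_bigr do rewrite -addn1.
  by rewrite big_split /= sum_nat_const card_ord muln1.
have tail : (2 * r * \sum_(i < K) (T %/ (q + i).+1 ^ 2) <= T)%N.
  rewrite -(ler_nat rat) natrM natr_sum.
  have : \sum_(i < K) (T %/ (q + i).+1 ^ 2)%:R <= T%:R / q%:R :> rat.
    apply: (@le_trans _ _ (T%:R * \sum_(i < K) ((q + i).+1%:R ^- 2))).
      rewrite mulr_sumr; apply: ler_sum => i _.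
      rewrite ler_pdivlMr ?exprn_gt0 ?ltr0n // -natrX -natrM ler_nat.
      exact: leq_trunc_div.
    rewrite ler_pM2l ?ltr0n //; apply: le_trans (sum_inv_squares K q_gt0) _.
    by rewrite gerBl invr_ge0 ler0n.
  rewrite ler_pdivlMr ?ltr0n // mulrC; apply: le_trans.
  by rewrite ler_wpM2r ?ler_nat // sumr_ge0 // => i _; rewrite ler0n.
have sqrt_le : (4 * r * K <= T)%N by rewrite -leq_sqr; nia.
have := count_predC good (iota 0 T); rewrite size_iota.
by nia.
Qed.

(** * Distinct fields from ramified primes *)

(** The numerator of n - a over the denominator of a, up to sign. *)
Definition lin_form (a : rat) (n : nat) : nat := absz (denq a * n%:Z - numq a)%R.

Lemma vp_sub_rat (p : nat) (a : rat) (n : nat) : (0 < lin_form a n)%N ->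
  vp p (n%:R - a) = (logn p (lin_form a n))%:Z - (logn p `|denq a|)%:Z.
Proof.
rewrite absz_gt0 => L0; rewrite -vp_frac ?denq_neq0 //; congr vp.
rewrite rmorphB rmorphM /= numqE -pmulrn; field.
by rewrite intr_eq0 denq_neq0.
Qed.

Lemma ltn_prod_lin (I : eqType) (s : seq I) (F G : I -> nat) : s != [::] ->
  (forall i, i \in s -> (0 < F i < G i)%N) ->
  (\prod_(i <- s) F i < \prod_(i <- s) G i)%N.
Proof.
elim: s => // x [|y s] IH _ FG.
  by rewrite !big_seq1; case/andP: (FG x (mem_head _ _)).
rewrite big_cons [ltnRHS]big_cons; have /andP[F0 lt_FG] := FG x (mem_head _ _).
apply: leq_ltn_trans (leq_mul (ltnW lt_FG) (leqnn _)) _.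
rewrite ltn_pmul2l ?(leq_trans _ lt_FG) //; apply: IH => // i si.
by apply: FG; rewrite inE si orbT.
Qed.

Lemma prod_modn (I : eqType) (s : seq I) (F G : I -> nat) (m : nat) :
  (forall i, i \in s -> F i = G i %[mod m]) ->
  (\prod_(i <- s) F i = \prod_(i <- s) G i %[mod m])%N.
Proof.
elim: s => [|x s IH] FG; first by rewrite !big_nil.
rewrite !big_cons -modnMm FG ?mem_head // IH ?modnMm // => i si.
by apply: FG; rewrite inE si orbT.
Qed.

Lemma logn_prod_seq (I : eqType) (p : nat) (s : seq I) (F : I -> nat) :
  (forall i, i \in s -> (0 < F i)%N) ->
  logn p (\prod_(i <- s) F i) = (\sum_(i <- s) logn p (F i))%N.
Proof.
elim: s => [|x s IH] F0; first by rewrite !big_nil logn1.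
rewrite !big_cons lognM ?IH ?F0 ?mem_head // => [i si|].
  by apply: F0; rewrite inE si orbT.
rewrite big_seq prodn_cond_gt0 // => i si.
by apply: F0; rewrite inE si orbT.
Qed.

Lemma prime_ndvd_fact (p n : nat) : prime p -> (n < p)%N -> ~~ (p %| n`!)%N.
Proof.
move=> p_pr; elim: n => [_|n IH lt_np]; first by rewrite dvdn1 gtn_eqF ?prime_gt1.
by rewrite factS Euclid_dvdM // negb_or gtnNdvd // IH // ltnW.
Qed.

Lemma leq_sum_mem (I : eqType) (s : seq I) x : x \in s ->
  forall F : I -> nat, (F x <= \sum_(y <- s) F y)%N.
Proof. by move=> sx F; rewrite (big_rem x sx) leq_addr. Qed.

(** Along n = n0 + M k the product Q n of the numerators of the n - a has a
    constant p-part for each prime p <= q. For a positive proportion of the k it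
    is divisible at most once by every prime p > q, and the hypothesis says that
    the field determines which of these primes divide it. Hence the field
    determines Q n, and so n, because Q is increasing. *)
Lemma fields_from_ramification (U : eqType) (fld : nat -> U) (S : seq rat) (p0 n1 : nat) :
  S != [::] -> uniq S ->
  (forall n m a p, (n1 < n)%N -> (n1 < m)%N -> fld n = fld m ->
     prime p -> (p0 < p)%N -> a \in S -> vp p (n%:R - a) = 1 ->
     (forall b, b \in S -> b != a -> vp p (n%:R - b) = 0) ->
     exists2 b, b \in S & vp p (m%:R - b) != 0) ->
  exists D N0 : nat, forall N, (N0 <= N)%N ->
    (N <= D * size (undup [seq fld i | i <- iota 1 N]))%N.
Proof.
move=> S_n0 S_uniq ram.
pose n0 := (n1 + \sum_(a <- S) `|numq a|%N).+1.
have w_gt0 (a : rat) : (0 < `|denq a|)%N by rewrite absz_gt0 denq_neq0.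
have DL a k : a \in S -> (lin_form a (n0 + k) = `|denq a| * k + lin_form a n0)%N.
  move=> Sa; have num_le : (`|numq a| < n0)%N.
    by rewrite /n0 ltnS (big_rem a Sa) /=; lia.
  by rewrite /lin_form; have := denq_gt0 a; nia.
have L0 a : a \in S -> (0 < lin_form a n0)%N.
  move=> Sa; have num_le : (`|numq a| < n0)%N.
    by rewrite /n0 ltnS (big_rem a Sa) /=; lia.
  by rewrite /lin_form; have := denq_gt0 a; nia.
pose Q n := (\prod_(a <- S) lin_form a n)%N.
(* a prime p > q divides no denominator, no two of the numerators of the n - a,
   and not Q n0 *)
pose h x y := absz (denq y * numq x - denq x * numq y)%R.
pose q := (p0 + 2 * size S + \sum_(a <- S) `|denq a| +
   \sum_(a <- S) \sum_(b <- S) h a b + Q n0).+1.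
(* M is divisible by p * p-part of Q n0 for every prime p <= q *)
pose M := (Q n0 * q`!)%N.
have Q0 n : (n0 <= n)%N -> (0 < Q n)%N.
  move=> /subnKC <-; rewrite /Q big_seq prodn_cond_gt0 // => a Sa.
  by rewrite DL // addn_gt0 L0 ?orbT.
have M_gt0 : (0 < M)%N by rewrite muln_gt0 Q0 // fact_gt0.
pose lf := [seq (lin_form a n0, `|denq a| * M)%N | a <- S].
have pM p : prime p -> (q < p)%N -> ~~ (p %| M)%N.
  move=> p_pr qp; rewrite Euclid_dvdM // negb_or prime_ndvd_fact // andbT.
  by rewrite gtnNdvd ?Q0 //; apply: leq_ltn_trans qp; rewrite /q; lia.
have pw p a : (q < p)%N -> a \in S -> logn p `|denq a| = 0%N.
  move=> qp Sa; rewrite lognE gtnNdvd ?w_gt0 ?andbF //.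
  by apply: leq_ltn_trans qp; rewrite /q (big_rem a Sa) /=; lia.
have [lfA lfB] : (forall AB, AB \in lf -> (0 < AB.1)%N) /\
    (forall AB p, AB \in lf -> prime p -> (q < p)%N -> ~~ (p %| AB.2)%N).
  split=> [AB|AB p] /mapP[a Sa ->] /=; first exact: L0.
  move=> p_pr qp; rewrite Euclid_dvdM // negb_or pM // andbT.
  rewrite gtnNdvd ?w_gt0 //.
  by apply: leq_ltn_trans qp; rewrite /q (big_rem a Sa) /=; lia.
have q_ge : (2 * size lf <= q)%N by rewrite size_map /q; lia.
have [T0 HT] := square_free_values (isT : (0 < q)%N) q_ge lfA lfB.
pose nk k := (n0 + M * k)%N.
have DLk a k : a \in S -> lin_form a (nk k) = (lin_form a n0 + `|denq a| * M * k)%N.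
  by move=> Sa; rewrite /nk DL // addnC mulnA.
have Lk0 a k : a \in S -> (0 < lin_form a (nk k))%N.
  by move=> Sa; rewrite DLk // addn_gt0 L0.
have Qk0 k : (0 < Q (nk k))%N by rewrite Q0 ?leq_addr.
have Qlog p k : logn p (Q (nk k)) = (\sum_(a <- S) logn p (lin_form a (nk k)))%N.
  by apply: logn_prod_seq => a Sa; apply: Lk0.
have small_p p k : prime p -> (p <= q)%N -> logn p (Q (nk k)) = logn p (Q n0).
  move=> p_pr pq; set v := logn p (Q n0).
  have Qmod : (Q (nk k) = Q n0 %[mod M])%N.
    by apply: prod_modn => a Sa; rewrite DLk // mulnAC -modnDmr modnMl addn0.
  have pv_M : (p ^ v.+1 %| M)%N.
    rewrite expnSr dvdn_mul ?pfactor_dvdnn //.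
    by rewrite dvdn_fact // prime_gt0.
  have dvdQ j : (j <= v.+1)%N -> (p ^ j %| Q (nk k))%N = (p ^ j %| Q n0)%N.
    move=> j_le; have /dvdnP[z Dz] := dvdn_trans (dvdn_exp2l p j_le) pv_M.
    by rewrite /dvdn -(modn_dvdm (Q (nk k)) (dvdn_trans (dvdn_exp2l p j_le) pv_M)) Qmod modn_dvdm // Dz dvdn_mull.
  apply/eqP; rewrite eqn_leq; apply/andP; split; last first.
    by rewrite -(pfactor_dvdn v p_pr (Qk0 k)) dvdQ // pfactor_dvdn ?Q0.
  rewrite leqNgt -(pfactor_dvdn v.+1 p_pr (Qk0 k)) dvdQ // pfactor_dvdn ?Q0 //.
  by rewrite -/v ltnn.
have uniq_p p a b n : (q < p)%N -> a \in S -> b \in S -> b != a ->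
    (p %| lin_form a n)%N -> ~~ (p %| lin_form b n)%N.
  move=> qp Sa Sb nab pa; apply/negP => pb.
  pose d := (denq b * numq a - denq a * numq b)%R.
  have d0 : d != 0.
    rewrite subr_eq0; apply: contraNneq nab => Dd.
    rewrite -(divq_num_den a) -(divq_num_den b) eqr_div ?intr_eq0 ?denq_neq0 //.
    by rewrite -!rmorphM /= eqr_int; apply/eqP; lia.
  have : (p%:Z %| d)%Z.
    have -> : d = denq a * (denq b * n%:Z - numq b) - denq b * (denq a * n%:Z - numq a).
      by rewrite /d; ring.
    by rewrite rpredB // dvdz_mull // dvdzE.
  rewrite dvdzE /= gtnNdvd ?absz_gt0 //.
  have le_a : (\sum_(y <- S) h a y <= \sum_(x <- S) \sum_(y <- S) h x y)%N.
    exact: (leq_sum_mem Sa (fun x => \sum_(y <- S) h x y)%N).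
  have le_b : (h a b <= \sum_(y <- S) h a y)%N.
    exact: (leq_sum_mem Sb (h a)).
  by apply: leq_ltn_trans qp; rewrite -[absz d]/(h a b) /q; lia.
have large_le p k : square_free_above q lf k -> prime p -> (q < p)%N ->
    (logn p (Q (nk k)) <= 1)%N.
  move=> /asboolP good p_pr qp; rewrite Qlog.
  have le1 a : a \in S -> (logn p (lin_form a (nk k)) <= 1)%N.
    move=> Sa; rewrite leqNgt -pfactor_dvdn ?Lk0 //.
    rewrite DLk //; apply: (good (_, _) p _ p_pr qp).
    by apply/mapP; exists a.
  have [/hasP[a Sa pa]|/hasPn none] := boolP (has (fun a => p %| lin_form a (nk k))%N S).
    rewrite (big_rem a Sa) /= big_seq big1 ?addn0 ?le1 // => b.
    rewrite mem_rem_uniq // inE => /andP[nba Sb].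
    by rewrite lognE (negPf (uniq_p _ _ _ _ qp Sa Sb nba pa)) !andbF.
  rewrite big_seq big1 // => a Sa; rewrite lognE (negPf (none a Sa)) !andbF //.
have large_eq p k k' : square_free_above q lf k -> fld (nk k) = fld (nk k') ->
    prime p -> (q < p)%N -> (0 < logn p (Q (nk k)))%N -> (0 < logn p (Q (nk k')))%N.
  move=> good eq_f p_pr qp; have := large_le p k good p_pr qp.
  rewrite Qlog => le1 gt0.
  have [a Sa pa] : exists2 a, a \in S & (0 < logn p (lin_form a (nk k)))%N.
    apply/hasP; apply: contraLR gt0 => /hasPn none; rewrite -leqNgt leqn0.
    by rewrite big_seq big1 // => a /none; rewrite -leqNgt leqn0 => /eqP.
  have La : logn p (lin_form a (nk k)) = 1%N.
    by apply/eqP; rewrite eqn_leq pa andbT; move: le1; rewrite (big_rem a Sa) /=; lia.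
  have pda : (p %| lin_form a (nk k))%N by move: pa; rewrite logn_gt0 mem_primes => /and3P[].
  have nk_gt m : (n1 < nk m)%N by rewrite /nk /n0; lia.
  have [|||b Sb] := ram (nk k) (nk k') a p (nk_gt k) (nk_gt k') eq_f p_pr _ Sa.
  - by apply: leq_trans qp; rewrite /q; lia.
  - by rewrite vp_sub_rat ?Lk0 // La pw.
  - move=> b Sb nba; rewrite vp_sub_rat ?Lk0 // pw //.
    by rewrite lognE (negPf (uniq_p _ _ _ _ qp Sa Sb nba pda)) !andbF.
  rewrite vp_sub_rat ?Lk0 // pw // subr0 Qlog (big_rem b Sb) /=.
  by case: logn.
have inj k k' : square_free_above q lf k -> square_free_above q lf k' ->
    fld (nk k) = fld (nk k') -> k = k'.
  move=> good good' eq_f.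
  have eqQ : Q (nk k) = Q (nk k').
    apply: eqn_from_log (Qk0 k) (Qk0 k') _ => p.
    have [p_pr|np] := boolP (prime p); last by rewrite lognE [RHS]lognE (negPf np).
    have [pq|qp] := leqP p q; first by rewrite (small_p p k) ?(small_p p k').
    move: (large_le p k good p_pr qp) (large_le p k' good' p_pr qp).
    move: (large_eq p k k' good eq_f p_pr qp) (large_eq p k' k good' (esym eq_f) p_pr qp).
    by move: (logn p (Q (nk k))) (logn p (Q (nk k'))) => [|[|x]] [|[|y]] // xy yx;
      [have := yx isT|have := xy isT].
  have mono j j' : (j < j')%N -> (Q (nk j) < Q (nk j'))%N.
    move=> lt_j; apply: ltn_prod_lin => // a Sa; rewrite Lk0 //= !DLk //.
    by rewrite ltn_add2l ltn_pmul2l // muln_gt0 w_gt0 M_gt0.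
  by case: (ltngtP k k') => // /mono; [rewrite eqQ ltnn|rewrite -eqQ ltnn].
exists (8 * M)%N, (2 * (n0 + M * T0.+1))%N => N N_ge.
pose T := ((N - n0) %/ M)%N.
have T_ge : (T0 <= T)%N by rewrite leq_divRL //; nia.
have := HT T T_ge; set good := square_free_above q lf => cnt.
have : (count good (iota 0 T) <= size (undup [seq fld i | i <- iota 1 N]))%N.
  rewrite -size_filter -(size_map (fun k => fld (nk k))); apply: uniq_leq_size.
    rewrite map_inj_in_uniq ?filter_uniq ?iota_uniq // => k k'.
    by rewrite !mem_filter => /andP[gk _] /andP[gk' _]; apply: inj.
  move=> x /mapP[k]; rewrite mem_filter mem_iota add0n => /andP[_ /= kT] ->.
  rewrite mem_undup; apply: map_f; rewrite mem_iota /nk /n0 /=.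
  have : (M * T <= N - n0)%N by rewrite mulnC leq_trunc_div.
  by rewrite /n0; nia.
have := ltn_ceil (N - n0) M_gt0; rewrite -/T; nia.
Qed.

(** * Places of fields over the algebraic numbers *)

(** A homomorphism to algC over the constants, defined on a subring of M, is
    encoded by its graph. Extension of homomorphisms is then inclusion, as
    needed for the use of Zorn's lemma. *)
Record place_graph (M : fieldType) (cst : {rmorphism algC -> M})
    (V : set (M * algC)) : Prop := PlaceGraph {
  pg_cst : forall c, V (cst c, c);
  pg_add : forall f a g b, V (f, a) -> V (g, b) -> V (f + g, a + b);
  pg_mul : forall f a g b, V (f, a) -> V (g, b) -> V (f * g, a * b);
  pg_fun : forall a, V (0, a) -> a = 0 }.

Section Places.
Variables (M : fieldType) (cst : {rmorphism algC -> M}).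

Section Graph.
Variables (V : set (M * algC)) (Vg : place_graph cst V).

Lemma pg_scale c f a : V (f, a) -> V (cst c * f, c * a).
Proof. by move=> Vf; apply: (pg_mul Vg) => //; apply: (pg_cst Vg). Qed.

Lemma pg_opp f a : V (f, a) -> V (- f, - a).
Proof. by move/(pg_scale (-1)); rewrite rmorphN rmorph1 !mulN1r. Qed.

Lemma pg_zero : V (0, 0). Proof. by have := pg_cst Vg 0; rewrite rmorph0. Qed.
Lemma pg_one : V (1, 1). Proof. by have := pg_cst Vg 1; rewrite rmorph1. Qed.

Lemma pg_sum (I : Type) (s : seq I) (F : I -> M) (G : I -> algC) :
  (forall i, V (F i, G i)) -> V (\sum_(i <- s) F i, \sum_(i <- s) G i).
Proof.
move=> FG; elim: s => [|i s IH]; first by rewrite !big_nil; apply: pg_zero.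
by rewrite !big_cons; apply: (pg_add Vg).
Qed.

Lemma pg_exp f a n : V (f, a) -> V (f ^+ n, a ^+ n).
Proof.
move=> Vf; elim: n => [|n IH]; first by rewrite !expr0; apply: pg_one.
by rewrite !exprS; apply: (pg_mul Vg).
Qed.

Definition pg_poly (p : {poly M}) (q : {poly algC}) : Prop :=
  forall i, V (p`_i, q`_i).

Lemma pg_polyD p q p' q' : pg_poly p q -> pg_poly p' q' -> pg_poly (p + p') (q + q').
Proof. by move=> pq pq' i; rewrite !coefD; apply: (pg_add Vg). Qed.

Lemma pg_polyM p q p' q' : pg_poly p q -> pg_poly p' q' -> pg_poly (p * p') (q * q').
Proof.
by move=> pq pq' i; rewrite !coefM; apply: pg_sum => j; apply: (pg_mul Vg).
Qed.

Lemma pg_poly_cst (q : {poly algC}) : pg_poly (map_poly cst q) q.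
Proof. by move=> i; rewrite coef_map; apply: (pg_cst Vg). Qed.

Lemma pg_polyC f a : V (f, a) -> pg_poly f%:P a%:P.
Proof. by move=> Vf i; rewrite !coefC; case: eqP => // _; apply: pg_zero. Qed.

(** The subring of M * algC generated by V and (x, xi). *)
Definition pg_adjoin (x : M) (xi : algC) : set (M * algC) :=
  [set fa | exists p q, pg_poly p q /\ fa = (p.[x], q.[xi])].

Lemma pg_adjoinP x xi : (forall p q, pg_poly p q -> p.[x] = 0 -> q.[xi] = 0) ->
  place_graph cst (pg_adjoin x xi).
Proof.
move=> H; split.
- move=> c; exists (cst c)%:P, c%:P; rewrite !hornerC; split=> //.
  exact/pg_polyC/(pg_cst Vg).
- move=> _ _ _ _ [p [q [pq [-> ->]]]] [p' [q' [pq' [-> ->]]]].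
  by exists (p + p'), (q + q'); rewrite !hornerD; split=> //; apply: pg_polyD.
- move=> _ _ _ _ [p [q [pq [-> ->]]]] [p' [q' [pq' [-> ->]]]].
  by exists (p * p'), (q * q'); rewrite !hornerM; split=> //; apply: pg_polyM.
- by move=> a [p [q [pq [Dp ->]]]]; apply: H pq _.
Qed.

Lemma pg_adjoin_sub x xi : V `<=` pg_adjoin x xi.
Proof.
by move=> -[f a] Vf; exists f%:P, a%:P; rewrite !hornerC; split=> //; apply: pg_polyC.
Qed.

Lemma pg_adjoin_mem x xi : pg_adjoin x xi (x, xi).
Proof.
exists 'X, 'X; rewrite !hornerX; split=> //; rewrite -(map_polyX cst).
exact: pg_poly_cst.
Qed.

(** A relation p(x) = 0 whose coefficients have the values 1, 0, 0, ... prevents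
    x from having a finite value. *)
Definition pg_pole (x : M) : Prop :=
  exists2 p : {poly M}, pg_poly p 1 & p.[x] = 0.

(** The values, coefficient by coefficient, of the polynomials over the domain of
    V that vanish at x form an ideal of {poly algC}. If it does not contain 1,
    its elements have a common root, which is a possible value for x. *)
Lemma pg_extend x : ~ pg_pole x ->
  exists xi, forall p q, pg_poly p q -> p.[x] = 0 -> q.[xi] = 0.
Proof.
move=> npole; pose J q := exists2 p, pg_poly p q & p.[x] = 0.
have JM q r : J q -> J (r * q).
  move=> [p pq p0]; exists (map_poly cst r * p); last by rewrite hornerM p0 mulr0.
  exact/pg_polyM/pq/pg_poly_cst.
have JB q q' : J q -> J q' -> J (q - q').
  move=> [p pq p0] /(JM _ (-1)) [p' pq' p'0]; exists (p + p').
    by rewrite -[- q']mulN1r; apply: pg_polyD.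
  by rewrite hornerD p0 p'0 addr0.
have [[q0 [Jq0 q00]]|none] := pselect (exists q, J q /\ q != 0); last first.
  exists 0 => p q pq p0; have [-> | q0] := eqVneq q 0; first by rewrite horner0.
  by case: none; exists q; split=> //; exists p.
have exn : exists n, `[< exists q, [/\ J q, q != 0 & size q = n] >].
  by exists (size q0); apply/asboolP; exists q0.
case: (ex_minnP exn) => n /asboolP[g [Jg g0 sz_g]] g_min.
have [xi xi_root] : exists xi, root g xi.
  apply/closed_rootP; apply/eqP => sz1; move/eqP/size_poly1P: sz1 => [c c0 Dg].
  case: npole; have [p pq p0] := JM g (c^-1)%:P Jg; exists p => //.
  by move: pq; rewrite Dg -polyCM mulVf.
exists xi => p q pq p0; have Jq : J q by exists p.
have Jr : J (q %% g).
  have -> : q %% g = q - q %/ g * g by rewrite {2}(divp_eq q g) addrC addKr.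
  exact/JB/JM.
rewrite (divp_eq q g) hornerD hornerM (rootP xi_root) mulr0 add0r.
have [-> | r0] := eqVneq (q %% g) 0; first by rewrite horner0.
suff : (n <= size (q %% g)%R)%N by rewrite leqNgt -sz_g ltn_modp g0.
by apply: g_min; apply/asboolP; exists (q %% g)%R.
Qed.

(** Chevalley's argument: among relations excluding y and y^-1, of least size n
    for y and of size m <= n for y^-1, the second one, multiplied by a power of
    y, cancels the leading term of the first without changing the values of its
    coefficients. *)
Lemma pg_pole_both x : x != 0 -> pg_pole x -> pg_pole x^-1 -> False.
Proof.
move=> x0 px px'.
have size_gt y (p : {poly M}) : pg_poly p 1 -> p.[y] = 0 -> (1 < size p)%N.
  move=> p1 py; rewrite ltnNge; apply/negP => /size1_polyC Dp.
  have := p1 0%N; have : p`_0 = 0 by rewrite -(hornerC p`_0 y) -Dp.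
  by move=> -> /(pg_fun Vg)/eqP; rewrite coef1 oner_eq0.
pose Pn y n := `[< exists p, [/\ pg_poly p 1, p.[y] = 0 & size p = n] >].
have key y n m : y != 0 -> Pn y n -> Pn y^-1 m -> (m <= n)%N ->
    (forall k, Pn y k -> (n <= k)%N) -> False.
  move=> y0 /asboolP[p [p1 py sz_p]] /asboolP[q [q1 qy sz_q]] le_mn n_min.
  have := size_gt _ _ p1 py; have := size_gt _ _ q1 qy; rewrite sz_p sz_q => m_gt n_gt.
  have n_gt0 : (0 < n)%N by lia.
  (* qr.[y] = y^(m - 1) * q.[y^-1] *)
  pose qr := \poly_(i < m) q`_(m.-1 - i).
  have qry : qr.[y] = 0.
    rewrite horner_poly.
    transitivity (y ^+ m.-1 * q.[y^-1]); last by rewrite qy mulr0.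
    rewrite horner_coef sz_q mulr_sumr (reindex_inj rev_ord_inj) /=.
    apply: eq_bigr => i _.
    have lt_im := ltn_ord i; have -> : (m - i.+1 = m.-1 - i)%N by lia.
    rewrite subKn; last by lia.
    have {2}-> : m.-1 = (m.-1 - i + i)%N by lia.
    by rewrite exprD exprVn mulrCA; congr (_ * _); rewrite mulfK ?expf_neq0.
  pose r := q`_0 *: p - p`_n.-1 *: (qr * 'X^(n - m)).
  have r1 : pg_poly r 1.
    move=> i; have Vpn : V (p`_n.-1, 0).
      by have := p1 n.-1; rewrite coef1; have -> : (n.-1 == 0)%N = false by lia.
    have Vqr : V ((qr * 'X^(n - m))`_i, (if (i < n - m)%N then 0 else
        if (i - (n - m) < m)%N then (1 : {poly algC})`_(m.-1 - (i - (n - m))) else 0)).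
      rewrite coefMXn; case: ifP => _; first exact: pg_zero.
      by rewrite coef_poly; case: ifP => _; [apply: q1 | apply: pg_zero].
    set c := (if _ then _ else _) in Vqr.
    have -> : (1 : {poly algC})`_i = 1 * (1 : {poly algC})`_i + - (0 * c).
      by rewrite mul1r mul0r subr0.
    rewrite /r coefB !coefZ.
    apply: (pg_add Vg); first by apply: (pg_mul Vg) (p1 i); have := q1 0%N; rewrite coef1.
    exact/pg_opp/(pg_mul Vg).
  have : (size r <= n.-1)%N.
    apply/leq_sizeP => i le_i; rewrite /r coefB !coefZ coefMXn coef_poly.
    have [Di|ne_i] := eqVneq i n.-1.
      have -> : (i < n - m)%N = false by lia.
      have -> : (i - (n - m) < m)%N by lia.
      have -> : (m.-1 - (i - (n - m)) = 0)%N by lia.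
      by rewrite Di mulrC subrr.
    have le_ni : (n <= i)%N by rewrite -(prednK n_gt0) ltn_neqAle eq_sym ne_i.
    have -> : (i < n - m)%N = false by lia.
    have -> : (i - (n - m) < m)%N = false.
      apply/negbTE; rewrite -leqNgt -{1}(subKn le_mn); exact: leq_sub2r.
    by rewrite [p`_i]nth_default ?sz_p // !mulr0 subrr.
  suff : (n <= size r)%N by lia.
  apply: n_min; apply/asboolP; exists r; split=> //.
  by rewrite /r hornerD hornerN !hornerZ hornerM py qry mul0r !mulr0 subr0.
have minP y : pg_pole y -> exists2 n, Pn y n & forall k, Pn y k -> (n <= k)%N.
  move=> [p p1 py]; have exn : exists n, Pn y n by exists (size p); apply/asboolP; exists p.
  by case: (ex_minnP exn) => n; exists n.
have [[n Pn1 n_min] [m Pm m_min]] := (minP _ px, minP _ px').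
have [le_mn|/ltnW le_nm] := leqP m n; first exact: (key x n m).
by apply: (key x^-1 m n); rewrite ?invr_eq0 ?invrK.
Qed.

Lemma pg_pole_inv u a : V (u, a) -> u != 0 -> pg_pole u^-1 -> a = 0.
Proof.
move=> Vu u0 [p p1 pu].
(* u^(n - 1) p(1/u) = 0 has the value a^(n - 1) for n = size p + 1 *)
have H n : (0 < n)%N -> (size p <= n)%N -> u ^+ n.-1 * p.[u^-1] = \sum_(i < n) p`_i * u ^+ (n.-1 - i).
  move=> n_gt sz_n; rewrite (horner_coef_wide _ sz_n) mulr_sumr; apply: eq_bigr => i _.
  have lt_in := ltn_ord i; have {1}-> : n.-1 = (n.-1 - i + i)%N by lia.
  by rewrite exprD exprVn mulrCA; congr (_ * _); rewrite mulfK ?expf_neq0.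
have := H (size p).+1 isT (leqnSn _); rewrite pu mulr0 /= => Dsum.
have : V (0, \sum_(i < (size p).+1) (1 : {poly algC})`_i * a ^+ (size p - i)).
  rewrite Dsum; apply: pg_sum => i; apply: (pg_mul Vg); [exact: p1|exact: pg_exp].
move/(pg_fun Vg); rewrite big_ord_recl coef1 mul1r subn0 big1 ?addr0.
  by move/eqP; rewrite expf_eq0 => /andP[_ /eqP].
by move=> i _; rewrite coef1 mul0r.
Qed.

End Graph.

(** A maximal extension of the homomorphism p(t) |-> p(alpha). By maximality an
    element outside its domain is excluded by a relation; the inverse is not,
    and so has a value, which is 0. *)
Theorem place_exists (t : M) (alpha : algC) :
  (forall p : {poly algC}, (map_poly cst p).[t] = 0 -> p = 0) ->
  exists V : set (M * algC), [/\ place_graph cst V, V (t, alpha) &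
    forall f, f != 0 -> (exists a, V (f, a)) \/ V (f^-1, 0)].
Proof.
move=> t_tr.
pose V0 : set (M * algC) := [set fa | exists p, fa = ((map_poly cst p).[t], p.[alpha])].
have V0g : place_graph cst V0.
  split.
  - by move=> c; exists c%:P; rewrite map_polyC !hornerC.
  - by move=> _ _ _ _ [p [-> ->]] [q [-> ->]]; exists (p + q); rewrite rmorphD !hornerD.
  - by move=> _ _ _ _ [p [-> ->]] [q [-> ->]]; exists (p * q); rewrite rmorphM !hornerM.
  - by move=> a [p [/esym/t_tr -> ->]]; rewrite horner0.
have V0t : V0 (t, alpha) by exists 'X; rewrite map_polyX !hornerX.
(* the empty set is admitted as an upper bound of the empty chain *)
pose P (V : set (M * algC)) := V = set0 \/ place_graph cst V /\ V (t, alpha).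
have [V [PV Vmax]] : exists V, P V /\ forall W, V `<` W -> ~ P W.
  apply: Zorn_bigcup => F FP Ftot.
  have [[W0 [FW0 W0n]]|none] := pselect (exists W, F W /\ W !=set0); last first.
    left; rewrite -subset0 => x [W FW Wx]; apply: none; exists W; split=> //.
    by exists x.
  have Fg W x : F W -> W x -> place_graph cst W /\ W (t, alpha).
    by move=> FW Wx; have [W0'|//] := FP W FW; rewrite W0' in Wx.
  have [x0 W0x] := W0n; have [W0g W0t] := Fg _ _ FW0 W0x.
  have join x y : (\bigcup_(X in F) X) x -> (\bigcup_(X in F) X) y ->
      exists W, [/\ F W, W x & W y].
    move=> [W FW Wx] [W' FW' Wy].
    by have [s|s] := Ftot W W' FW FW'; [exists W' | exists W]; split=> //; apply: s.
  right; split; last by exists W0.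
  split.
  - by move=> c; exists W0 => //; apply: (pg_cst W0g).
  - move=> f a g b Ff Fgb; have [W [FW Wf Wg]] := join _ _ Ff Fgb.
    by exists W => //; apply: (pg_add (Fg _ _ FW Wf).1).
  - move=> f a g b Ff Fgb; have [W [FW Wf Wg]] := join _ _ Ff Fgb.
    by exists W => //; apply: (pg_mul (Fg _ _ FW Wf).1).
  - by move=> a [W FW Wa]; apply: (pg_fun (Fg _ _ FW Wa).1).
have [Vg Vt] : place_graph cst V /\ V (t, alpha).
  case: PV => // V_0; case: (Vmax V0); last by right.
  by rewrite V_0; split=> // H; have := H _ V0t.
have dom f : ~ pg_pole V f -> exists a, V (f, a).
  move=> npole; have [xi Hxi] := pg_extend Vg npole; exists xi.
  apply: contrapT => nV; apply: (Vmax (pg_adjoin V f xi)).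
    split; first exact: pg_adjoin_sub.
    by move=> H; apply: nV; apply: H; apply: pg_adjoin_mem.
  right; split; first exact: pg_adjoinP.
  exact: pg_adjoin_sub.
exists V; split=> // f f0.
have [pf|/dom ?] := pselect (pg_pole V f); last by left.
right; have [a Va] : exists a, V (f^-1, a).
  by apply: dom => pf'; apply: (pg_pole_both Vg f0 pf pf').
suff <- : a = 0 by [].
by apply: (pg_pole_inv Vg Va); rewrite ?invr_eq0 ?invrK.
Qed.

End Places.

(** * Rational functions and their values at points *)

Lemma rmorph_mmap (k M : fieldType) (m : nat) (e : {rmorphism {mpoly k[m]} -> M}) F :
  e F = mmap (e \o @mpolyC m k) (fun i => e 'X_i) F.
Proof.
rewrite {1}[F]mpolyE rmorph_sum /mmap; apply: eq_bigr => mu _.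
rewrite -mul_mpolyC rmorphM /= mpolyXE_id rmorph_prod; congr (_ * _).
by apply: eq_bigr => i _; rewrite rmorphXn.
Qed.

(** The map ev from polynomials in the homogeneous coordinates to a field M
    stands for the map to the fraction field of the homogeneous coordinate ring
    of a projective variety with set of points T: its kernel consists of the
    polynomials vanishing at all points. *)
Section Geometry.
Variables (n : nat) (M : fieldType) (ev : {rmorphism {mpoly algC[n]} -> M}).
Variables (T : Type) (co : T -> 'I_n -> algC).
Hypothesis evP : forall F, ev F = 0 <-> forall P, F.@[co P] = 0.
Hypothesis T_inh : inhabited T.

Local Notation cst := (ev \o @mpolyC n algC : {rmorphism algC -> M}).
Implicit Types (P : T) (F G : {mpoly algC[n]}) (f g : M).

Definition rational_function f : Prop := exists d F G,
  [/\ F \is d.-homog, G \is d.-homog, ev G != 0 & f = ev F / ev G].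

Definition value_at f P (a : algC) : Prop := exists d F G,
  [/\ F \is d.-homog, G \is d.-homog, G.@[co P] != 0, f = ev F / ev G
    & a = F.@[co P] / G.@[co P]].

Lemma ev_mmap F : ev F = mmap cst (fun i => ev 'X_i) F.
Proof. exact: rmorph_mmap. Qed.

Lemma ev_neq0 P G : G.@[co P] != 0 -> ev G != 0.
Proof. by apply: contraNneq => /evP ->. Qed.

Lemma meval_homog d F (v w : 'I_n -> algC) (c : algC) : F \is d.-homog ->
  (forall i, w i = c * v i) -> F.@[w] = c ^+ d * F.@[v].
Proof.
move=> /dhomogP hF Dw; rewrite !mevalE mulr_sumr big_seq [RHS]big_seq.
apply: eq_bigr => m mF; rewrite mulrCA -(hF m mF); congr (_ * _).
rewrite /= mdegE -prodrXr -big_split /=; apply: eq_bigr => i _.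
by rewrite Dw exprMn.
Qed.

Lemma mmap_homog d F (v w : 'I_n -> M) (c : M) : F \is d.-homog ->
  (forall i, w i = c * v i) -> mmap cst w F = c ^+ d * mmap cst v F.
Proof.
move=> /dhomogP hF Dw; rewrite /mmap mulr_sumr big_seq [RHS]big_seq.
apply: eq_bigr => m mF; rewrite mulrCA -(hF m mF); congr (_ * _).
rewrite /mmap1 /= mdegE -prodrXr -big_split /=; apply: eq_bigr => i _.
by rewrite Dw exprMn.
Qed.

Lemma value_at_frac d F G P : F \is d.-homog -> G \is d.-homog -> G.@[co P] != 0 ->
  value_at (ev F / ev G) P (F.@[co P] / G.@[co P]).
Proof. by move=> hF hG GP; exists d, F, G. Qed.

Lemma value_at_fun f P a : value_at f P a -> rational_function f.
Proof.
by case=> d [F [G [hF hG GP Df _]]]; exists d, F, G; split=> //; apply: ev_neq0 GP.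
Qed.

Lemma value_at_uniq f P a b : value_at f P a -> value_at f P b -> a = b.
Proof.
move=> [d [F [G [hF hG GP -> ->]]]] [e [F' [G' [_ _ G'P Df ->]]]].
have G0 := ev_neq0 GP; have G'0 := ev_neq0 G'P.
apply/eqP; rewrite eqr_div //; apply/eqP.
have : ev (F * G' - F' * G) = 0.
  rewrite rmorphB !rmorphM; apply/eqP; rewrite subr_eq0; apply/eqP.
  have -> : ev F = ev F' / ev G' * ev G by rewrite -Df divfK.
  by rewrite mulrAC divfK.
move=> /evP/(_ P); rewrite mevalB !mevalM => /eqP; rewrite subr_eq0 => /eqP->.
by rewrite mulrC.
Qed.

Lemma value_at_cst c P : value_at (cst c) P c.
Proof.
exists 0%N, c%:MP, 1; rewrite dhomog1 mevalC meval1 rmorph1 !divr1 oner_eq0.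
by split=> //; rewrite -alg_mpolyC; apply/dhomogZ/dhomog1.
Qed.

Lemma value_at_add f g P a b :
  value_at f P a -> value_at g P b -> value_at (f + g) P (a + b).
Proof.
move=> [d [F [G [hF hG GP -> ->]]]] [e [F' [G' [hF' hG' G'P -> ->]]]].
exists (d + e)%N, (F * G' + F' * G), (G * G'); split.
- by apply: dhomogD; [exact: dhomogM | rewrite addnC; exact: dhomogM].
- exact: dhomogM.
- by rewrite mevalM mulf_neq0.
- by rewrite (addf_div _ _ (ev_neq0 GP) (ev_neq0 G'P)) rmorphD !rmorphM.
- by rewrite (addf_div _ _ GP G'P) mevalD !mevalM.
Qed.

Lemma value_at_mul f g P a b :
  value_at f P a -> value_at g P b -> value_at (f * g) P (a * b).
Proof.
move=> [d [F [G [hF hG GP -> ->]]]] [e [F' [G' [hF' hG' G'P -> ->]]]].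
exists (d + e)%N, (F * F'), (G * G'); split; try exact: dhomogM.
- by rewrite mevalM mulf_neq0.
- by rewrite mulf_div !rmorphM.
- by rewrite mulf_div !mevalM.
Qed.

Lemma value_at_inv f P a : value_at f P a -> a != 0 -> value_at f^-1 P a^-1.
Proof.
move=> [d [F [G [hF hG GP -> ->]]]].
rewrite mulf_eq0 invr_eq0 (negPf GP) orbF => FP.
by rewrite !invf_div; apply: (@value_at_frac d).
Qed.

Lemma value_at_coord i j P : co P j != 0 ->
  value_at (ev 'X_i / ev 'X_j) P (co P i / co P j).
Proof.
by move=> Pj; exists 1%N, 'X_i, 'X_j; rewrite !dhomogX /= !mdeg1 !mevalXU.
Qed.

Lemma value_at_sum (I : Type) (s : seq I) (f : I -> M) (a : I -> algC) P :
  (forall i, value_at (f i) P (a i)) ->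
  value_at (\sum_(i <- s) f i) P (\sum_(i <- s) a i).
Proof.
move=> fa; elim: s => [|i s IH].
  by rewrite !big_nil -(rmorph0 cst); apply: value_at_cst.
by rewrite !big_cons; apply: value_at_add.
Qed.

Lemma value_at_prod (I : Type) (s : seq I) (f : I -> M) (a : I -> algC) P :
  (forall i, value_at (f i) P (a i)) ->
  value_at (\prod_(i <- s) f i) P (\prod_(i <- s) a i).
Proof.
move=> fa; elim: s => [|i s IH].
  by rewrite !big_nil -(rmorph1 cst); apply: value_at_cst.
by rewrite !big_cons; apply: value_at_mul.
Qed.

Lemma value_at_opp f P a : value_at f P a -> value_at (- f) P (- a).
Proof.
move=> fa; rewrite -mulN1r -[- a]mulN1r -(rmorphN1 cst).
exact/value_at_mul/fa/value_at_cst.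
Qed.

Lemma value_at_sub f g P a b :
  value_at f P a -> value_at g P b -> value_at (f - g) P (a - b).
Proof. by move=> fa gb; apply/value_at_add/value_at_opp. Qed.

Lemma value_at_exp f P a k : value_at f P a -> value_at (f ^+ k) P (a ^+ k).
Proof.
move=> fa; elim: k => [|k IH]; last by rewrite !exprS; apply: value_at_mul.
by rewrite !expr0 -(rmorph1 cst); apply: value_at_cst.
Qed.

Lemma value_at_horner (p : {poly algC}) f P a : value_at f P a ->
  value_at (map_poly cst p).[f] P p.[a].
Proof.
move=> fa; elim/poly_ind: p => [|p c IH].
  by rewrite rmorph0 !horner0 -(rmorph0 cst); apply: value_at_cst.
rewrite rmorphD rmorphM /= map_polyX map_polyC !hornerMXaddC.
by apply: value_at_add (value_at_cst _ _); apply: value_at_mul.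
Qed.

Lemma rational_function_cst c : rational_function (cst c).
Proof. by have [P] := T_inh; apply: value_at_fun (value_at_cst c P). Qed.

Lemma rational_function_div f g : rational_function f -> rational_function g -> rational_function (f / g).
Proof.
move=> [d [F [G [hF hG G0 ->]]]] [e [F' [G' [hF' hG' G'0 ->]]]].
have [F'0|F'0] := eqVneq (ev F') 0.
  by rewrite F'0 mul0r invr0 mulr0 -(rmorph0 cst); apply: rational_function_cst.
exists (d + e)%N, (F * G'), (G * F').
by rewrite !dhomogM // !rmorphM mulf_neq0 // invf_div mulf_div.
Qed.

Lemma rational_function_sub f g : rational_function f -> rational_function g -> rational_function (f - g).
Proof.
move=> [d [F [G [hF hG G0 ->]]]] [e [F' [G' [hF' hG' G'0 ->]]]].
exists (d + e)%N, (F * G' - F' * G), (G * G').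
split; last by rewrite -mulNr addf_div // rmorphB !rmorphM mulNr.
- by apply: dhomogD; [exact: dhomogM | rewrite dhomogN addnC; exact: dhomogM].
- exact: dhomogM.
- by rewrite rmorphM mulf_neq0.
Qed.

End Geometry.

(** * The local ring at a smooth point *)

Lemma mpoly_ring_ind (k : nzRingType) (m : nat) (Q : {mpoly k[m]} -> Prop) :
  (forall c, Q c%:MP) -> (forall i, Q 'X_i) ->
  (forall F G, Q F -> Q G -> Q (F + G)) -> (forall F G, Q F -> Q G -> Q (F * G)) ->
  forall F, Q F.
Proof.
move=> QC QX QD QM F; rewrite [F]mpolyE.
have Q0 : Q 0 by rewrite -(mpolyC0 m k); apply: QC.
have Q1 : Q 1 by rewrite -(mpolyC1 m k); apply: QC.
elim: (msupp F) => [|mu s IH]; first by rewrite big_nil.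
rewrite big_cons; apply: (QD) => //; rewrite -mul_mpolyC; apply: (QM) => //.
rewrite mpolyXE_id; apply: (big_ind Q) => [||i _]; [exact: Q1 | exact: QM |].
by elim: (mu i) => [|e IHe]; [rewrite expr0 | rewrite exprS; apply: (QM)].
Qed.

Lemma mpoly_euler (k : comNzRingType) (m d : nat) (F : {mpoly k[m]}) (v : 'I_m -> k) :
  F \is d.-homog -> \sum_i v i * (mderiv i F).@[v] = d%:R * F.@[v].
Proof.
move=> F_homog; have hF := dhomog_mf F_homog; rewrite {2}[F]mpolyE.
have step i : v i * (mderiv i F).@[v] =
    \sum_(mu <- msupp F) F@_mu * ((mu i)%:R * (v i * ('X_[mu - U_(i)]).@[v])).
  have -> : mderiv i F = \sum_(mu <- msupp F) F@_mu *: ((mu i)%:R *: 'X_[mu - U_(i)]).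
    rewrite {1}[F]mpolyE (big_morph _ (@mderivD _ _ i) (@mderiv0 _ _ i)); apply: eq_bigr => mu _.
    by rewrite mderivZ mderivX.
  rewrite [X in _ * X](big_morph _ (@mevalD _ _ v) (@meval0 _ _ v)) mulr_sumr; apply: eq_bigr => mu _.
  by rewrite /= !mevalZ; ring.
under eq_bigr do rewrite step.
rewrite exchange_big [X in _ * X](big_morph _ (@mevalD _ _ v) (@meval0 _ _ v)) mulr_sumr big_seq [RHS]big_seq /=.
apply: eq_bigr => mu muF; rewrite -(hF mu muF) /= mevalZ mulrCA -mulr_sumr.
congr (_ * _); rewrite mdegE natr_sum mulr_suml; apply: eq_bigr => i _.
have [->|mu_i] := eqVneq (mu i) 0%N; first by rewrite !mul0r.
congr (_ * _); rewrite -[v i]mevalXU -mevalM -mpolyXD; congr (_.@[v]); congr 'X_[_].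
by rewrite addmC submK // lep1mP.
Qed.

Lemma mderivXU (k : nzRingType) (m : nat) (i l : 'I_m) :
  mderiv l ('X_i : {mpoly k[m]}) = (i == l)%:R.
Proof.
rewrite mderivX mnm1E; have [->|_] := eqVneq; last by rewrite scale0r.
by rewrite scale1r -[X in (X - _)%MM]add0m addmK mpolyX0.
Qed.

Lemma mmap_mul (m : nat) (k : nzRingType) (S : comNzRingType) (f : {rmorphism k -> S})
  (h : 'I_m -> S) : {morph mmap f h : F G / F * G}.
Proof. by move=> F G; rewrite (rmorphM (mmap f h)). Qed.

Section Smooth.
Variables (n : nat) (M : fieldType) (ev : {rmorphism {mpoly algC[n]} -> M}).
Variables (T : Type) (co : T -> 'I_n -> algC).
Hypothesis evP : forall F, ev F = 0 <-> forall P, F.@[co P] = 0.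
Local Notation cst := (ev \o @mpolyC n algC : {rmorphism algC -> M}).
Local Notation value_at := (value_at ev co).

Variables (P : T) (j : 'I_n).
Hypothesis Pj : co P j = 1.

Let z (i : 'I_n) : M := ev 'X_i / ev 'X_j.
Let g (i : 'I_n) : M := z i - cst (co P i).

Lemma xj_neq0 : ev 'X_j != 0.
Proof. by apply: (ev_neq0 evP (P := P)); rewrite mevalXU Pj oner_eq0. Qed.

Lemma value_z i : value_at (z i) P (co P i).
Proof.
by rewrite -[co P i]divr1 -Pj; apply: value_at_coord; rewrite Pj oner_eq0.
Qed.

Lemma value_g i : value_at (g i) P 0.
Proof. by rewrite -(subrr (co P i)); apply/(value_at_sub evP)/value_at_cst/value_z. Qed.

Lemma g_j : g j = 0.
Proof. by rewrite /g /z divff ?xj_neq0 // Pj rmorph1 subrr. Qed.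

(** First order expansion at P in the affine coordinates z. The assertion is
    stable under sums and products, so it suffices to check it for constants and
    for the coordinates. *)
Lemma taylor F : exists h : 'I_n -> M, (forall i, value_at (h i) P 0) /\
  mmap cst z F = cst F.@[co P] + \sum_i (cst (mderiv i F).@[co P] + h i) * g i.
Proof.
have v0 : value_at 0 P 0 by rewrite -(rmorph0 cst); apply: value_at_cst.
elim/mpoly_ring_ind: F => [c|i|F G [h [h0 Fh]] [h' [h'0 Gh]]|F G [h [h0 Fh]] [h' [h'0 Gh]]].
- exists (fun=> 0); split=> //; rewrite mmapC mevalC big1 ?addr0 // => i _.
  by rewrite mderivC meval0 rmorph0 addr0 mul0r.
- exists (fun=> 0); split=> //; rewrite mmapX mmap1U mevalXU (bigD1 i) //= big1.
    by rewrite addr0 addr0 mderivXU eqxx meval1 rmorph1 mul1r /g addrC subrK.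
  by move=> k nki; rewrite mderivXU eq_sym (negPf nki) meval0 rmorph0 addr0 mul0r.
- exists (fun i => h i + h' i); split=> [i|]; first by rewrite -[0]addr0; apply: value_at_add.
  rewrite mmapD Fh Gh mevalD rmorphD addrACA -big_split; congr (_ + _).
  by apply: eq_bigr => i _; rewrite mderivD mevalD rmorphD /=; ring.
- have vF (H : {mpoly algC[n]}) k : (forall i, value_at (k i) P 0) ->
      mmap cst z H = cst H.@[co P] + \sum_i (cst (mderiv i H).@[co P] + k i) * g i ->
      value_at (mmap cst z H - cst H.@[co P]) P 0.
    move=> k0 ->; rewrite addrC addKr.
    have <- : \sum_(i < n) (0 : algC) = 0 by rewrite big1.
    apply: value_at_sum => // i; rewrite -(mulr0 ((mderiv i H).@[co P] + 0)).
    apply: value_at_mul (value_g i); apply: value_at_add => //; exact: value_at_cst.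
  have vG := vF _ _ h'0 Gh; set G' := _ - _ in vG.
  have DG : mmap cst z G = cst G.@[co P] + G' by rewrite addrC subrK.
  exists (fun i => cst F.@[co P] * h' i + h i * mmap cst z G + cst (mderiv i F).@[co P] * G').
  split=> [i|].
    rewrite -(addr0 0) -{1}(addr0 0); apply: value_at_add => //; last first.
      by rewrite -(mulr0 (mderiv i F).@[co P]); apply: value_at_mul => //; apply: value_at_cst.
    apply: value_at_add => //.
      by rewrite -(mulr0 F.@[co P]); apply: value_at_mul => //; apply: value_at_cst.
    rewrite -(mul0r (G.@[co P] + 0)); apply: value_at_mul => //; rewrite DG.
    by apply: value_at_add => //; apply: value_at_cst.
  rewrite mmap_mul mevalM (rmorphM cst) {1}Fh mulrDl {1}Gh mulrDr -addrA; congr (_ + _).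
  rewrite mulr_sumr mulr_suml -big_split; apply: eq_bigr => i _ /=.
  rewrite mderivM mevalD !mevalM rmorphD !rmorphM /= DG.
  by ring.
Qed.

End Smooth.

(** The rows of J vanish on p, while the j-th coordinate does not. Hence J
    together with the j-th and one more coordinate form has full rank n, and a
    left inverse. *)
Lemma corank_two_complement (F : fieldType) (k n : nat) (J : 'M[F]_(k, n))
    (p : 'cV[F]_n) (j : 'I_n) : (\rank J).+2 = n -> J *m p = 0 -> p j 0 != 0 ->
  exists (i0 : 'I_n) (B : 'M_(n, k)) (b c : 'cV_n),
    B *m J + b *m delta_mx 0 j + c *m delta_mx 0 i0 = 1%:M.
Proof.
move=> rk Jp pj.
have lt_rank m (A : 'M[F]_(m, n)) (e : 'rV[F]_n) : ~~ (e <= A)%MS ->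
    (\rank A < \rank (A + e)%MS)%N.
  move=> ne; have : (A < A + e)%MS by rewrite ltmxE addsmxSl addsmx_sub submx_refl.
  by rewrite ltmxErank => /andP[].
have nj : ~~ ((delta_mx 0 j : 'rV_n) <= J)%MS.
  apply: contra pj => /submxP[C DC]; have : delta_mx 0 j *m p = 0 :> 'M_1.
    by rewrite DC -mulmxA Jp mulmx0.
  by rewrite -rowE => /matrixP/(_ 0 0); rewrite !mxE => ->.
set A := (J + (delta_mx 0 j : 'rV_n))%MS.
have rkA : (\rank A < n)%N.
  have := mxrank_adds_leqif J (delta_mx 0 j : 'rV_n) => -[+ _].
  by rewrite mxrank_delta -/A; lia.
have [i0 ni0] : exists i0, ~~ ((delta_mx 0 i0 : 'rV_n) <= A)%MS.
  apply/existsP; apply: contraLR rkA; rewrite negb_exists => /forallP all_le.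
  have : (1%:M <= A)%MS.
    by apply/row_subP => i; rewrite rowE mulmx1; have := all_le i; rewrite negbK.
  by move/mxrankS; rewrite mxrank1 -leqNgt.
exists i0; have full : row_full (A + (delta_mx 0 i0 : 'rV_n))%MS.
  rewrite /row_full eqn_leq rank_leq_col -[leqLHS]rk.
  by rewrite (leq_ltn_trans _ (lt_rank _ _ _ ni0)) // (lt_rank _ _ _ nj).
have /submxP[D DD] : (1%:M <= col_mx (col_mx J (delta_mx 0 j : 'rV_n)) (delta_mx 0 i0 : 'rV_n))%MS.
  rewrite -addsmxE; apply: submx_trans (submx_full _ full) _.
  by rewrite addsmxS // /A addsmxE.
exists (lsubmx (lsubmx D)), (rsubmx (lsubmx D)), (rsubmx D).
by rewrite DD -[D in RHS]hsubmxK mul_row_col -[lsubmx D in RHS]hsubmxK mul_row_col.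
Qed.

Section Uniformizer.
Variables (n : nat) (M : fieldType) (ev : {rmorphism {mpoly algC[n]} -> M}).
Variables (T : Type) (co : T -> 'I_n -> algC).
Hypothesis evP : forall F, ev F = 0 <-> forall P, F.@[co P] = 0.
Local Notation cst := (ev \o @mpolyC n algC : {rmorphism algC -> M}).
Local Notation value_at := (value_at ev co).
Variable P : T.

Let mval (r s : nat) (A : 'M[M]_(r, s)) (a : 'M[algC]_(r, s)) :=
  forall i j, value_at (A i j) P (a i j).

Lemma mval_mul r s t (A : 'M_(r, s)) a (B : 'M_(s, t)) b :
  mval A a -> mval B b -> mval (A *m B) (a *m b).
Proof.
move=> Aa Bb i j; rewrite !mxE; apply: value_at_sum => // l; exact: value_at_mul.
Qed.

Lemma mval_det r (A : 'M_r) a : mval A a -> value_at (\det A) P (\det a).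
Proof.
move=> Aa; rewrite /determinant; apply: value_at_sum => // s.
apply: value_at_mul; last exact: value_at_prod.
by rewrite -(rmorph_sign cst); apply: value_at_cst.
Qed.

Lemma mval_adj r (A : 'M_r) a : mval A a -> mval (\adj A) (\adj a).
Proof.
move=> Aa i j; rewrite !mxE /cofactor; apply: value_at_mul.
  by rewrite -(rmorph_sign cst); apply: value_at_cst.
by apply: mval_det => k l; rewrite !mxE.
Qed.

(** The determinant of 1 - L has the value 1 at P, so Cramer's rule solves
    (1 - L) g = gam w in the local ring. *)
Lemma nakayama (g w : 'cV[M]_n) (L : 'M_n) (gam : M) (w0 : 'cV_n) :
  mval L 0 -> mval w w0 -> g = L *m g + gam *: w ->
  exists2 u : 'cV[M]_n, g = gam *: u & exists u0, mval u u0.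
Proof.
move=> L0 ww0 Dg; pose A := 1%:M - L.
have A1 : mval A 1%:M.
  move=> i j; rewrite !mxE -[_%:R in X in value_at _ _ X]subr0.
  have := L0 i j; rewrite mxE => Lij; apply: value_at_sub => //.
  by rewrite -(rmorph_nat cst); apply: value_at_cst.
have Ag : A *m g = gam *: w by rewrite mulmxBl mul1mx {1}Dg addrC addKr.
have det1 := mval_det A1; rewrite det1 in det1.
have det_n0 : \det A != 0.
  apply/eqP => D0; have v0 : value_at 0 P 0.
    by rewrite -(rmorph0 cst); apply: value_at_cst.
  rewrite D0 in det1; have /eqP := value_at_uniq evP det1 v0.
  by rewrite oner_eq0.
exists ((\det A)^-1 *: (\adj A *m w)).
  have := congr1 (mulmx (\adj A)) Ag; rewrite mulmxA mul_adj_mx mul_scalar_mx -scalemxAr.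
  move/(congr1 (fun m => (\det A)^-1 *: m)); rewrite !scalerA mulVf // scale1r => ->.
  by rewrite mulrC.
exists (1 *: (\adj 1%:M *m w0)) => i j; rewrite !mxE.
apply: value_at_mul => //; last by have := mval_mul (mval_adj A1) ww0 i j; rewrite !mxE.
by rewrite -[1]invr1; apply: value_at_inv; rewrite ?oner_eq0.
Qed.

End Uniformizer.

(** The equation p(f, g) = 0, with p seen as a polynomial in its second variable
    over the polynomials in the first. *)
Definition algebraic_relation (M : fieldType) (cst : {rmorphism algC -> M}) (f g : M) : Prop :=
  exists2 p : {poly {poly algC}}, p != 0 &
    \sum_(i < size p) (map_poly cst p`_i).[f] * g ^+ i = 0.

(** The relation is divided by the largest possible power of g. *)
Lemma algebraic_relation_const (M : fieldType) (cst : {rmorphism algC -> M}) (f g : M) :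
  algebraic_relation cst f g -> g != 0 ->
  exists2 p : {poly {poly algC}}, p`_0 != 0 &
    \sum_(i < size p) (map_poly cst p`_i).[f] * g ^+ i = 0.
Proof.
move=> [p p0 rel] g0.
have ex : exists i, p`_i != 0 by exists (size p).-1; rewrite -lead_coefE lead_coef_eq0.
case: (ex_minnP ex) => i0 pi0 min_i0.
have lt_i0 : (i0 < size p)%N.
  by rewrite ltnNge; apply: contra pi0 => /leq_sizeP/(_ i0 (leqnn _)) ->.
have q_i i : (drop_poly i0 p)`_i = p`_(i0 + i) by rewrite coef_drop_poly addnC.
exists (drop_poly i0 p); first by rewrite q_i addn0.
apply: (mulfI (expf_neq0 i0 g0)); rewrite mulr0 -[RHS]rel mulr_sumr size_drop_poly.
rewrite -[RHS](big_mkord predT (fun i => (map_poly cst p`_i).[f] * g ^+ i)).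
rewrite (big_cat_nat (leq0n i0) (ltnW lt_i0)) [X in _ = X + _]big1_seq ?add0r; last first.
  move=> i /andP[_]; rewrite mem_iota subn0 => /andP[_ lt_i].
  have -> : p`_i = 0 by apply/eqP; apply: contraTT lt_i => /min_i0; rewrite -leqNgt.
  by rewrite rmorph0 horner0 mul0r.
rewrite -[X in index_iota X _]add0n [RHS]big_addn.
rewrite big_mkord; apply: eq_bigr => i _.
by rewrite q_i mulrCA -exprD (addnC i0 i).
Qed.

Section LocalRing.
Variables (n : nat) (M : fieldType) (ev : {rmorphism {mpoly algC[n]} -> M}).
Variables (T : Type) (co : T -> 'I_n -> algC).
Hypothesis evP : forall F, ev F = 0 <-> forall P, F.@[co P] = 0.
Local Notation cst := (ev \o @mpolyC n algC : {rmorphism algC -> M}).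
Local Notation value_at := (value_at ev co).

Variables (k : nat) (E : 'I_k -> {mpoly algC[n]}) (dE : 'I_k -> nat).
Hypothesis E_homog : forall l, E l \is (dE l).-homog.
Hypothesis E_vanish : forall l, ev (E l) = 0.
Definition jac P : 'M_(k, n) := \matrix_(l, i) (mderiv i (E l)).@[co P].

Section AtPoint.
Variables (P : T) (j : 'I_n).
Hypothesis Pj : co P j = 1.
Hypothesis smooth : (\rank (jac P)).+2 = n.
Let z (i : 'I_n) : M := ev 'X_i / ev 'X_j.

Lemma mmap_z d F : F \is d.-homog -> mmap cst z F = (ev 'X_j)^-1 ^+ d * ev F.
Proof.
move=> hF; rewrite (ev_mmap ev F); apply: mmap_homog hF _ => i.
by rewrite /z mulrC.
Qed.

Lemma frac_z d F G : F \is d.-homog -> G \is d.-homog ->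
  ev F / ev G = mmap cst z F / mmap cst z G.
Proof.
move=> hF hG; rewrite (mmap_z hF) (mmap_z hG) -mulf_div divff ?mul1r //.
by rewrite expf_neq0 // invr_eq0 (xj_neq0 evP Pj).
Qed.

Lemma value_mmap_z F : value_at (mmap cst z F) P F.@[co P].
Proof.
elim/mpoly_ring_ind: F => [c|i|F G HF HG|F G HF HG].
- by rewrite mmapC mevalC; apply: value_at_cst.
- by rewrite mmapX mmap1U mevalXU; apply: value_z.
- by rewrite mmapD mevalD; apply: value_at_add.
- by rewrite mmap_mul mevalM; apply: value_at_mul.
Qed.

(** By Taylor expansion of the equations, the Jacobian matrix maps the vector of
    the local coordinates g i to terms of second order. Its rank being n - 2, and
    g j being 0, all the g i are multiples of one of them up to terms of second
    order, which [nakayama] removes. Any function vanishing at P is a combination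
    of the g i. *)
Lemma uniformizer : exists gam : M, value_at gam P 0 /\
  forall f, value_at f P 0 -> exists u a, f = gam * u /\ value_at u P a.
Proof.
pose g i := z i - cst (co P i).
have g0 i : value_at (g i) P 0 := value_g evP Pj i.
have gj : g j = 0 := g_j evP Pj.
pose p : 'cV[algC]_n := \col_i co P i.
have EP l : (E l).@[co P] = 0 by have /evP := E_vanish l.
have Jp : jac P *m p = 0.
  apply/colP => l; rewrite !mxE.
  under eq_bigr do rewrite !mxE mulrC.
  by rewrite (mpoly_euler _ (E_homog l)) EP mulr0.
have pj : p j 0 != 0 by rewrite mxE Pj oner_eq0.
have [i0 [B [b [c DB]]]] := corank_two_complement smooth Jp pj.
have Ht l : exists h : 'I_n -> M, (forall i, value_at (h i) P 0) /\
    \sum_i (cst (jac P l i) + h i) * g i = 0.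
  have [h [h0 Dh]] := taylor evP Pj (E l); exists h; split=> //.
  move: Dh; rewrite (mmap_z (E_homog l)) E_vanish mulr0 EP rmorph0 add0r => Dh.
  by rewrite [RHS]Dh; apply: eq_bigr => i _; rewrite mxE.
pose hh l := sval (cid (Ht l)); have hhP l := svalP (cid (Ht l)).
pose H : 'M[M]_(k, n) := \matrix_(l, i) hh l i.
have H0 l i : value_at (H l i) P 0 by rewrite mxE; have [h0 _] := hhP l; apply: h0.
pose G : 'cV[M]_n := \col_i g i.
have JG : map_mx cst (jac P) *m G = - (H *m G).
  apply/eqP; rewrite -addr_eq0 -mulmxDl; apply/eqP/colP => l; rewrite !mxE.
  have [_ Dl] := hhP l; rewrite -[RHS]Dl; by apply: eq_bigr => i _; rewrite !mxE.
pose L := - (map_mx cst B *m H).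
have DG : G = L *m G + g i0 *: map_mx cst c.
  have := congr1 (fun A => map_mx cst A *m G) DB.
  rewrite !map_mxD !map_mxM map_mx1 mul1mx !mulmxDl -!mulmxA JG => {1}<-.
  rewrite !map_delta_mx -!rowE.
  have -> : row j G = 0 by apply/rowP => i; rewrite !mxE gj.
  rewrite mulmx0 addr0 /L mulNmx mulmxN mulmxA; congr (_ + _).
  by apply/colP => i; rewrite !mxE big_ord1 !mxE mulrC.
have L0 i l : value_at (L i l) P ((0 : 'M[algC]_n) i l).
  rewrite !mxE -[X in value_at _ _ X]oppr0; apply: value_at_opp => //.
  have -> : (0 : algC) = \sum_(l < k) B i l * 0.
    by rewrite big1 // => ? _; rewrite mulr0.
  apply: value_at_sum => // l'; apply: value_at_mul => //.
  by rewrite mxE; apply: value_at_cst.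
have cc i l : value_at (map_mx cst c i l) P (c i l) by rewrite mxE; apply: value_at_cst.
have [u Du [u0 uu0]] := nakayama evP L0 cc DG.
exists (g i0); split; first exact: g0.
move=> f [d [F [F' [hF hF' F'P -> /esym/eqP]]]].
rewrite mulf_eq0 invr_eq0 (negPf F'P) orbF => /eqP FP.
have [h [h0 Dh]] := taylor evP Pj F.
exists ((\sum_i (cst (mderiv i F).@[co P] + h i) * u i 0) / mmap cst z F').
exists ((\sum_i ((mderiv i F).@[co P] + 0) * u0 i 0) / F'.@[co P]); split.
  rewrite (frac_z hF hF') Dh FP rmorph0 add0r mulrA; congr (_ / _).
  rewrite mulr_sumr; apply: eq_bigr => i _.
  by have /colP/(_ i) := Du; rewrite !mxE -/(g i) => ->; rewrite mulrCA.
apply: value_at_mul => //.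
  apply: value_at_sum => // i; apply: value_at_mul => //.
  by apply: value_at_add => //; apply: value_at_cst.
by apply: value_at_inv => //; apply: value_mmap_z.
Qed.

End AtPoint.
End LocalRing.

Section Critical.
Variables (n : nat) (M : fieldType) (ev : {rmorphism {mpoly algC[n]} -> M}).
Variables (T : Type) (co : T -> 'I_n -> algC).
Hypothesis evP : forall F, ev F = 0 <-> forall P, F.@[co P] = 0.
Local Notation cst := (ev \o @mpolyC n algC : {rmorphism algC -> M}).
Local Notation value_at := (value_at ev co).
Local Notation rational_function := (rational_function ev).

Hypothesis alg_rel : forall f g, rational_function f -> rational_function g ->
  algebraic_relation cst f g.

Section Valuation.
Variables (P : T) (gam : M).
Hypothesis gam0 : value_at gam P 0.
Hypothesis gam_gen : forall f, value_at f P 0 ->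
  exists u a, f = gam * u /\ value_at u P a.
Hypothesis gam_neq0 : gam != 0.

Definition unit_at u := exists2 a, a != 0 & value_at u P a.

Lemma unit_at_mul u v : unit_at u -> unit_at v -> unit_at (u * v).
Proof.
move=> [a a0 ua] [b b0 vb]; exists (a * b); first exact: mulf_neq0.
exact: value_at_mul.
Qed.

Lemma unit_at_exp u e : unit_at u -> unit_at (u ^+ e).
Proof.
by move=> [a a0 ua]; exists (a ^+ e); [exact: expf_neq0 | exact: value_at_exp].
Qed.

(** The left-hand side has a nonzero value at P, and the right-hand side the
    value 0. *)
Lemma unit_at_not_multiple i u v : unit_at u -> (exists a, value_at v P a) ->
  u = gam ^+ i.+1 * v -> False.
Proof.
move=> [a a0 ua] [b vb] Du; case/eqP: a0; apply: (value_at_uniq evP ua).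
have := value_at_mul (value_at_exp i.+1 gam0) vb.
by rewrite expr0n mul0r -Du.
Qed.

Lemma unit_at_inj i j u v : unit_at u -> unit_at v ->
  gam ^+ i * u = gam ^+ j * v -> i = j.
Proof.
wlog lt_ij : i j u v / (i < j)%N.
  move=> W uu uv Duv; have [lt_ij|lt_ji|//] := ltngtP i j; first exact: (W i j u v).
  by apply/esym/(W j i v u).
move=> uu [b b0 vb] Duv; case: (@unit_at_not_multiple (j - i.+1) u v) => //; first by exists b.
apply: (mulfI (expf_neq0 i gam_neq0)); rewrite Duv mulrA -exprD.
by congr (_ ^+ _ * _); lia.
Qed.

(** In a relation c_0(gam) + c_1(gam) f + ... = 0 with c_0 != 0, the first term
    is a unit times a power gam^mu, and f divides it. So f is not divisible by
    gam^(mu + 1). *)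
Lemma not_infinitely_divisible f a : value_at f P a -> f != 0 ->
  (forall i, exists u b, f = gam ^+ i * u /\ value_at u P b) -> False.
Proof.
move=> fa f0 inf.
have [p p0 rel] := algebraic_relation_const
  (alg_rel (value_at_fun evP gam0) (value_at_fun evP fa)) f0.
pose c i := (map_poly cst p`_i).[gam].
have [s Ds] : exists s, size p = s.+1.
  exists (size p).-1; rewrite prednK // size_poly_gt0.
  by apply: contraNneq p0 => ->; rewrite coef0.
move: rel; rewrite Ds big_ord_recl -[(map_poly _ _).[gam]]/(c 0%N) expr0 mulr1 => /eqP; rewrite addr_eq0 => /eqP Dc.
pose v := - \sum_(i < s) c i.+1 * f ^+ i.
have Dcv : c 0%N = f * v.
  rewrite Dc mulrN; congr (- _); rewrite mulr_sumr; apply: eq_bigr => i _.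
  by rewrite exprS mulrCA.
have [b vb] : exists b, value_at v P b.
  exists (- \sum_(i < s) (p`_i.+1).[0] * a ^+ i); apply: value_at_opp => //.
  apply: value_at_sum => // i; apply: value_at_mul => //; last exact: value_at_exp.
  exact: value_at_horner.
have [mu [q q_n0 Dq]] := multiplicity_XsubC p`_0 0.
rewrite p0 /= in q_n0.
have [u [b' [Df ub']]] := inf mu.+1.
apply: (@unit_at_not_multiple 0 (map_poly cst q).[gam] (u * v)).
- by exists q.[0]; [exact: q_n0 | exact: value_at_horner].
- by exists (b' * b); apply: value_at_mul.
apply: (mulfI (expf_neq0 mu gam_neq0)); have -> : gam ^+ mu * (gam ^+ 1 * (u * v)) = gam ^+ mu.+1 * u * v.
  by rewrite (exprSr _ mu) expr1 !mulrA.
rewrite -Df -Dcv /c Dq.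
by rewrite subr0 rmorphM rmorphXn /= map_polyX hornerM hornerXn mulrC.
Qed.

Lemma value_at_factor f a : value_at f P a -> f != 0 ->
  exists i u, unit_at u /\ f = gam ^+ i * u.
Proof.
move=> fa f0; apply: contrapT => no; apply: (not_infinitely_divisible fa f0).
elim=> [|i [u [b [Df ub]]]]; first by exists f, a; rewrite mul1r.
have [b0|b0] := eqVneq b 0; last first.
  by case: no; exists i, u; split=> //; exists b.
rewrite b0 in ub; have [u' [b' [Du ub']]] := gam_gen ub.
by exists u', b'; rewrite Df Du exprSr mulrA.
Qed.

End Valuation.
End Critical.

(** * Roots of radicands are critical values *)

Section KummerRoot.
Variables (n : nat) (M : fieldType) (ev : {rmorphism {mpoly algC[n]} -> M}).
Variables (T : Type) (co : T -> 'I_n -> algC).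
Hypothesis evP : forall F, ev F = 0 <-> forall P, F.@[co P] = 0.
Hypothesis T_inh : inhabited T.
Local Notation cst := (ev \o @mpolyC n algC : {rmorphism algC -> M}).
Local Notation value_at := (value_at ev co).
Local Notation rational_function := (rational_function ev).
Hypothesis alg_rel : forall f g, rational_function f -> rational_function g ->
  algebraic_relation cst f g.
Hypothesis co_neq0 : forall P, exists i, co P i != 0.

Variables (k : nat) (E : 'I_k -> {mpoly algC[n]}) (dE : 'I_k -> nat).
Hypothesis E_homog : forall l, E l \is (dE l).-homog.
Hypothesis E_vanish : forall l, ev (E l) = 0.
Hypothesis E_points : forall c : 'I_n -> algC, (exists i, c i != 0) ->
  (forall l, (E l).@[c] = 0) -> exists P, co P = c.
Hypothesis smooth : forall P, (\rank (jac co E P)).+2 = n.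

Section Center.
Variable V : set (M * algC).
Hypothesis Vg : place_graph cst V.
Hypothesis V_total : forall f, f != 0 -> (exists a, V (f, a)) \/ V (f^-1, 0).

Lemma place_uniq f a b : V (f, a) -> V (f, b) -> a = b.
Proof.
move=> Va /(pg_opp Vg) Vb; have := pg_add Vg Va Vb; rewrite subrr => /(pg_fun Vg)/eqP.
by rewrite subr_eq0 => /eqP.
Qed.

Lemma place_inv f a : V (f, a) -> a != 0 -> V (f^-1, a^-1).
Proof.
move=> Vf a0; have f0 : f != 0.
  by apply: contraNneq a0 => f0; rewrite f0 in Vf; rewrite (pg_fun Vg Vf).
have [[b Vb]|] := V_total (invr_neq0 f0); last first.
  by rewrite invrK => /(place_uniq Vf) Da; rewrite Da eqxx in a0.
have := pg_mul Vg Vf Vb; rewrite divff // => /(place_uniq (pg_one Vg)) Dab.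
by have -> : a^-1 = b by apply: (mulfI a0); rewrite divff.
Qed.

(** The coordinate of least valuation exists, because any two are comparable, since of
    two inverse quotients at least one has a value. *)
Lemma best_coordinate (s : seq 'I_n) : has (fun i => ev 'X_i != 0) s ->
  exists j, ev 'X_j != 0 /\ forall i, i \in s -> exists a, V (ev 'X_i / ev 'X_j, a).
Proof.
have V0 j : exists a, V (0 / ev 'X_j, a) by exists 0; rewrite mul0r; apply: pg_zero Vg.
elim: s => // l s IH /=; have [xl0|xl0] := eqVneq (ev 'X_l) 0.
  move=> /IH[j [xj0 Hj]]; exists j; split=> // i; rewrite inE => /orP[/eqP->|/Hj//].
  by rewrite xl0; apply: V0.
have Vll : V (ev 'X_l / ev 'X_l, 1) by rewrite divff //; apply: pg_one Vg.
have [/IH[j [xj0 Hj]] _|/hasPn none _] := boolP (has (fun i => ev 'X_i != 0) s); last first.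
  exists l; split=> // i; rewrite inE => /orP[/eqP->|/none]; first by exists 1.
  by rewrite negbK => /eqP->; apply: V0.
have [[a Va]|Vinv] := V_total (mulf_neq0 xl0 (invr_neq0 xj0)).
  by exists j; split=> // i; rewrite inE => /orP[/eqP->|/Hj//]; exists a.
exists l; split=> // i; rewrite inE => /orP[/eqP->|/Hj[a Va]]; first by exists 1.
exists (a * 0); suff -> : ev 'X_i / ev 'X_l = ev 'X_i / ev 'X_j * (ev 'X_l / ev 'X_j)^-1.
  exact: (pg_mul Vg).
by rewrite invf_div mulrA divfK.
Qed.

(** The values of the quotients x_i / x_j by the coordinate of least valuation
    satisfy the equations, and are the coordinates of P. *)
Lemma place_center : exists P j, co P j = 1 /\
  forall f a, value_at f P a -> V (f, a).
Proof.
have hasx : has (fun i => ev 'X_i != 0) (enum 'I_n).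
  have [P] := T_inh; have [i Pi] := co_neq0 P; apply/hasP; exists i.
    by rewrite mem_enum.
  by apply: (ev_neq0 evP (P := P)); rewrite mevalXU.
have [j [xj0 Hj]] := best_coordinate hasx.
have Hc i : exists a, V (ev 'X_i / ev 'X_j, a) by apply: Hj; rewrite mem_enum.
pose c i := sval (cid (Hc i)); have Vc i : V (ev 'X_i / ev 'X_j, c i) := svalP (cid (Hc i)).
have cj : c j = 1.
  by apply: place_uniq (Vc j) _; rewrite divff //; apply: pg_one Vg.
pose z i := ev 'X_i / ev 'X_j.
have Vz F : V (mmap cst z F, F.@[c]).
  elim/mpoly_ring_ind: F => [b|i|F G HF HG|F G HF HG].
  - by rewrite mmapC mevalC; apply: (pg_cst Vg).
  - by rewrite mmapX mmap1U mevalXU; exact: Vc.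
  - by rewrite mmapD mevalD; apply: (pg_add Vg).
  - by rewrite mmap_mul mevalM; apply: (pg_mul Vg).
have zE d F : F \is d.-homog -> mmap cst z F = (ev 'X_j)^-1 ^+ d * ev F.
  by move=> hF; rewrite (ev_mmap ev F); apply: mmap_homog hF _ => i; rewrite /z mulrC.
have [P DP] : exists P, co P = c.
  apply: E_points; first by exists j; rewrite cj oner_eq0.
  by move=> l; have := Vz (E l); rewrite (zE _ _ (E_homog l)) E_vanish mulr0 => /(pg_fun Vg).
exists P, j; rewrite DP; split=> // f a [d [F [G [hF hG GP -> ->]]]].
have Pj : co P j = 1 by rewrite DP.
rewrite (frac_z evP Pj hF hG) DP; rewrite DP in GP.
by apply: (pg_mul Vg); [exact: Vz | apply: place_inv => //; exact: Vz].
Qed.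

End Center.

(** Let gam be a uniformizer at the centre P of a place with t = alpha. If
    t - alpha has order at least 2, it is the product of gam and a function
    vanishing at P. If it has order 1, the orders of both sides of the equation
    for y^e are e times the order of y, and m; so e divides m. *)
Theorem kummer_root_critical (t y : M) (e m : nat) (alpha : algC) (q : {poly algC}) :
  rational_function t -> (forall p : {poly algC}, (map_poly cst p).[t] = 0 -> p = 0) ->
  rational_function y -> (0 < e)%N -> ~~ (e %| m)%N -> q.[alpha] != 0 ->
  y ^+ e = (map_poly cst (('X - alpha%:P) ^+ m * q)).[t] ->
  exists P f g, [/\ value_at f P 0, value_at g P 0 & t - cst alpha = f * g].
Proof.
move=> rt t_tr ry e_gt0 e_ndvd qa Dy.
have [V [Vg Vt V_total]] := place_exists alpha t_tr.
have [P [j [Pj Vval]]] := place_center Vg V_total.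
have [gam [gam0 gam_gen]] := uniformizer evP E_homog E_vanish Pj (smooth P).
have fracP f : rational_function f -> exists f1 f2 a b,
    [/\ f = f1 / f2, f2 != 0, value_at f1 P a & value_at f2 P b].
  move=> [d [F [G [hF hG G0 Df]]]]; pose z i := ev 'X_i / ev 'X_j.
  exists (mmap cst z F), (mmap cst z G), F.@[co P], G.@[co P].
  rewrite Df (frac_z evP Pj hF hG); split=> //; try exact: value_mmap_z.
  rewrite (mmap_z _ _ hG) mulf_neq0 // expf_neq0 // invr_eq0.
  exact: (xj_neq0 evP Pj).
have not_cst c : t != cst c.
  apply/eqP => Dt; have := t_tr ('X - c%:P).
  rewrite rmorphB /= map_polyX map_polyC hornerXsubC => H.
  have /H/eqP : t - cst c = 0 by rewrite -Dt subrr.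
  by rewrite polyXsubC_eq0.
have gam_n0 : gam != 0.
  apply/eqP => Dgam.
  have valcst f a : value_at f P a -> f = cst a.
    move=> fa; have fa0 : value_at (f - cst a) P 0.
      by rewrite -(subrr a); apply: value_at_sub => //; apply: value_at_cst.
    have [u [b [Df _]]] := gam_gen _ fa0.
    by apply/eqP; rewrite -subr_eq0 Df Dgam mul0r.
  have [f1 [f2 [a [b [Dt _ /valcst Df1 /valcst Df2]]]]] := fracP t rt.
  by have /eqP[] := not_cst (a / b); rewrite Dt Df1 Df2 fmorph_div.
have factor f : rational_function f -> f != 0 ->
    exists i l u, unit_at ev co P u /\ f * gam ^+ l = gam ^+ i * u.
  move=> rf f0; have [f1 [f2 [a [b [Df f2n0 f1a f2b]]]]] := fracP f rf.
  have f1n0 : f1 != 0 by apply: contraNneq f0 => f10; rewrite Df f10 mul0r.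
  have [i [u [uu Du]]] := value_at_factor evP alg_rel gam0 gam_gen gam_n0 f1a f1n0.
  have [l [v [[b' b'0 vv] Dv]]] := value_at_factor evP alg_rel gam0 gam_gen gam_n0 f2b f2n0.
  have v0 : v != 0 by apply: contraNneq f2n0 => v0; rewrite Dv v0 mulr0.
  exists i, l, (u / v); split.
    by apply: unit_at_mul => //; exists b'^-1; [rewrite invr_eq0 | apply: value_at_inv].
  by rewrite Df Du Dv; field; rewrite v0 expf_neq0.
pose f := t - cst alpha.
have rf : rational_function f by apply: rational_function_sub => //; exact: rational_function_cst.
have Vf : V (f, 0) by rewrite -(subrr alpha); apply: (pg_add Vg Vt); apply/(pg_opp Vg)/(pg_cst Vg).
have f_n0 : f != 0 by rewrite subr_eq0 not_cst.
have [i [l [u [uu Du]]]] := factor f rf f_n0.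
have [b b0 ub] := uu.
have lt_li : (l < i)%N.
  rewrite ltnNge; apply/negP => le_il.
  have Dfu : f * gam ^+ (l - i) = u.
    apply: (mulfI (expf_neq0 i gam_n0)); rewrite -Du mulrCA -exprD.
    by congr (_ * _ ^+ _); lia.
  have := pg_mul Vg Vf (pg_exp Vg (l - i) (Vval _ _ gam0)); rewrite Dfu mul0r.
  by move/(place_uniq Vg (Vval _ _ ub)) => Db; rewrite Db eqxx in b0.
have Df : f = gam ^+ (i - l) * u.
  apply: (mulIf (expf_neq0 l gam_n0)); rewrite Du mulrAC -exprD.
  by congr (_ ^+ _ * _); lia.
have [il1|il1] := eqVneq (i - l)%N 1%N; last first.
  exists P, gam, (gam ^+ (i - l).-1 * u); split=> //.
    have := value_at_mul (value_at_exp (i - l).-1 gam0) ub.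
    have -> : (0 : algC) ^+ (i - l).-1 = 0 by rewrite expr0n; case: eqP => // ?; lia.
    by rewrite mul0r.
  by rewrite mulrA -exprS prednK // -/f; lia.
have y0 : y != 0.
  apply/eqP => Dy0; move: Dy; rewrite Dy0 expr0n gtn_eqF // => /esym/t_tr/eqP.
  rewrite mulf_eq0 expf_eq0 polyXsubC_eq0 andbF /= => /eqP Dq.
  by rewrite Dq horner0 eqxx in qa.
have [i' [l' [w [uw Dw]]]] := factor y ry y0.
have fa : value_at f P 0.
  by rewrite Df il1 expr1; have := value_at_mul gam0 ub; rewrite mul0r.
have ta : value_at t P alpha.
  have -> : t = f + cst alpha by rewrite subrK.
  rewrite -[X in value_at _ _ X]add0r; apply: value_at_add => //.
  exact: value_at_cst.
have uq : unit_at ev co P (map_poly cst q).[t] by exists q.[alpha]; last exact: value_at_horner.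
case/negP: e_ndvd.
have : (m + l' * e = i' * e)%N.
  apply: (unit_at_inj evP gam0 gam_n0 (unit_at_mul (unit_at_exp m uu) uq) (unit_at_exp e uw)).
  rewrite [gam ^+ (i' * e)]exprM -exprMn -Dw exprMn Dy rmorphM rmorphXn rmorphB /=.
  rewrite map_polyX map_polyC hornerM horner_exp hornerXsubC -/f Df il1 expr1.
  by rewrite exprMn exprD exprM; ring.
by move=> Dm; rewrite -(dvdn_addl _ (dvdn_mull l' (dvdnn e))) Dm dvdn_mull.
Qed.

End KummerRoot.

(** * Subfields and degrees of composita *)

Definition degree_le (D : nat) (x : algC) : Prop :=
  exists q : {poly rat}, [/\ q != 0, (size q <= D.+1)%N & root (map_poly ratr q) x].

Lemma dim_adjoin_seq_le (E : fieldExtType rat) (D : nat) (s : seq E) :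
  (forall x, x \in s -> exists q : {poly rat},
     [/\ q != 0, (size q <= D.+1)%N & root (map_poly (in_alg E) q) x]) ->
  (\dim <<1 & s>> <= D ^ size s)%N.
Proof.
elim/last_ind: s => [|s x IH] Hs; first by rewrite Fadjoin_nil dimv1.
rewrite adjoin_rcons dim_Fadjoin size_rcons expnS leq_mul //; last first.
  by apply: IH => y sy; apply: Hs; rewrite mem_rcons inE sy orbT.
have [q [q0 sz_q qx]] : exists q : {poly rat},
     [/\ q != 0, (size q <= D.+1)%N & root (map_poly (in_alg E) q) x].
  by apply: Hs; rewrite mem_rcons mem_head.
rewrite -ltnS -size_minPoly; apply: leq_trans sz_q.
rewrite -(size_map_poly (in_alg E)); apply: dvdp_leq; first by rewrite map_poly_eq0.
apply: minPoly_dvdp qx; apply/polyOverP => i.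
by rewrite coef_map /= rpredZ // rpred1.
Qed.

Lemma is_subfieldP (L : fieldType) (K : set L) : is_subfield K <->
  [/\ K 1, forall x y, K x -> K y -> K (x - y) & forall x y, K x -> K y -> K (x / y)].
Proof.
have inK x : x \in [pred x | x \in K] <-> K x.
  by split=> [/set_mem//|Kx]; apply/mem_set.
split=> -[K1 KB KV]; split; first exact/inK.
- by move=> x y /inK Kx /inK Ky; apply/inK/KB.
- by move=> x y /inK Kx /inK Ky; apply/inK/KV.
- exact/inK.
- by move=> x y /inK Kx /inK Ky; apply/inK/KB.
- by move=> x y /inK Kx /inK Ky; apply/inK/KV.
Qed.

Section Subfield.
Variables (L : fieldType) (K : set L).
Hypothesis subK : is_subfield K.

Lemma subfield0 : K 0.
Proof. by have [K1 KB _] := (is_subfieldP K).1 subK; rewrite -(subrr 1); apply: KB. Qed.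

Lemma subfieldB x y : K x -> K y -> K (x - y).
Proof. by have [_ KB _] := (is_subfieldP K).1 subK; apply: KB. Qed.

Lemma subfieldV x y : K x -> K y -> K (x / y).
Proof. by have [_ _ KV] := (is_subfieldP K).1 subK; apply: KV. Qed.

Lemma subfieldD x y : K x -> K y -> K (x + y).
Proof.
by move=> Kx Ky; rewrite -[y]opprK -[- y]sub0r; apply/subfieldB/subfieldB => //; apply: subfield0.
Qed.

Lemma subfieldM x y : K x -> K y -> K (x * y).
Proof.
move=> Kx Ky; rewrite -[y]invrK -[y^-1]mul1r; apply/subfieldV/subfieldV => //.
by have [] := (is_subfieldP K).1 subK.
Qed.

Lemma subfield_rat (f : {rmorphism rat -> L}) c : K (f c).
Proof.
have K1 : K 1 by have [] := (is_subfieldP K).1 subK.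
have Knat (i : nat) : K i%:R.
  by elim: i => [|i IH]; [exact: subfield0 | rewrite -natr1; apply: subfieldD].
have Kint (i : int) : K i%:~R.
  case: i => i; first exact: Knat.
  rewrite NegzE rmorphN -[- _]sub0r; apply: subfieldB; first exact: subfield0.
  exact: Knat.
rewrite -(divq_num_den c) fmorph_div !rmorph_int; exact: subfieldV.
Qed.

Lemma subfield_sum (I : eqType) (s : seq I) (F : I -> L) :
  (forall i, i \in s -> K (F i)) -> K (\sum_(i <- s) F i).
Proof.
move=> KF; rewrite big_seq; apply: (big_ind K) => //; first exact: subfield0.
exact: subfieldD.
Qed.

Lemma subfield_horner (k : nzRingType) (f : {rmorphism k -> L}) (p : {poly k}) x :
  (forall c, K (f c)) -> K x -> K (map_poly f p).[x].
Proof.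
move=> Kf Kx; elim/poly_ind: p => [|p c IH]; first by rewrite rmorph0 horner0; apply: subfield0.
rewrite rmorphD rmorphM /= map_polyX map_polyC hornerMXaddC.
by apply/subfieldD/Kf/subfieldM.
Qed.

End Subfield.

Lemma gen_subfield_is (L : fieldType) (A : set L) : is_subfield (gen_subfield A).
Proof.
apply/is_subfieldP; split=> [K [/is_subfieldP[]//]|x y Ax Ay K KP|x y Ax Ay K KP].
  by have [/is_subfieldP[_ KB _] _] := KP; apply: KB; [apply: Ax|apply: Ay].
by have [/is_subfieldP[_ _ KV] _] := KP; apply: KV; [apply: Ax|apply: Ay].
Qed.

Lemma is_subfield_image (E : fieldExtType rat) (phi : {rmorphism E -> algC})
  (W : {subfield E}) : is_subfield (phi @` [set` W]).
Proof.
apply/is_subfieldP; split.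
- by exists 1; rewrite ?rmorph1 //= mem1v.
- move=> _ _ [a Wa <-] [b Wb <-]; exists (a - b); rewrite ?rmorphB //=.
  exact: rpredB.
- move=> _ _ [a Wa <-] [b Wb <-]; exists (a / b); rewrite ?fmorph_div //=.
  exact: rpred_div.
Qed.

(** The compositum is generated by the at most s generators of one
    representative for each of the distinct fields. *)
Lemma compositum_degree (D s N d : nat) (gens : nat -> seq algC) :
  (forall i, (size (gens i) <= s)%N) ->
  (forall i x, (0 < i)%N -> x \in gens i -> degree_le D.+1 x) ->
  number_field_degree
    (gen_subfield [set x | exists2 i, (0 < i <= N)%N & x \in gens i]) d ->
  (d <= D.+1 ^ (s * size (undup [seq gen_subfield [set` gens i] | i <- iota 1 N])))%N.
Proof.
move=> sz_gens degD [E [phi [rng <-]]].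
pose K i := gen_subfield [set` gens i].
(* one index for each of the distinct fields *)
pose fields := undup [seq K i | i <- iota 1 N].
have repr (F : set algC) : exists i, F \in fields -> (0 < i <= N)%N /\ K i = F.
  have [/[dup] FF|nF] := boolP (F \in fields); last by exists 0%N.
  rewrite mem_undup => /mapP[i]; rewrite mem_iota => iN DF; exists i => _.
  by split=> //; lia.
pose idx F := sval (cid (repr F)).
have idxP F : F \in fields -> (0 < idx F <= N)%N /\ K (idx F) = F.
  by move: (svalP (cid (repr F))).
pose all_gens := flatten [seq gens (idx F) | F <- fields].
have in_range i x : (0 < i <= N)%N -> x \in gens i -> exists y, phi y = x.
  move=> iN gx; have : range phi x by rewrite rng; apply: sub_gen_smallest; exists i.
  by case=> y _ <-; exists y.
have all_range x : x \in all_gens -> exists2 i, (0 < i <= N)%N & x \in gens i.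
  by move=> /flattenP[_ /mapP[F FF ->] gx]; exists (idx F) => //; have [] := idxP F FF.
have [es Des] : exists es : seq E, map phi es = all_gens.
  have : forall x, x \in all_gens -> exists y, phi y = x.
    by move=> x /all_range[i iN gx]; apply: in_range gx.
  elim: all_gens {all_range} => [|x l IH] Hl; first by exists [::].
  have [y Dy] := Hl x (mem_head _ _); have [|es Des] := IH.
    by move=> z lz; apply: Hl; rewrite inE lz orbT.
  by exists (y :: es); rewrite /= Dy Des.
pose W := <<1 & es>>%AS.
have W_all x : x \in all_gens -> (phi @` [set` W]) x.
  by rewrite -Des => /mapP[y sy ->]; exists y => //=; apply: seqv_sub_adjoin.
have full : W = fullv :> {vspace E}.
  apply/vspaceP => y; rewrite memvf.
  suff : (phi @` [set` W]) (phi y) by case=> y' /= Wy' /fmorph_inj <-.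
  have : range phi (phi y) by exists y.
  rewrite rng; apply: smallest_sub; first exact: is_subfield_image.
  move=> x [i iN gx].
  have KF : K i \in fields.
    by rewrite mem_undup; apply: map_f; rewrite mem_iota; lia.
  have : K (idx (K i)) x.
    by have [_ ->] := idxP _ KF; apply: sub_gen_smallest.
  apply: smallest_sub; first exact: is_subfield_image.
  move=> z /= gz; apply: W_all; apply/flattenP; exists (gens (idx (K i))) => //.
  exact: map_f.
rewrite -full; apply: leq_trans (dim_adjoin_seq_le (D := D.+1) _) _.
  move=> y sy; have : phi y \in all_gens by rewrite -Des map_f.
  move=> /all_range[i /andP[i0 _] /(degD _ _ i0)[q [q0 sz_q qx]]]; exists q; split=> //.
  rewrite -(fmorph_root phi) -map_poly_comp.
  rewrite (eq_map_poly (g := ratr)) // => a /=.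
  by rewrite rmorphZ_num rmorph1 mulr1.
rewrite leq_pexp2l // -(size_map phi) Des size_flatten /shape -map_comp.
rewrite -/fields; elim: (fields) => [|F l IH] /=; first by rewrite muln0.
by rewrite mulnS leq_add.
Qed.

(** * Descent to rational coefficients *)

Section Descent.
Variables (n : nat) (M : fieldType) (ev : {rmorphism {mpoly algC[n]} -> M}).
Local Notation cst := (ev \o @mpolyC n algC : {rmorphism algC -> M}).
Local Notation cstQ := (cst \o (ratr : rat -> algC) : {rmorphism rat -> M}).
Hypothesis ev_conj : forall (nu : {rmorphism algC -> algC}) F,
  ev F = 0 -> ev (map_mpoly nu F) = 0.

Definition rational_functionQ (f : M) : Prop := exists d F G,
  [/\ to_algC F \is d.-homog, to_algC G \is d.-homog,
      ev (to_algC G) != 0 & f = ev (to_algC F) / ev (to_algC G)].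

Lemma map_mpoly_ratr (nu : {rmorphism algC -> algC}) (F : {mpoly rat[n]}) :
  map_mpoly nu (to_algC F) = to_algC F.
Proof. by apply/mpolyP => m; rewrite !mcoeff_map_mpoly /= fmorph_rat. Qed.

Lemma rational_functionQ_mul f g :
  rational_functionQ f -> rational_functionQ g -> rational_functionQ (f * g).
Proof.
move=> [d [F [G [hF hG G0 ->]]]] [e [F' [G' [hF' hG' G'0 ->]]]].
exists (d + e)%N, (F * F'), (G * G'); rewrite !rmorphM /=; split; try exact: dhomogM.
  exact: mulf_neq0.
exact: mulf_div.
Qed.

Lemma rational_functionQ_1 : rational_functionQ 1.
Proof. by exists 0%N, 1, 1; rewrite rmorph1 /= dhomog1 rmorph1 oner_eq0 divr1. Qed.

Lemma rational_functionQ_exp f i : rational_functionQ f -> rational_functionQ (f ^+ i).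
Proof.
move=> Qf; elim: i => [|i IH]; first by rewrite expr0; apply: rational_functionQ_1.
by rewrite exprS; apply: rational_functionQ_mul.
Qed.

Lemma rational_functionQ_subfield : is_subfield [set f | rational_functionQ f].
Proof.
apply/is_subfieldP; split; first exact: rational_functionQ_1.
- move=> _ _ [d [F [G [hF hG G0 ->]]]] [e [F' [G' [hF' hG' G'0 ->]]]].
  exists (d + e)%N, (F * G' - F' * G), (G * G').
  split.
  + rewrite rmorphB !rmorphM /=.
    by apply: dhomogD; [exact: dhomogM | rewrite dhomogN addnC; exact: dhomogM].
  + by rewrite rmorphM; exact: dhomogM.
  + by rewrite !rmorphM mulf_neq0.
  + by rewrite -mulNr addf_div // rmorphB !rmorphM rmorphB !rmorphM mulNr.
- move=> _ _ [d [F [G [hF hG G0 ->]]]] [e [F' [G' [hF' hG' G'0 ->]]]].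
  have [F'0|F'0] := eqVneq (ev (to_algC F')) 0.
    rewrite F'0 mul0r invr0 mulr0; exists 0%N, 0, 1.
    by rewrite rmorph0 rmorph1 /= dhomog0 dhomog1 rmorph0 rmorph1 oner_eq0 mul0r.
  exists (d + e)%N, (F * G'), (G * F').
  rewrite !rmorphM /= invf_div mulf_div; split=> //; try exact: dhomogM.
  exact: mulf_neq0.
Qed.

(** After multiplication by a common denominator the relation says that a
    combination of polynomials over Q lies in the kernel of ev, which is stable
    under conjugation. *)
Lemma linear_relation_conj (I : finType) (u : I -> M) (c : I -> algC)
    (nu : {rmorphism algC -> algC}) : (forall i, rational_functionQ (u i)) ->
  \sum_i cst (c i) * u i = 0 -> \sum_i cst (nu (c i)) * u i = 0.
Proof.
move=> Qu.
have H i : exists AB : {mpoly rat[n]} * {mpoly rat[n]},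
    ev (to_algC AB.2) != 0 /\ u i = ev (to_algC AB.1) / ev (to_algC AB.2).
  by have [d [F [G [_ _ G0 Du]]]] := Qu i; exists (F, G).
pose A i := (sval (cid (H i))).1; pose B i := (sval (cid (H i))).2.
have B0 i : ev (to_algC (B i)) != 0 by have [] := svalP (cid (H i)).
have Du i : u i = ev (to_algC (A i)) / ev (to_algC (B i)) by have [] := svalP (cid (H i)).
pose D := \prod_i ev (to_algC (B i)).
have D0 : D != 0 by apply/prodf_neq0 => i _.
pose N i := A i * \prod_(l | l != i) B l.
have DN i : D * u i = ev (to_algC (N i)).
  rewrite Du /D (bigD1 i) //= rmorphM rmorphM rmorph_prod rmorph_prod /=.
  by rewrite mulrC -mulrA mulKf.
have rel (c' : I -> algC) : D * (\sum_i cst (c' i) * u i) =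
    ev (\sum_i (c' i)%:MP * to_algC (N i)).
  rewrite rmorph_sum mulr_sumr; apply: eq_bigr => i _.
  by rewrite mulrCA DN (rmorphM ev).
move=> c0; apply: (mulfI D0); rewrite mulr0 rel.
have /(ev_conj nu) : ev (\sum_i (c i)%:MP * to_algC (N i)) = 0 by rewrite -rel c0 mulr0.
rewrite (rmorph_sum (map_mpoly nu)) => <-; congr (ev _); apply: eq_bigr => i _.
by rewrite rmorphM /= map_mpolyC map_mpoly_ratr.
Qed.

(** A nontrivial relation with the least number of nonzero coefficients,
    normalised so that one of them is 1, coincides with its conjugates: the
    difference would be a shorter relation. So its coefficients are rational. *)
Theorem linear_relation_descent (I : finType) (u : I -> M) (c : I -> algC) :
  (forall i, rational_functionQ (u i)) ->
  \sum_i cst (c i) * u i = 0 -> (exists i, c i != 0) ->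
  exists c' : I -> rat, \sum_i cstQ (c' i) * u i = 0 /\ exists i, c' i != 0.
Proof.
move=> Qu c_rel c_n0.
pose R (c : I -> algC) := \sum_i cst (c i) * u i = 0 /\ exists i, c i != 0.
have ex : exists s, `[< exists c, R c /\ #|[pred i | c i != 0]| = s >].
  by exists #|[pred i | c i != 0]|; apply/asboolP; exists c.
case: (ex_minnP ex) => s /asboolP[{c_rel c_n0}b [[b_rel [i0 bi0]] sz_b]] min_s.
pose a i := b i / b i0.
have a_rel : \sum_i cst (a i) * u i = 0.
  apply: (mulfI (x := cst (b i0))); first by rewrite fmorph_eq0.
  rewrite mulr0 -[RHS]b_rel mulr_sumr; apply: eq_bigr => i _.
  by rewrite mulrA -rmorphM; congr (cst _ * _); rewrite /a mulrC divfK.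
have a_rat i : a i \in Crat.
  apply: fixed_by_aut_rat => nu; apply/eqP; rewrite -subr_eq0.
  apply: contrapT => /negP ne.
  pose h l := nu (a l) - a l.
  have h_rel : R h.
    split; last by exists i.
    have := linear_relation_conj nu Qu a_rel => rel'.
    transitivity (\sum_l cst (nu (a l)) * u l - \sum_l cst (a l) * u l).
      by rewrite -sumrB; apply: eq_bigr => l _; rewrite rmorphB mulrBl.
    by rewrite rel' a_rel subrr.
  have : (s <= #|[pred l | h l != 0%R]|)%N.
    by apply: min_s; apply/asboolP; exists h.
  rewrite leqNgt -sz_b => /negP[]; apply: proper_card; apply/properP; split.
    apply/fintype.subsetP => l; rewrite !inE; apply: contraNneq => bl0.
    by rewrite /h /a bl0 mul0r rmorph0 subrr.
  by exists i0; rewrite !inE // /h /a divff // rmorph1 subrr eqxx.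
exists (fun i => getCrat (a i)); split.
  by rewrite -[RHS]a_rel; apply: eq_bigr => i _; rewrite /= getCratK.
exists i0; have : a i0 != 0 by rewrite /a divff // oner_eq0.
by apply: contraNneq => g0; rewrite -(getCratK (a_rat i0)) g0 rmorph0.
Qed.

Lemma horner_cstQ (p : {poly rat}) (t : M) (N : nat) : (size p <= N)%N ->
  (map_poly cstQ p).[t] = \sum_(i < N) cstQ p`_i * t ^+ i.
Proof.
move=> sz; rewrite (horner_coef_wide _ (n := N)) ?size_map_poly //.
by apply: eq_bigr => i _; rewrite coef_map.
Qed.

Variable t : M.
Hypothesis Qt : rational_functionQ t.
Hypothesis t_tr : forall p : {poly algC}, (map_poly cst p).[t] = 0 -> p = 0.

Lemma t_trQ (p : {poly rat}) : (map_poly cstQ p).[t] = 0 -> p = 0.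
Proof.
move=> p0; have /t_tr/eqP : (map_poly cst (map_poly ratr p)).[t] = 0.
  by rewrite -map_poly_comp.
by rewrite map_poly_eq0 => /eqP.
Qed.

(** This is [linear_relation_descent] for the functions f t^i and t^i. *)
Lemma rational_in_t_descent f (A B : {poly algC}) : rational_functionQ f -> B != 0 ->
  f * (map_poly cst B).[t] = (map_poly cst A).[t] ->
  exists A' B' : {poly rat}, B' != 0 /\ f * (map_poly cstQ B').[t] = (map_poly cstQ A').[t].
Proof.
move=> Qf B0 rel; pose N := maxn (size A) (size B).
pose u (x : 'I_N + 'I_N) := match x with inl i => f * t ^+ i | inr i => t ^+ i end.
pose c (x : 'I_N + 'I_N) := match x with inl i => B`_i | inr i => - A`_i end.
have Qu x : rational_functionQ (u x).
  case: x => i; last exact: rational_functionQ_exp.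
  exact/rational_functionQ_mul/rational_functionQ_exp.
have c_rel : \sum_x cst (c x) * u x = 0.
  rewrite big_sumType /=; apply/eqP; rewrite addr_eq0; apply/eqP.
  have hor (p : {poly algC}) : (size p <= N)%N ->
      (map_poly cst p).[t] = \sum_(i < N) cst p`_i * t ^+ i.
    move=> sz; rewrite (horner_coef_wide _ (n := N)) ?size_map_poly //.
    by apply: eq_bigr => i _; rewrite coef_map.
  transitivity (f * (map_poly cst B).[t]).
    rewrite hor ?leq_maxr // mulr_sumr; apply: eq_bigr => i _; exact: mulrCA.
  rewrite rel hor ?leq_maxl // -sumrN; apply: eq_bigr => i _.
  by rewrite -[X in - (X * _)]/(cst (- A`_i)) (rmorphN cst) mulNr opprK.
have [|c' [c'_rel c'_n0]] := linear_relation_descent Qu c_rel.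
  have sB : ((size B).-1 < N)%N.
    by rewrite prednK ?size_poly_gt0 // leq_maxr.
  by exists (inl (Ordinal sB)); rewrite /= -lead_coefE lead_coef_eq0.
pose B' := \poly_(i < N) (if insub i is Some i' then c' (inl i') else 0).
pose A' := \poly_(i < N) (if insub i is Some i' then - c' (inr i') else 0).
have B'E (i : 'I_N) : B'`_i = c' (inl i).
  by rewrite coef_poly ltn_ord; case: insubP => [j _ /val_inj->|]; rewrite ?ltn_ord.
have A'E (i : 'I_N) : A'`_i = - c' (inr i).
  by rewrite coef_poly ltn_ord; case: insubP => [j _ /val_inj->|]; rewrite ?ltn_ord.
have rel' : f * (map_poly cstQ B').[t] = (map_poly cstQ A').[t].
  rewrite !(@horner_cstQ _ _ N) ?size_poly //.
  move/eqP: c'_rel; rewrite big_sumType /= addr_eq0 => /eqP c'_rel.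
  rewrite mulr_sumr; transitivity (\sum_(i < N) cstQ (c' (inl i)) * (f * t ^+ i)).
    by apply: eq_bigr => i _; rewrite -B'E; apply: mulrCA.
  rewrite [LHS]c'_rel -sumrN; apply: eq_bigr => i _; rewrite -mulNr; congr (_ * _).
  by rewrite -(rmorphN cstQ) -A'E.
exists A', B'; split=> //; apply/eqP => B'0.
move: rel'; rewrite B'0 rmorph0 horner0 mulr0 => /esym/t_trQ A'0.
case: c'_n0 => -[i|i] /eqP[]; first by rewrite -B'E B'0 coef0.
by apply/eqP; rewrite -oppr_eq0 -A'E A'0 coef0.
Qed.

(** This is [linear_relation_descent] for the functions t^l f^i. *)
Lemma algebraic_relation_descent f : rational_functionQ f -> algebraic_relation cst t f ->
  exists2 p : {poly {poly rat}}, p != 0 &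
    \sum_(i < size p) (map_poly cstQ p`_i).[t] * f ^+ i = 0.
Proof.
move=> Qf [p p0 rel]; pose N := \max_(i < size p) size (p`_i)%R.
pose S := size p.
pose u (x : 'I_S * 'I_N) := t ^+ x.2 * f ^+ x.1.
pose c (x : 'I_S * 'I_N) := p`_x.1`_x.2.
have Qu x : rational_functionQ (u x).
  by apply: rational_functionQ_mul; apply: rational_functionQ_exp.
have szN (i : 'I_S) : (size (p`_i)%R <= N)%N by rewrite (leq_bigmax i).
have c_rel : \sum_x cst (c x) * u x = 0.
  rewrite -[RHS]rel -(pair_bigA _ (fun i l => cst (c (i, l)) * u (i, l))) /=.
  apply: eq_bigr => i _; rewrite (horner_coef_wide _ (n := N)); last first.
    by rewrite size_map_poly.
  by rewrite mulr_suml; apply: eq_bigr => l _; rewrite coef_map mulrA.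
have [|c' [c'_rel [[i0 l0] c'_n0]]] := linear_relation_descent Qu c_rel.
  have S_gt0 : (0 < S)%N by rewrite size_poly_gt0.
  have sS : (S.-1 < S)%N by rewrite prednK.
  have lc : p`_S.-1 != 0 by rewrite -lead_coefE lead_coef_eq0.
  have sN : ((size (p`_S.-1)%R).-1 < N)%N.
    by rewrite prednK ?size_poly_gt0 // (szN (Ordinal sS)).
  by exists (Ordinal sS, Ordinal sN); rewrite /c /= -lead_coefE lead_coef_eq0.
pose co' i l := if insub i is Some i' then (if insub l is Some l' then c' (i', l') else 0) else 0.
pose p' : {poly {poly rat}} := \poly_(i < S) \poly_(l < N) co' i l.
have p'E (i : 'I_S) (l : 'I_N) : p'`_i`_l = c' (i, l).
  rewrite coef_poly ltn_ord coef_poly ltn_ord /co'.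
  case: insubP => [i' _ /val_inj->|]; last by rewrite ltn_ord.
  by case: insubP => [l' _ /val_inj->|]; last by rewrite ltn_ord.
have p'0 : p' != 0.
  by apply: contraNneq c'_n0 => p'0; rewrite -p'E p'0 !coef0.
exists p' => //; rewrite -[RHS]c'_rel.
transitivity (\sum_(i < S) (map_poly cstQ p'`_i).[t] * f ^+ i).
  rewrite (big_ord_widen S (fun i => (map_poly cstQ p'`_i).[t] * f ^+ i)) ?size_poly //.
  rewrite big_mkcond; apply: eq_bigr => i _; case: ltnP => // /leq_sizeP/(_ i (leqnn _)) ->.
  by rewrite rmorph0 horner0 mul0r.
transitivity (\sum_(i < S) \sum_(l < N) cstQ (c' (i, l)) * u (i, l)); last first.
  by rewrite pair_bigA; apply: eq_bigr => -[].
apply: eq_bigr => i _; rewrite (@horner_cstQ _ _ N); last first.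
  by rewrite coef_poly ltn_ord size_poly.
by rewrite mulr_suml; apply: eq_bigr => l _; rewrite p'E mulrA.
Qed.

End Descent.

(** * Degrees of the points *)

Lemma eventually_nonroot (q : {poly algC}) : q != 0 ->
  exists B, forall n, (B <= n)%N -> q.[n%:R] != 0.
Proof.
move=> q0; have [r Dr] := closed_field_poly_normal q.
have [B HB] : exists B, forall n, (B <= n)%N -> n%:R \notin r.
  elim: r {Dr} => [|x r [B HB]]; first by exists 0%N.
  have [[m Dm]|none] := pselect (exists m, x = m%:R :> algC).
    exists (maxn m.+1 B) => n; rewrite geq_max => /andP[lt_mn /HB nr].
    by rewrite inE negb_or nr Dm eqr_nat gtn_eqF.
  exists B => n /HB nr; rewrite inE negb_or nr andbT.
  by apply/eqP => Dx; apply: none; exists n.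
exists B => n /HB nr; rewrite Dr hornerZ mulf_neq0 ?lead_coef_eq0 //.
by move: nr; rewrite -root_prod_XsubC.
Qed.

Lemma degree_le_mono D D' x : (D <= D')%N -> degree_le D x -> degree_le D' x.
Proof. by move=> le [q [q0 sz qx]]; exists q; split=> //; apply: leq_trans sz _. Qed.

Lemma degree_le_exists x : exists D, degree_le D x.
Proof.
have [q [Dq mon_q] _] := minCpolyP x; exists (size q), q.
by rewrite monic_neq0 // leqnSn -Dq root_minCpoly.
Qed.

Lemma bounded_max (I : eqType) (s : seq I) (Q : I -> nat -> Prop) :
  (forall i D D', (D <= D')%N -> Q i D -> Q i D') ->
  (forall i, i \in s -> exists D, Q i D) -> exists D, forall i, i \in s -> Q i D.
Proof.
move=> mono; elim: s => [|i s IH] Hs; first by exists 0%N.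
have [D HD] : exists D, forall i, i \in s -> Q i D.
  by apply: IH => l sl; apply: Hs; rewrite inE sl orbT.
have [D' HD'] := Hs i (mem_head _ _).
exists (maxn D D') => l; rewrite inE => /orP[/eqP->|/HD].
  by apply: mono HD'; rewrite leq_maxr.
by apply: mono; rewrite leq_maxl.
Qed.

Section PointsDegree.
Variables (n : nat) (M : fieldType) (ev : {rmorphism {mpoly algC[n]} -> M}).
Variables (T : Type) (co : T -> 'I_n -> algC).
Hypothesis evP : forall F, ev F = 0 <-> forall P, F.@[co P] = 0.
Local Notation cst := (ev \o @mpolyC n algC : {rmorphism algC -> M}).
Local Notation cstQ := (cst \o (ratr : rat -> algC) : {rmorphism rat -> M}).
Local Notation value_at := (value_at ev co).
Hypothesis ev_conj : forall (nu : {rmorphism algC -> algC}) F,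
  ev F = 0 -> ev (map_mpoly nu F) = 0.
Hypothesis alg_rel : forall f g, rational_function ev f -> rational_function ev g ->
  algebraic_relation cst f g.
Variable t : M.
Hypothesis rt : rational_function ev t.
Hypothesis Qt : rational_functionQ ev t.
Variable P : nat -> T.
Hypothesis tP : forall m, value_at t (P m) m%:R.

(** The function x_i / x_j satisfies an algebraic relation over Q(t). At t = m it
    becomes an equation over Q for the value of x_i / x_j at P m, nontrivial
    unless m is one of the finitely many zeros of its leading coefficient. *)
Lemma coordinate_degree i j : exists D, forall m, co (P m) j != 0 ->
  degree_le D (co (P m) i / co (P m) j).
Proof.
have [[m0 Pm0]|none] := pselect (exists m, co (P m) j != 0); last first.
  by exists 0%N => m Pm; case: none; exists m.
have xj0 : ev 'X_j != 0 by apply: (ev_neq0 evP (P := P m0)); rewrite mevalXU.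
pose f := ev 'X_i / ev 'X_j.
have rf : rational_function ev f by exact: (value_at_fun evP (value_at_coord ev i Pm0)).
have Qf : rational_functionQ ev f.
  exists 1%N, 'X_i, 'X_j.
  by rewrite !map_mpolyX !dhomogX /= !mdeg1.
have [p p0 rel] := algebraic_relation_descent ev_conj Qt Qf (alg_rel rt rf).
have lead_p0 : map_poly ratr (lead_coef p) != 0 :> {poly algC}.
  by rewrite map_poly_eq0 lead_coef_eq0.
have [B HB] := eventually_nonroot lead_p0.
have large m : (B <= m)%N -> co (P m) j != 0 -> degree_le (size p) (co (P m) i / co (P m) j).
  move=> /HB lead_m Pm; set x := _ / _.
  pose q : {poly rat} := \poly_(l < size p) (p`_l).[m%:R].
  have ratr_horner (r : {poly rat}) : ratr r.[m%:R] = (map_poly ratr r).[m%:R] :> algC.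
    by rewrite -horner_map /= rmorph_nat.
  exists q; split.
  - apply: contraNneq lead_m => q0; rewrite -ratr_horner fmorph_eq0.
    rewrite lead_coefE; have := congr1 (fun r : {poly rat} => r`_(size p).-1) q0.
    by rewrite /= coef_poly coef0 prednK ?size_poly_gt0 // leqnn => ->.
  - by rewrite (leq_trans (size_poly _ _)).
  have fx : value_at f (P m) x := value_at_coord ev i Pm.
  have v0 : value_at 0 (P m) 0 by rewrite -(rmorph0 cst); apply: value_at_cst.
  apply/rootP; apply: (value_at_uniq evP _ v0); rewrite -rel.
  rewrite (horner_coef_wide _ (n := size p)); last first.
    by rewrite size_map_poly size_poly.
  apply: value_at_sum => // l; apply: value_at_mul; last exact: value_at_exp.
  rewrite coef_map coef_poly ltn_ord /= ratr_horner map_poly_comp.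
  by apply: value_at_horner => //; apply: tP.
pose Q m D := co (P m) j != 0 -> degree_le D (co (P m) i / co (P m) j).
have mono m D D' : (D <= D')%N -> Q m D -> Q m D'.
  by move=> le Qm Pm; apply: degree_le_mono le (Qm Pm).
have exQ m : m \in iota 0 B -> exists D, Q m D.
  by move=> _; have [D HD] := degree_le_exists (co (P m) i / co (P m) j); exists D.
have [D HD] := bounded_max mono exQ.
exists (maxn D (size p)) => m Pm; have [le_B|lt_B] := leqP B m.
  by apply: degree_le_mono (large m le_B Pm); rewrite leq_maxr.
apply: degree_le_mono (leq_maxl _ _) (HD m _ Pm).
by rewrite mem_iota.
Qed.

Theorem points_degree : exists D, forall m i j, co (P m) j != 0 ->
  degree_le D (co (P m) i / co (P m) j).
Proof.
pose Q (x : 'I_n * 'I_n) D := forall m, co (P m) x.2 != 0 ->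
  degree_le D (co (P m) x.1 / co (P m) x.2).
have mono x D D' : (D <= D')%N -> Q x D -> Q x D'.
  by move=> le Qx m Pm; apply: degree_le_mono le (Qx m Pm).
have exQ x : x \in enum {: 'I_n * 'I_n} -> exists D, Q x D.
  by case: x => i j _; apply: coordinate_degree.
have [D HD] := bounded_max mono exQ.
by exists D => m i j; apply: (HD (i, j)); rewrite mem_enum.
Qed.

End PointsDegree.

(** * Abelian extensions as sums of radicals *)

Section KummerDecomposition.
Variables (F : fieldType) (E : splittingFieldType F).
Local Notation G := ('Gal({:E} / 1)%g).
Local Notation e := #|G|.
Hypothesis galE : galois 1 {:E}.
Hypothesis abelG : abelian G.
Variable zeta : E.
Hypothesis prim_z : e.-primitive_root zeta.
Hypothesis zeta1 : zeta \in 1%VS.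

Lemma gal_zeta (s : gal_of {:E}) i : s \in G -> s (zeta ^+ i) = zeta ^+ i.
Proof. by move=> Gs; apply: fixed_gal Gs _; rewrite ?subvf // rpredX. Qed.

Lemma gal_exp (s : gal_of {:E}) i x : (s ^+ i)%g x = iter i s x.
Proof.
elim: i x => [|i IH] x; first by rewrite expg0 gal_id.
by rewrite expgSr galM ?memvf // IH.
Qed.

Definition eigen (s : gal_of {:E}) (y : E) : Prop := exists i, s y = zeta ^+ i * y.

(** The Lagrange resolvents e^-1 * sum_i zeta^(- i j) s^i(x) add up to x, and the
    j-th one is an eigenvector of s for zeta^j. As G is abelian, they remain
    eigenvectors of the elements of l. *)
Lemma resolvent (s : gal_of {:E}) (l : seq (gal_of {:E})) (x : E) :
  s \in G -> {subset l <= G} -> (forall g, g \in l -> eigen g x) ->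
  exists ys : seq E, x = \sum_(y <- ys) y /\
    forall y, y \in ys -> forall g, g \in s :: l -> eigen g y.
Proof.
move=> Gs Gl eig_x; have e_gt0 : (0 < e)%N := cardG_gt0 _.
have z0 : zeta != 0 by rewrite (prim_root_eq0 prim_z) -lt0n.
have ze : zeta ^+ e = 1 := prim_expr_order prim_z.
have e0 : e%:R != 0 :> E := prim_root_natf_neq0 prim_z.
pose w := zeta ^+ e.-1.
have wz : w * zeta = 1 by rewrite -exprSr prednK.
have we : w ^+ e = 1 by rewrite -exprM mulnC exprM ze expr1n.
pose y j := e%:R^-1 * \sum_(i < e) w ^+ (i * j) * iter i s x.
have fixe (g : gal_of {:E}) : g \in G -> g e%:R^-1 = e%:R^-1.
  by move=> _; rewrite fmorphV rmorph_nat.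
have fixw (g : gal_of {:E}) i : g \in G -> g (w ^+ i) = w ^+ i.
  by move=> Gg; rewrite -exprM gal_zeta.
have se : iter e s x = x by rewrite -gal_exp (expg_cardG Gs) gal_id.
exists [seq y j | j <- iota 0 e]; split.
  rewrite big_map (_ : iota 0 e = index_iota 0 e); last by rewrite /index_iota subn0.
  rewrite big_mkord -mulr_sumr exchange_big /=.
  rewrite (eq_bigr (fun i : 'I_e => (\sum_(j < e) (w ^+ i) ^+ j) * iter i s x)); last first.
    by move=> i _; rewrite mulr_suml; apply: eq_bigr => j _; rewrite exprM.
  rewrite (bigD1 (Ordinal e_gt0)) //= [X in _ + X]big1 ?addr0 => [|i ne_i0].
    rewrite [X in _ * (X * _)](_ : _ = e%:R) ?mulKf //.
    rewrite (eq_bigr (fun=> 1)) ?sumr_const ?card_ord // => j _.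
    by rewrite (_ : w ^+ _ = 1) ?expr1n.
  have wi : w ^+ i != 1.
    apply: contra ne_i0 => /eqP wi1; have : zeta ^+ i = 1.
      have : w ^+ i * zeta ^+ i = 1 by rewrite -exprMn wz expr1n.
      by rewrite wi1 mul1r.
    move/eqP; rewrite -(prim_order_dvd prim_z) => e_i.
    apply/eqP/val_inj/eqP => /=; apply: contraTT e_i => i0.
    by rewrite gtnNdvd // lt0n.
  suff -> : \sum_(j < e) (w ^+ i) ^+ j = 0 by rewrite mul0r.
  apply: (mulfI (x := w ^+ i - 1)); first by rewrite subr_eq0.
  by rewrite mulr0 -subrX1 -exprM mulnC exprM we expr1n subrr.
move=> _ /mapP[j _ ->] g; rewrite inE => /orP[/eqP->|lg].
  exists j; rewrite rmorphM /= fixe // mulrCA; congr (_ * _).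
  rewrite rmorph_sum mulr_sumr.
  pose u i := zeta ^+ j * (w ^+ (i * j) * iter i s x).
  transitivity (\sum_(i < e) u i.+1).
    apply: eq_bigr => i _; rewrite rmorphM /= fixw // /u mulSn exprD !mulrA.
    by rewrite -exprMn (mulrC zeta) wz expr1n mul1r.
  apply: (addrI (u 0%N)); rewrite -(big_ord_recl _ (fun i => u i)) big_ord_recr /= addrC.
  by congr (_ + _); rewrite /u se mul0n exprM we expr1n.
have Gg := Gl g lg; have [i0 Di0] := eig_x g lg; exists i0.
rewrite rmorphM /= fixe // mulrCA; congr (_ * _); rewrite rmorph_sum mulr_sumr.
apply: eq_bigr => i _; rewrite rmorphM /= fixw // mulrCA; congr (_ * _).
rewrite -!gal_exp -galM ?memvf //; have -> : (s ^+ i * g = g * s ^+ i)%g.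
  by apply: (centsP abelG); rewrite ?groupX.
by rewrite galM ?memvf // Di0 rmorphM /= gal_zeta ?groupX.
Qed.

Lemma eigen_decomposition (l : seq (gal_of {:E})) (x : E) : {subset l <= G} ->
  exists ys : seq E, x = \sum_(y <- ys) y /\
    forall y, y \in ys -> forall g, g \in l -> eigen g y.
Proof.
elim: l x => [|s l IH] x Gl; first by exists [:: x]; rewrite big_seq1.
have Gs : s \in G by apply: Gl; rewrite mem_head.
have Gl' : {subset l <= G} by move=> g lg; apply: Gl; rewrite inE lg orbT.
have [ys [-> eig_ys]] := IH x Gl'.
elim: ys eig_ys => [|y ys IHys] eig_ys; first by exists [::].
have [zs [Dz eig_zs]] : exists ys' : seq E, \sum_(y <- ys) y = \sum_(y <- ys') y /\
    forall y, y \in ys' -> forall g, g \in s :: l -> eigen g y.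
  by apply: IHys => z yz; apply: eig_ys; rewrite inE yz orbT.
have [us [Dy eig_us]] := resolvent Gs Gl' (eig_ys y (mem_head _ _)).
exists (us ++ zs); rewrite big_cons big_cat /= -Dy -Dz; split=> // z.
by rewrite mem_cat => /orP[/eig_us|/eig_zs].
Qed.

(** The e-th power of a common eigenvector is fixed by the Galois group. *)
Theorem kummer_decomposition (x : E) : exists ys : seq E,
  x = \sum_(y <- ys) y /\ forall y, y \in ys -> y ^+ e \in 1%VS.
Proof.
have enumG : {subset enum G <= G} by move=> g; rewrite mem_enum.
have [ys [Dx eig]] := eigen_decomposition x enumG.
exists ys; split=> // y ysy.
suff : y ^+ e \in fixedField G by rewrite (galois_fixedField galE).
apply/fixedFieldP => [|g Gg]; first exact: memvf.
have [|i Dg] := eig y ysy g; first by rewrite mem_enum.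
by rewrite rmorphXn /= Dg exprMn exprAC (prim_expr_order prim_z) expr1n mul1r.
Qed.

End KummerDecomposition.

Section Normalise.
Variables (M : fieldType) (cst : {rmorphism algC -> M}) (t : M).
Local Notation "p .[t]" := (map_poly cst p).[t] (at level 2, left associativity, format "p .[t]").

Definition rational_in_t (f : M) : Prop :=
  exists p q : {poly algC}, q.[t] != 0 /\ f = p.[t] / q.[t].

Lemma rational_in_t_subfield : is_subfield [set f | rational_in_t f].
Proof.
apply/is_subfieldP; split=> [|_ _ [p [q [q0 ->]]] [p' [q' [q'0 ->]]]|
                              _ _ [p [q [q0 ->]]] [p' [q' [q'0 ->]]]].
- by exists 1, 1; rewrite rmorph1 hornerC oner_eq0 divr1.
- exists (p * q' - p' * q), (q * q'); rewrite rmorphB !rmorphM /= hornerD hornerN !hornerM.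
  by rewrite mulf_neq0 // -mulNr addf_div // mulNr.
- have [p'0|p'0] := eqVneq p'.[t] 0.
    by exists 0, 1; rewrite rmorph1 rmorph0 hornerC oner_eq0 p'0 horner0 !mul0r invr0 mulr0.
  exists (p * q'), (q * p'); rewrite !rmorphM /= !hornerM.
  by rewrite mulf_neq0 // invf_div mulf_div.
Qed.

Lemma rational_in_t_poly (p : {poly algC}) : rational_in_t p.[t].
Proof. by exists p, 1; rewrite rmorph1 hornerC oner_eq0 divr1. Qed.

Lemma gen_subfield_rational_in_t f :
  gen_subfield (t |` range cst) f -> rational_in_t f.
Proof.
move: f; apply: smallest_sub; first exact: rational_in_t_subfield.
move=> _ [->|[c _ <-]].
  by have := rational_in_t_poly 'X; rewrite map_polyX hornerX.
by have := rational_in_t_poly c%:P; rewrite map_polyC hornerC.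
Qed.

(** Multiplication by a denominator turns y^e into a polynomial in t. Each linear
    factor of it occurs with a multiplicity k a, and h absorbs its power with
    exponent k a / e, as well as the leading coefficient. *)
Lemma radical_normal_form (e : nat) (y : M) : (0 < e)%N -> y != 0 ->
  rational_in_t (y ^+ e) ->
  exists (h : M) (S : seq algC) (m : algC -> nat),
    [/\ rational_in_t h, h != 0, uniq S, forall a, a \in S -> ~~ (e %| m a)%N &
        (y / h) ^+ e = (\prod_(a <- S) ('X - a%:P) ^+ m a).[t]].
Proof.
move=> e_gt0 y0 [A [B [Bt0 Dye]]].
have At0 : A.[t] != 0.
  by apply: contraNneq (expf_neq0 e y0) => At; rewrite Dye At mul0r.
pose C := A * B ^+ e.-1.
have DC : (y * B.[t]) ^+ e = C.[t].
  rewrite exprMn Dye rmorphM rmorphXn /= hornerM horner_exp -{1}(prednK e_gt0) exprS.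
  by rewrite mulrA divfK.
have [rs Drs] := closed_field_poly_normal C.
pose k a := count_mem a rs.
pose H := (e.-root (lead_coef C))%:P * \prod_(a <- undup rs) ('X - a%:P) ^+ (k a %/ e).
pose S := [seq a <- undup rs | ~~ (e %| k a)%N].
pose R := \prod_(a <- S) ('X - a%:P) ^+ (k a %% e).
have DCHR : C = H ^+ e * R.
  have -> : R = \prod_(a <- undup rs) ('X - a%:P) ^+ (k a %% e).
    rewrite /R /S big_filter big_mkcond; apply: eq_bigr => a _.
    by rewrite /dvdn; case: eqP => //= ->.
  rewrite {1}Drs /H exprMn -rmorphXn /= rootCK // -mulrA -mul_polyC; congr (_ * _).
  rewrite -prodrXl -big_split /= -(prodr_undup_exp_count _ xpredT); apply: eq_bigr => a _.
  by rewrite -exprM -exprD -divn_eq.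
have Ct0 : C.[t] != 0.
  by rewrite -DC expf_neq0 // mulf_neq0.
have Ht0 : H.[t] != 0.
  apply: contraNneq Ct0 => Ht; rewrite DCHR rmorphM rmorphXn /= hornerM horner_exp Ht.
  by rewrite expr0n gtn_eqF // mul0r.
exists (H.[t] / B.[t]), S, (fun a => k a %% e)%N; split.
- by exists H, B.
- by rewrite mulf_neq0 ?invr_eq0.
- by rewrite filter_uniq ?undup_uniq.
- by move=> a; rewrite mem_filter => /andP[ek _]; rewrite /dvdn modn_mod.
rewrite invf_div mulrA expr_div_n DC DCHR rmorphM rmorphXn /= hornerM horner_exp.
by rewrite mulrC mulKf // expf_neq0.
Qed.
End Normalise.

(** * Specialisation at the points of the fibres *)

Definition radical_poly (S : seq rat) (m : rat -> nat) : {poly rat} :=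
  \prod_(a <- S) ('X - a%:P) ^+ m a.

Lemma eventually_and (Q R : nat -> Prop) :
  (exists B, forall m, (B <= m)%N -> Q m) -> (exists B, forall m, (B <= m)%N -> R m) ->
  exists B, forall m, (B <= m)%N -> Q m /\ R m.
Proof.
move=> [B HB] [B' HB']; exists (maxn B B') => m; rewrite geq_max => /andP[le le'].
by split; [apply: HB | apply: HB'].
Qed.

Lemma eventually_all (I : eqType) (s : seq I) (Q : I -> nat -> Prop) :
  (forall i, i \in s -> exists B, forall m, (B <= m)%N -> Q i m) ->
  exists B, forall m, (B <= m)%N -> forall i, i \in s -> Q i m.
Proof.
elim: s => [|i s IH] Hs; first by exists 0%N.
have Hi := Hs i (mem_head _ _).
have [|B HB] := eventually_and Hi (IH _).
  by move=> l sl; apply: Hs; rewrite inE sl orbT.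
by exists B => m /HB[Qi Qs] l; rewrite inE => /orP[/eqP->|/Qs].
Qed.

Lemma fixes_poly (s : seq algC) (nu : {rmorphism algC -> algC}) (p : {poly algC}) (x : algC) :
  fixes s nu -> {subset (p : seq algC) <= s} -> nu x = x -> nu p.[x] = p.[x].
Proof.
move=> fix_s ps nux; rewrite !horner_coef rmorph_sum /=; apply: eq_bigr => i _.
rewrite rmorphM rmorphXn /= nux; congr (_ * _).
by apply: fix_s; apply: ps; apply: mem_nth.
Qed.

Lemma fixes_mpoly (n : nat) (s : seq algC) (nu : {rmorphism algC -> algC})
    (F : {mpoly algC[n]}) (v : 'I_n -> algC) :
  fixes s nu -> {subset [seq F@_m | m <- msupp F] <= s} -> (forall i, nu (v i) = v i) ->
  nu F.@[v] = F.@[v].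
Proof.
move=> fix_s Fs nuv; rewrite !mevalE rmorph_sum big_seq [RHS]big_seq /=.
apply: eq_bigr => m mF; rewrite rmorphM rmorph_prod /= fix_s; last first.
  by apply: Fs; apply: map_f.
by congr (_ * _); apply: eq_bigr => i _; rewrite rmorphXn /= nuv.
Qed.

Section Specialise.
Variables (n : nat) (M : fieldType) (ev : {rmorphism {mpoly algC[n]} -> M}).
Variables (T : Type) (co : T -> 'I_n -> algC).
Hypothesis evP : forall F, ev F = 0 <-> forall P, F.@[co P] = 0.
Hypothesis co_neq0 : forall P, exists i, co P i != 0.
Local Notation cst := (ev \o @mpolyC n algC : {rmorphism algC -> M}).
Local Notation value_at := (value_at ev co).
Hypothesis alg_rel : forall f g, rational_function ev f -> rational_function ev g ->
  algebraic_relation cst f g.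
Variable t : M.
Hypothesis rt : rational_function ev t.
Variable P : nat -> T.
Hypothesis tP : forall m, value_at t (P m) m%:R.

(** In a relation p_0(t) + p_1(t) f + ... = 0 with p_0 != 0, a zero of f at P m
    forces m to be a root of p_0. *)
Lemma eventually_nonzero f : rational_function ev f -> f != 0 ->
  exists B, forall m, (B <= m)%N -> forall a, value_at f (P m) a -> a != 0.
Proof.
move=> rf f0; have [p p0 rel] := algebraic_relation_const (alg_rel rt rf) f0.
have [B HB] := eventually_nonroot p0; exists B => m /HB nz a fa.
apply: contraNneq nz => a0; rewrite a0 in fa.
have v0 : value_at 0 (P m) 0 by rewrite -(rmorph0 cst); apply: value_at_cst.
apply/eqP; apply: (value_at_uniq evP _ v0); rewrite -rel.
have -> : (p`_0).[m%:R] = \sum_(i < size p) (p`_i).[m%:R] * 0 ^+ i.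
  have sz_p : (0 < size p)%N.
    by rewrite size_poly_gt0; apply: contraNneq p0 => ->; rewrite coef0.
  rewrite (bigD1 (Ordinal sz_p)) //= expr0 mulr1 big1 ?addr0 // => i ne_i.
  by rewrite expr0n (negPf (_ : (i : nat) != 0%N)) ?mulr0.
apply: value_at_sum => // i; apply: value_at_mul; last exact: value_at_exp.
exact: value_at_horner.
Qed.

(** The denominator B is compared with a power of each homogeneous coordinate,
    so as to apply [eventually_nonzero]. *)
Lemma eventually_regular f : rational_function ev f -> exists d A B,
  [/\ A \is d.-homog, B \is d.-homog, f = ev A / ev B &
      exists N, forall m, (N <= m)%N -> B.@[co (P m)] != 0].
Proof.
move=> [d [A [B [hA hB B0 Df]]]]; exists d, A, B; split=> //.
have [|N HN] := @eventually_all _ (enum 'I_n) (fun j m => co (P m) j != 0 ->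
   B.@[co (P m)] != 0).
  move=> j _; have [xj0|xj0] := eqVneq (ev 'X_j) 0.
    by exists 0%N => m _; have /evP/(_ (P m)) := xj0; rewrite mevalXU => ->; rewrite eqxx.
  have hX : ('X_j ^+ d : {mpoly algC[n]}) \is d.-homog.
    by have := dhomogMn (d := 1) (p := 'X_j) d; rewrite mul1n; apply; rewrite dhomogX /= mdeg1.
  pose f' := ev B / ev ('X_j ^+ d).
  have X0 : ev ('X_j ^+ d) != 0 by rewrite rmorphXn expf_neq0.
  have rf' : rational_function ev f' by exists d, B, ('X_j ^+ d).
  have [|N HN] := eventually_nonzero rf'; first by rewrite mulf_neq0 ?invr_eq0.
  exists N => m le_m Pj.
  have Xj : ('X_j ^+ d).@[co (P m)] != 0 by rewrite rmorphXn /= mevalXU expf_neq0.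
  have := HN m le_m _ (value_at_frac ev hB hX Xj).
  by rewrite mulf_eq0 negb_or => /andP[].
exists N => m le_m; have [j Pj] := co_neq0 (P m).
by apply: (HN m le_m j); rewrite ?mem_enum.
Qed.

(** The automorphism nu is the identity on the field generated by Q. *)
Definition ratio_fixed (Q : T) (nu : {rmorphism algC -> algC}) : Prop :=
  forall i j, co Q j != 0 -> nu (co Q i / co Q j) = co Q i / co Q j.

(** The value of f at P m is a quotient of polynomials in the ratios of the
    coordinates of P m, with coefficients in s. *)
Lemma specialise f : rational_function ev f -> exists (s : seq algC) (v : nat -> algC) (N : nat),
  forall m, (N <= m)%N -> value_at f (P m) (v m) /\
    forall nu, fixes s nu -> ratio_fixed (P m) nu -> nu (v m) = v m.
Proof.
move=> rf; have [d [A [B [hA hB Df [N HN]]]]] := eventually_regular rf.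
exists ([seq A@_m | m <- msupp A] ++ [seq B@_m | m <- msupp B]).
exists (fun m => A.@[co (P m)] / B.@[co (P m)]), N => m le_m; split.
  by rewrite Df; exact: (value_at_frac ev hA hB (HN m le_m)).
move=> nu fix_s fix_r; have [j Pj] := co_neq0 (P m).
pose c i := co (P m) i / co (P m) j.
have hc d' F : F \is d'.-homog -> F.@[co (P m)] = co (P m) j ^+ d' * F.@[c].
  by move=> hF; apply: meval_homog hF _ => i; rewrite /c mulrC divfK.
have -> : A.@[co (P m)] / B.@[co (P m)] = A.@[c] / B.@[c].
  by rewrite (hc _ _ hA) (hc _ _ hB) -mulf_div divff ?mul1r // expf_neq0.
rewrite fmorph_div /=; congr (_ / _); apply: (fixes_mpoly fix_s) => [x xs|i].
- by rewrite mem_cat xs.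
- exact: fix_r.
- by rewrite mem_cat xs orbT.
- exact: fix_r.
Qed.

Lemma specialise_in_t h : rational_in_t cst t h -> exists (s : seq algC) (v : nat -> algC) (N : nat),
  forall m, (N <= m)%N -> value_at h (P m) (v m) /\
    forall nu, fixes s nu -> nu (v m) = v m.
Proof.
move=> [p [q [q0 Dh]]]; have q_n0 : q != 0.
  by apply: contraNneq q0 => ->; rewrite rmorph0 horner0.
have [N HN] := eventually_nonroot q_n0.
exists ((p : seq algC) ++ q), (fun m => p.[m%:R] / q.[m%:R]), N => m le_m; split.
  rewrite Dh; apply: value_at_mul; first exact: value_at_horner.
  by apply: value_at_inv; [exact: value_at_horner | exact: HN].
move=> nu fix_s; rewrite fmorph_div /=; congr (_ / _);
  by apply: (fixes_poly fix_s); rewrite ?rmorph_nat // => x xs; rewrite mem_cat xs ?orbT.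
Qed.

End Specialise.

(** * Abelian coverings with rational critical values *)

Section AbelianCase.
Variables (n : nat) (M : fieldType) (ev : {rmorphism {mpoly algC[n]} -> M}).
Variables (T : Type) (co : T -> 'I_n -> algC).
Hypothesis evP : forall F, ev F = 0 <-> forall P, F.@[co P] = 0.
Hypothesis T_inh : inhabited T.
Hypothesis co_neq0 : forall P, exists i, co P i != 0.
Hypothesis ev_conj : forall (nu : {rmorphism algC -> algC}) F,
  ev F = 0 -> ev (map_mpoly nu F) = 0.
Local Notation cst := (ev \o @mpolyC n algC : {rmorphism algC -> M}).
Local Notation cstQ := (cst \o (ratr : rat -> algC) : {rmorphism rat -> M}).
Local Notation value_at := (value_at ev co).
Hypothesis alg_rel : forall f g, rational_function ev f -> rational_function ev g ->
  algebraic_relation cst f g.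
Variable t : M.
Hypothesis Qt : rational_functionQ ev t.
Hypothesis t_tr : forall p : {poly algC}, (map_poly cst p).[t] = 0 -> p = 0.
Variable P : nat -> T.
Hypothesis tP : forall m, value_at t (P m) m%:R.

Variable e : nat.
Hypothesis e_gt0 : (0 < e)%N.
Hypothesis kummer : forall f, rational_function ev f -> exists ys : seq M,
  f = \sum_(y <- ys) y /\
  forall y, y \in ys -> rational_function ev y /\ rational_in_t cst t (y ^+ e).
Hypothesis crit_rat : forall (y : M) m (alpha : algC) (q : {poly algC}),
  rational_function ev y -> ~~ (e %| m)%N -> q.[alpha] != 0 ->
  y ^+ e = (map_poly cst (('X - alpha%:P) ^+ m * q)).[t] -> alpha \in Crat.

Variable f0 : M.
Hypothesis Qf0 : rational_functionQ ev f0.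
Hypothesis f0_not_t : forall A B : {poly rat}, B != 0 ->
  f0 * (map_poly cstQ B).[t] <> (map_poly cstQ A).[t].

Lemma rational_functionQW f : rational_functionQ ev f -> rational_function ev f.
Proof. by case=> d [F [G [hF hG G0 Df]]]; exists d, (to_algC F), (to_algC G). Qed.

Lemma rational_function_subfield : is_subfield [set f | rational_function ev f].
Proof.
apply/is_subfieldP; split=> [|f g|f g]; last 2 first.
- exact: rational_function_sub.
- exact: (rational_function_div evP T_inh).
- by rewrite /= -(rmorph1 cst); apply: (rational_function_cst evP T_inh).
Qed.

Lemma rational_in_tW h : rational_in_t cst t h -> rational_function ev h.
Proof.
have sub := rational_function_subfield.
have poly_t (p : {poly algC}) : [set f | rational_function ev f] (map_poly cst p).[t].
  apply: subfield_horner => // [c|]; first exact: (rational_function_cst evP T_inh).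
  exact: rational_functionQW.
by move=> [p [q [_ ->]]]; apply: (subfieldV sub).
Qed.

(** The data (h, z, rs, m) present y as a multiple h(t) z of a radical, where
    z^e is the product of the (t - a)^(m a) for a in rs. *)
Definition radical_term (y : M) (d : M * M * seq rat * (rat -> nat)) : Prop :=
  let: (h, z, rs, m) := d in
  [/\ y = h * z, rational_in_t cst t h, rational_function ev z,
      uniq rs /\ (forall a, a \in rs -> ~~ (e %| m a)%N) &
      z ^+ e = (map_poly cst (map_poly ratr (radical_poly rs m))).[t]].

(** The zeros of the radicand in [radical_normal_form] are rational by
    hypothesis. *)
Lemma radical_term_exists y : rational_function ev y -> rational_in_t cst t (y ^+ e) ->
  exists d, radical_term y d.
Proof.
move=> ry rye; have [y0|y0] := eqVneq y 0.
  exists (0, 1, [::], fun=> 0%N); split=> //.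
  - by rewrite y0 mul0r.
  - by exists 0, 1; rewrite rmorph1 rmorph0 horner0 hornerC oner_eq0 mul0r.
  - by rewrite -(rmorph1 cst); apply: (rational_function_cst evP T_inh).
  - by rewrite /radical_poly big_nil !rmorph1 hornerC expr1n.
have [h [S [m [rh h0 uS Sm Dz]]]] := radical_normal_form e_gt0 y0 rye.
have rz : rational_function ev (y / h).
  exact: (rational_function_div evP T_inh ry (rational_in_tW rh)).
have S_rat a : a \in S -> a \in Crat.
  move=> Sa; apply: (crit_rat (m := m a) (q := \prod_(b <- rem a S) ('X - b%:P) ^+ m b) rz).
  - exact: Sm.
  - rewrite horner_prod prodf_seq_neq0; apply/allP => b; rewrite mem_rem_uniq // inE.
    by case/andP=> nba _; rewrite horner_exp hornerXsubC expf_neq0 // subr_eq0 eq_sym.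
  - by rewrite Dz (big_rem a Sa).
exists (h, y / h, [seq getCrat a | a <- S], fun b => m (ratr b)); split=> //.
- by rewrite mulrC divfK.
- split; first by rewrite map_inj_in_uniq // => a b /S_rat ra /S_rat rb Dab;
    rewrite -(getCratK ra) Dab getCratK.
  by move=> _ /mapP[a Sa ->]; rewrite getCratK ?S_rat // Sm.
- rewrite Dz; congr (map_poly _ _).[t]; rewrite /radical_poly big_map rmorph_prod /=.
  rewrite big_seq [RHS]big_seq; apply: eq_bigr => a Sa.
  by rewrite rmorphXn rmorphB /= map_polyX map_polyC /= getCratK ?S_rat.
Qed.

(** A root z of unity is a constant, so the sum is rational in t over algC, and
    [rational_in_t_descent] applies. *)
Lemma trivial_radicals_insufficient ys : (forall y, y \in ys -> exists h z, 
    [/\ y = h * z, rational_in_t cst t h & z ^+ e = 1]) ->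
  f0 != \sum_(y <- ys) y.
Proof.
move=> triv; apply/eqP => Df0.
have sub := rational_in_t_subfield cst t.
have [A [B [Bt0 Df]]] : rational_in_t cst t f0.
  rewrite Df0; apply: (subfield_sum sub) => y /triv[h [z [-> rh ze]]].
  apply: (subfieldM sub) => //.
  have [zeta prim_z] := C_prim_root_exists e_gt0.
  have prim_M : e.-primitive_root (cst zeta) by rewrite fmorph_primitive_root.
  have [i ->] := prim_rootP prim_M ze.
  rewrite -rmorphXn; have := rational_in_t_poly cst t (zeta ^+ i)%:P.
  by rewrite map_polyC hornerC.
have B0 : B != 0 by apply: contraNneq Bt0 => ->; rewrite rmorph0 horner0.
have rel : f0 * (map_poly cst B).[t] = (map_poly cst A).[t] by rewrite Df divfK.
have [A' [B' [B'0 rel']]] := rational_in_t_descent ev_conj Qt t_tr Qf0 B0 rel.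
exact: f0_not_t B'0 rel'.
Qed.

Definition ratio_field (Q : T) : set algC :=
  gen_subfield [set x | exists i j, co Q j != 0 /\ x = co Q i / co Q j].

Lemma ratio_field_fixed (Q Q' : T) (nu : {rmorphism algC -> algC}) :
  ratio_field Q = ratio_field Q' -> ratio_fixed co Q' nu -> ratio_fixed co Q nu.
Proof.
move=> eqQ fix_nu i j Qj; pose fixed := [set x | nu x = x].
have : ratio_field Q (co Q i / co Q j) by apply: sub_gen_smallest; exists i, j.
rewrite eqQ; suff : ratio_field Q' `<=` fixed by apply.
apply: smallest_sub; last by move=> _ [i' [j' [Q'j ->]]]; apply: fix_nu.
apply/is_subfieldP; split=> [|x y fx fy|x y fx fy]; rewrite /fixed /= ?rmorph1 //.
  by rewrite rmorphB fx fy.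
by rewrite fmorph_div /= fx fy.
Qed.

Lemma vp_radical_poly p (S : seq rat) (m : rat -> nat) (x : rat) :
  (forall a, a \in S -> x != a) ->
  vp p (radical_poly S m).[x] = \sum_(a <- S) (m a)%:Z * vp p (x - a).
Proof.
rewrite /radical_poly => xS; rewrite horner_prod.
elim: S xS => [|a S IH] xS; first by rewrite !big_nil vp1.
have xS' b : b \in S -> x != b by move=> Sb; apply: xS; rewrite inE Sb orbT.
have xa : x - a != 0 by rewrite subr_eq0 xS // mem_head.
rewrite !big_cons vpM ?horner_exp ?hornerXsubC ?expf_neq0 //; last first.
  rewrite prodf_seq_neq0; apply/allP => b Sb /=.
  by rewrite horner_exp hornerXsubC expf_neq0 // subr_eq0 xS'.
by rewrite vpX // IH.
Qed.

(** Write the quotients of coordinate functions, and f0, as sums of terms h(t) z as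
    in [radical_term]; let s contain the coefficients of all these functions and
    a primitive e-th root of unity. For large m, an automorphism over s fixes
    the ratios of coordinates of P m if and only if it fixes the values v y m of
    the radicals. So equality of the fields of P i and P m makes [radical_valuation]
    applicable to v y i and the v z m. Here y is chosen so that i - a has
    valuation 1 at p for a zero a of its radicand, and the e-th power of v y i
    then has valuation mm y a, not divisible by e. *)
Theorem abelian_case : exists D N0 : nat, forall N, (N0 <= N)%N ->
  (N <= D * size (undup [seq ratio_field (P i) | i <- iota 1 N]))%N.
Proof.
have rt := rational_functionQW Qt; have rf0 := rational_functionQW Qf0.
(* the radicals in terms of which the coordinates and f0 are expressed *)
have rX i j : rational_function ev (ev 'X_i / ev 'X_j).
  have [xj0|xj0] := eqVneq (ev 'X_j) 0.
    rewrite xj0 invr0 mulr0 -(rmorph0 cst).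
    exact: (rational_function_cst evP T_inh).
  by exists 1%N, 'X_i, 'X_j; rewrite !dhomogX /= !mdeg1.
have exd y : exists d, rational_function ev y -> rational_in_t cst t (y ^+ e) ->
    radical_term y d.
  have [[ry rye]|no] := pselect (rational_function ev y /\ rational_in_t cst t (y ^+ e)).
    by have [d Hd] := radical_term_exists ry rye; exists d.
  by exists (0, 0, [::], fun=> 0%N) => ry rye; case: no.
pose dat y := sval (cid (exd y)).
pose hh y := (dat y).1.1.1; pose zz y := (dat y).1.1.2.
pose SS y := (dat y).1.2; pose mm y := (dat y).2.
have datP y : rational_function ev y -> rational_in_t cst t (y ^+ e) ->
    [/\ y = hh y * zz y, rational_in_t cst t (hh y), rational_function ev (zz y),
      uniq (SS y) /\ (forall a, a \in SS y -> ~~ (e %| mm y a)%N) &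
      zz y ^+ e = (map_poly cst (map_poly ratr (radical_poly (SS y) (mm y)))).[t]].
  move=> ry rye; have := svalP (cid (exd y)) ry rye.
  by rewrite -/(dat y) /hh /zz /SS /mm; case: (dat y) => [[[]]].
have exys f : exists ys : seq M, rational_function ev f -> f = \sum_(y <- ys) y /\
    forall y, y \in ys -> rational_function ev y /\ rational_in_t cst t (y ^+ e).
  have [rf|no] := pselect (rational_function ev f); last by exists [::].
  by have [ys Hys] := kummer rf; exists ys.
pose ys f := sval (cid (exys f)); have ysP f := svalP (cid (exys f)).
pose YS := flatten [seq ys (ev 'X_ij.1 / ev 'X_ij.2) | ij <- enum {: 'I_n * 'I_n}] ++ ys f0.
have YSX i j y : y \in ys (ev 'X_i / ev 'X_j) -> y \in YS.
  move=> yij; rewrite mem_cat; apply/orP; left; apply/flattenP.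
  by exists (ys (ev 'X_i / ev 'X_j)) => //; apply/mapP; exists (i, j); rewrite ?mem_enum.
have YSP y : y \in YS -> rational_function ev y /\ rational_in_t cst t (y ^+ e).
  rewrite mem_cat => /orP[/flattenP[_ /mapP[[i j] _ ->] yij]|yf0].
    by have [_ H] := ysP _ (rX i j); apply: H.
  by have [_ H] := ysP _ rf0; apply: H.
have datYS y (Yy : y \in YS) := datP y (YSP y Yy).1 (YSP y Yy).2.
have [y0 Yy0 Sy0] : exists2 y, y \in YS & SS y != [::].
  apply: contrapT => none; have [Df0 ysf0] := ysP _ rf0.
  have /eqP[] : f0 != \sum_(y <- ys f0) y; last exact: Df0.
  apply: trivial_radicals_insufficient => y yf0; have Yy : y \in YS by rewrite mem_cat yf0 orbT.
  have [Dy rh rz _ Dz] := datYS y Yy; exists (hh y), (zz y); split=> //.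
  have S0 : SS y = [::] by apply/eqP; apply: contrapT => /negP nS; apply: none; exists y.
  by rewrite Dz S0 /radical_poly big_nil !rmorph1 hornerC.
(* the values v y m of the radicals and c y m of their coefficients *)
have exv y : exists sv : seq algC * (nat -> algC), y \in YS -> exists N, forall m, (N <= m)%N ->
    value_at (zz y) (P m) (sv.2 m) /\
    forall nu, fixes sv.1 nu -> ratio_fixed co (P m) nu -> nu (sv.2 m) = sv.2 m.
  have [Yy|nY] := boolP (y \in YS); last by exists ([::], fun=> 0).
  have [_ _ rz _ _] := datYS y Yy.
  by have [s [v Hv]] := specialise evP co_neq0 alg_rel rt tP rz; exists (s, v).
have exc y : exists sc : seq algC * (nat -> algC), y \in YS -> exists N, forall m, (N <= m)%N ->
    value_at (hh y) (P m) (sc.2 m) /\ forall nu, fixes sc.1 nu -> nu (sc.2 m) = sc.2 m.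
  have [Yy|nY] := boolP (y \in YS); last by exists ([::], fun=> 0).
  have [_ rh _ _ _] := datYS y Yy.
  by have [s [v Hv]] := specialise_in_t evP tP rh; exists (s, v).
pose sv y := (sval (cid (exv y))).1; pose v y := (sval (cid (exv y))).2.
pose sc y := (sval (cid (exc y))).1; pose c y := (sval (cid (exc y))).2.
have vP y (Yy : y \in YS) := svalP (cid (exv y)) Yy.
have cP y (Yy : y \in YS) := svalP (cid (exc y)) Yy.
have [N1 HN1] : exists N, forall m, (N <= m)%N -> forall y, y \in YS ->
    (value_at (zz y) (P m) (v y m) /\
     forall nu, fixes (sv y) nu -> ratio_fixed co (P m) nu -> nu (v y m) = v y m) /\
    (value_at (hh y) (P m) (c y m) /\ forall nu, fixes (sc y) nu -> nu (c y m) = c y m).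
  by apply: eventually_all => y Yy; apply: eventually_and (vP y Yy) (cP y Yy).
pose s := flatten [seq sv y ++ sc y | y <- YS].
have fix_sv y nu : y \in YS -> fixes s nu -> fixes (sv y) nu.
  move=> Yy fix_s x xs; apply: fix_s; apply/flattenP; exists (sv y ++ sc y).
    exact: map_f.
  by rewrite mem_cat xs.
have fix_sc y nu : y \in YS -> fixes s nu -> fixes (sc y) nu.
  move=> Yy fix_s x xs; apply: fix_s; apply/flattenP; exists (sv y ++ sc y).
    exact: map_f.
  by rewrite mem_cat xs orbT.
have radicals_fixed m nu : (N1 <= m)%N -> fixes s nu ->
    (forall y, y \in YS -> nu (v y m) = v y m) -> ratio_fixed co (P m) nu.
  move=> le_m fix_s fix_v i j Pj; have [Df ysf] := ysP _ (rX i j).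
  have -> : co (P m) i / co (P m) j =
      \sum_(y <- ys (ev 'X_i / ev 'X_j)) (if y \in YS then c y m * v y m else 0).
    apply: (value_at_uniq evP (value_at_coord ev i Pj)); rewrite {1}Df.
    rewrite big_seq [X in value_at _ _ X]big_seq.
    elim/big_rec2: _ => [|y a f yij fa].
      by rewrite -(rmorph0 cst); apply: value_at_cst.
    apply: value_at_add fa => //; have Yy := YSX _ _ _ yij; rewrite Yy.
    have [Dy _ _ _ _] := datYS y Yy; rewrite Dy.
    by have [[vy _] [cy _]] := HN1 m le_m y Yy; apply: value_at_mul; rewrite -?Dy.
  rewrite rmorph_sum; apply: eq_bigr => y _ /=; case: ifP => [Yy|_]; last exact: rmorph0.
  have [_ [_ fix_c]] := HN1 m le_m y Yy.
  by rewrite rmorphM /= fix_v // fix_c //; apply: fix_sc.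
have v_pow y m : y \in YS -> (N1 <= m)%N ->
    v y m ^+ e = ratr (radical_poly (SS y) (mm y)).[m%:R].
  move=> Yy le_m; have [[vy _] _] := HN1 m le_m y Yy.
  apply: (value_at_uniq evP (value_at_exp e vy)).
  have [_ _ _ _ ->] := datYS y Yy.
  have := value_at_horner evP (map_poly ratr (radical_poly (SS y) (mm y))) (tP m).
  by rewrite -[in X in value_at _ _ X -> _](rmorph_nat (ratr : {rmorphism rat -> algC})) horner_map.
(* the set SA of all zeros of the radicands *)
have [zeta prim_z] := C_prim_root_exists e_gt0.
have [p0 Hp0] := radical_valuation e_gt0 prim_z (mem_head zeta s).
pose SA := undup (flatten [seq SS y | y <- YS]).
have SS_SA y a : y \in YS -> a \in SS y -> a \in SA.
  by move=> Yy Sa; rewrite mem_undup; apply/flattenP; exists (SS y) => //; apply: map_f.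
have [N2 HN2] : exists N, forall m, (N <= m)%N -> forall a, a \in SA -> m%:R != a.
  apply: eventually_all => a _; exists (`|numq a|.+1)%N => m lt_m; apply/eqP => Da.
  have : numq a = m by rewrite -Da -[m%:R]/(m%:~R : rat) numq_int.
  by move=> Dn; move: lt_m; rewrite Dn /= ltnn.
apply: (fields_from_ramification (S := SA) (p0 := p0) (n1 := maxn N1 N2)).
- apply: contraNneq Sy0 => SA0; case DS : (SS y0) => [//|a S].
  by have := SS_SA y0 a Yy0; rewrite DS mem_head SA0 => /(_ isT).
- exact: undup_uniq.
move=> i m a p; rewrite !gtn_max => /andP[N1i N2i] /andP[N1m N2m] eq_f p_pr p_gt SAa va vb.
apply: contrapT => none.
have van b : b \in SA -> vp p (m%:R - b) = 0.
  by move=> SAb; apply/eqP; apply: contrapT => /negP nb; apply: none; exists b.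
have /flattenP[_ /mapP[y Yy ->] Sya] : a \in flatten [seq SS y | y <- YS] by rewrite -mem_undup.
have [_ _ _ [uS Sm] _] := datYS y Yy.
case/negP: (Sm a Sya).
pose r := (radical_poly (SS y) (mm y)).[i%:R].
have nz z k : z \in YS -> (N2 <= k)%N -> (radical_poly (SS z) (mm z)).[k%:R] != 0.
  move=> Yz le_k; rewrite horner_prod prodf_seq_neq0; apply/allP => b Sb /=.
  by rewrite horner_exp hornerXsubC expf_neq0 // subr_eq0 HN2 // (SS_SA z).
have vr : vp p r = (mm y a)%:Z.
  rewrite vp_radical_poly => [|b Sb]; last by rewrite HN2 ?(SS_SA y) // ltnW.
  rewrite (bigD1_seq a) //= va mulr1 big_seq_cond big1 ?addr0 // => b /andP[Sb nba].
  by rewrite vb ?mulr0 // (SS_SA y).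
have -> : (e %| mm y a)%N = (e %| vp p r)%Z by rewrite vr.
apply: (Hp0 [seq v z m | z <- YS] [seq (radical_poly (SS z) (mm z)).[m%:R] | z <- YS] (v y i)).
- rewrite -!map_comp; apply/eq_in_map => z Yz /=.
  by apply: v_pow => //; apply: ltnW.
- apply/negP => /mapP[z Yz /esym/eqP]; apply/negP; apply: nz => //; exact: ltnW.
- by apply: v_pow => //; apply: ltnW.
- by apply: nz => //; apply: ltnW.
- move=> nu fix_all.
  have fix_s : fixes s nu.
    by move=> x xs; apply: fix_all; rewrite mem_cat inE xs !orbT.
  have fix_m : ratio_fixed co (P m) nu.
    apply: radicals_fixed fix_s _ => [|z Yz]; first exact: ltnW.
    by apply: fix_all; rewrite mem_cat (map_f (fun z => v z m)).
  have [[_ fix_v] _] := HN1 i (ltnW N1i) y Yy.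
  by apply: fix_v; [apply: fix_sv | apply: ratio_field_fixed eq_f fix_m].
- exact: p_gt.
- move=> _ /mapP[z Yz ->]; rewrite vp_radical_poly => [|b Sb].
    by rewrite big_seq big1 // => b Sb; rewrite van ?mulr0 // (SS_SA z).
  by rewrite HN2 ?(SS_SA z) // ltnW.
Qed.

End AbelianCase.

(** * Curves *)

Lemma transcendental_of_nonconstant (M : fieldType) (cst : {rmorphism algC -> M}) t :
  ~ range cst t -> forall p : {poly algC}, (map_poly cst p).[t] = 0 -> p = 0.
Proof.
move=> t_nc p pt; apply/eqP; apply: contrapT => /negP p0.
have [rs Drs] := closed_field_poly_normal p.
move: pt; rewrite Drs map_polyZ hornerZ => /eqP.
rewrite mulf_eq0 fmorph_eq0 lead_coef_eq0 (negPf p0) /= rmorph_prod horner_prod.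
rewrite prodf_seq_eq0 => /hasP[a _ /=].
rewrite map_polyXsubC hornerXsubC subr_eq0 => /eqP Dt.
by apply: t_nc; exists a.
Qed.

(** The monomials of p are regrouped by their exponent in the second variable. *)
Lemma algebraic_relation_of_mpoly (M : fieldType) (cst : {rmorphism algC -> M})
    (f : 'I_2 -> M) (p : {mpoly algC[2]}) : p != 0 -> mmap cst f p = 0 ->
  algebraic_relation cst (f ord0) (f ord_max).
Proof.
move=> p0 rel.
pose q : {poly {poly algC}} :=
  \sum_(m <- msupp p) (p@_m *: 'X^(m ord0))%:P * 'X^(m ord_max).
have qE i j : q`_j`_i = \sum_(m <- msupp p) p@_m * ((m ord0 == i) && (m ord_max == j))%:R.
  rewrite !coef_sum; apply: eq_bigr => m _; rewrite coefCM coefXn.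
  rewrite [_ == j]eq_sym; case: eqP => _; last by rewrite andbF !mulr0 coef0.
  by rewrite mulr1 andbT coefZ coefXn eq_sym.
have [m pm] : exists m, m \in msupp p.
  by have := mlead_supp p0; exists (mlead p).
exists q.
  apply/eqP => q0; have := qE (m ord0) (m ord_max).
  rewrite q0 !coef0 (bigD1_seq m) //= !eqxx mulr1 big1 => [|m' ne_m].
    by move/esym/eqP; rewrite addr0 mcoeff_eq0 pm.
  case: andP => [[/eqP e0 /eqP e1]|]; last by rewrite mulr0.
  case/eqP: ne_m; apply/mnmP => i; have [->|->] : i = ord0 \/ i = ord_max; last 2 first.
  - exact: e0.
  - exact: e1.
  by case: i => -[|[|]] // ?; [left | right]; apply: val_inj.
pose Phi : {rmorphism {poly algC} -> M} := horner_eval (f ord0) \o map_poly cst.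
transitivity (map_poly Phi q).[f ord_max].
  rewrite (horner_coef_wide _ (n := size q)) ?size_poly //.
  by apply: eq_bigr => i _; rewrite coef_map.
rewrite -[RHS]rel /mmap /q rmorph_sum horner_sum; apply: eq_bigr => m' _.
rewrite rmorphM /= map_polyC map_polyXn hornerM hornerC hornerXn /= /horner_eval.
rewrite map_polyZ map_polyXn hornerZ hornerXn -mulrA; congr (_ * _).
by rewrite /mmap1 big_ord_recl big_ord1; congr (_ * f _ ^+ m' _); apply: val_inj.
Qed.

Section Instance.
Variable X : curve.
Local Notation n := (pdim X).+1.
Local Notation ev := (to_hfrac X).
Local Notation co := (@hcoord n (eqns X)).

Lemma to_hfrac_eq0 F : (ev F == 0) = ideal_of X F.
Proof.
rewrite tofrac_eq0 -[0 in LHS](rmorph0 (@to_coord X)) /to_coord.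
by rewrite -Quotient.idealrBE subr0.
Qed.

Lemma to_hfrac_eq0P F : ev F = 0 <-> forall P : var_point X, F.@[co P] = 0.
Proof.
split=> [/eqP|F0]; first by rewrite to_hfrac_eq0 => /asboolP.
by apply/eqP; rewrite to_hfrac_eq0; apply/asboolP.
Qed.

Lemma hcoord_neq0 (P : var_point X) : exists i, co P i != 0.
Proof. by case: P. Qed.

Lemma var_point_vanish (P : var_point X) f : f \in eqns X -> (to_algC f).@[co P] = 0.
Proof. by case: P => c c0; apply. Qed.

Lemma meval_aut m (nu : {rmorphism algC -> algC}) (F : {mpoly algC[m]}) v :
  nu F.@[v] = (map_mpoly nu F).@[fun i => nu (v i)].
Proof.
elim/mpoly_ring_ind: F => [c|i|F G HF HG|F G HF HG].
- by rewrite map_mpolyC !mevalC.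
- by rewrite map_mpolyX !mevalXU.
- by rewrite (rmorphD (map_mpoly nu)) !mevalD (rmorphD nu) HF HG.
- by rewrite (rmorphM (map_mpoly nu)) !mevalM (rmorphM nu) HF HG.
Qed.

(** The equations being rational, conjugation permutes the points. *)
Lemma to_hfrac_conj (nu : {rmorphism algC -> algC}) F : ev F = 0 -> ev (map_mpoly nu F) = 0.
Proof.
move=> /to_hfrac_eq0P F0; apply/to_hfrac_eq0P => P.
pose c i := algC_invaut nu (co P i).
have c_n0 : exists i, c i != 0.
  by have [i Pi] := hcoord_neq0 P; exists i; rewrite fmorph_eq0.
have cP f : f \in eqns X -> (to_algC f).@[c] = 0.
  move=> Xf; have := var_point_vanish P Xf; move/(congr1 (algC_invaut nu)).
  by rewrite meval_aut map_mpoly_ratr rmorph0.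
have := F0 (PPoint c_n0 cP); move/(congr1 nu); rewrite meval_aut rmorph0 => <-.
by apply: meval_eq => i; rewrite /= algC_invautK.
Qed.

Lemma funfieldE f : funfield X f <-> rational_function ev f.
Proof.
split=> [[F [G [[d [hF hG]] nG Df]]]|[d [F [G [hF hG G0 Df]]]]].
  by exists d, F, G; split=> //; rewrite to_hfrac_eq0.
by exists F, G; split=> //; [exists d | rewrite -to_hfrac_eq0].
Qed.

Lemma funfieldQE f : funfieldQ X f <-> rational_functionQ ev f.
Proof.
split=> [[F [G [[d [hF hG]] nG Df]]]|[d [F [G [hF hG G0 Df]]]]].
  by exists d, F, G; split=> //; rewrite to_hfrac_eq0.
by exists F, G; split=> //; [exists d | rewrite -to_hfrac_eq0].
Qed.

Lemma has_valueE f (P : var_point X) a : has_value f P a <-> value_at ev co f P a.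
Proof.
split=> [[F [G [[[d [hF hG]] nG Df] GP Da]]]|[d [F [G [hF hG GP Df Da]]]]].
  by exists d, F, G.
exists F, G; split=> //; split=> //; first by exists d.
by rewrite -to_hfrac_eq0 (ev_neq0 to_hfrac_eq0P GP).
Qed.

Lemma curve_algebraic_relation f g : rational_function ev f -> rational_function ev g ->
  algebraic_relation (cst_hfrac X) f g.
Proof.
move=> /funfieldE rf /funfieldE rg.
have [_ trdeg1] : has_trdeg (cst_hfrac X) (funfield X) 1 by case: (X).
pose h (i : 'I_2) := if i == ord0 then f else g.
have hK i : funfield X (h i) by rewrite /h; case: ifP.
have /existsNP[p /not_implyP[rel /eqP p0]] := trdeg1 h hK.
exact: (algebraic_relation_of_mpoly p0 rel).
Qed.

End Instance.

Lemma to_algC_homog m d (F : {mpoly rat[m]}) : F \is d.-homog -> to_algC F \is d.-homog.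
Proof.
move=> /dhomogP hF; apply/dhomogP => mu; rewrite mcoeff_msupp mcoeff_map_mpoly.
rewrite fmorph_eq0 -mcoeff_msupp; exact: hF.
Qed.

Lemma to_algC_mderiv m i (F : {mpoly rat[m]}) : to_algC (mderiv i F) = mderiv i (to_algC F).
Proof.
apply/mpolyP => mu; rewrite mcoeff_deriv !mcoeff_map_mpoly mcoeff_deriv.
by rewrite raddfMn.
Qed.

Section CurveFacts.
Variables (X : curve) (t : hfrac X).
Local Notation n := (pdim X).+1.
Local Notation ev := (to_hfrac X).
Local Notation co := (@hcoord n (eqns X)).
Hypothesis Qt : funfieldQ X t.
Hypothesis t_nc : ~ range (cst_hfrac X) t.

Let E (l : 'I_(size (eqns X))) := to_algC (nth 0 (eqns X) l).

Lemma kummer_root_critical_value (y : hfrac X) (e m : nat) (alpha : algC) (q : {poly algC}) :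
  (0 < e)%N -> rational_function ev y -> ~~ (e %| m)%N -> q.[alpha] != 0 ->
  y ^+ e = (map_poly (cst_hfrac X) (('X - alpha%:P) ^+ m * q)).[t] ->
  critical_value t (Some alpha).
Proof.
move=> e_gt0 ry e_ndvd qa Dy.
have exd (l : 'I_(size (eqns X))) : exists d, E l \is d.-homog.
  have hom : forall f, f \in eqns X -> exists d : nat, f \is d.-homog by case: (X) => -[].
  by have [d hd] := hom _ (mem_nth 0 (ltn_ord l)); exists d; apply: to_algC_homog.
have E_homog l : E l \is (sval (cid (exd l))).-homog := svalP (cid (exd l)).
have E_vanish l : ev (E l) = 0.
  by apply/to_hfrac_eq0P => P; apply: var_point_vanish; apply: mem_nth.
have E_points c : (exists i, c i != 0) -> (forall l, (E l).@[c] = 0) ->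
    exists P : var_point X, co P = c.
  move=> c0 Ec; have cP f : f \in eqns X -> (to_algC f).@[c] = 0.
    by move=> /(nthP 0)[l lt_l <-]; apply: (Ec (Ordinal lt_l)).
  by exists (PPoint c0 cP).
have smooth (P : var_point X) : (\rank (jac co E P)).+2 = n.
  have sm : forall P : var_point X, (\rank (jacobian P) + 1)%N = pdim X by case: (X).
  have -> : jac co E P = jacobian P.
    by apply/matrixP => l i; rewrite !mxE /E to_algC_mderiv.
  by have := congr1 succn (sm P); rewrite addn1.
have rt : rational_function ev t by apply: rational_functionQW; apply/funfieldQE.
have [P [f [g [/has_valueE f0 /has_valueE g0 Dt]]]] := kummer_root_critical
  (@to_hfrac_eq0P X) (variety_inhabited X) (@curve_algebraic_relation X)
  (@hcoord_neq0 X) E_homog E_vanish E_points smooth rt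
  (transcendental_of_nonconstant t_nc) ry e_gt0 e_ndvd qa Dy.
exists P, 1%N, (fun=> f), (fun=> g); split=> //.
by rewrite big_ord1.
Qed.

Lemma abelian_kummer :
  finite_abelian_ext (gen_subfield (t |` range (cst_hfrac X))) (funfield X) ->
  exists2 e, (0 < e)%N & forall f, rational_function ev f -> exists ys : seq (hfrac X),
    f = \sum_(y <- ys) y /\
    forall y, y \in ys -> rational_function ev y /\ rational_in_t (cst_hfrac X) t (y ^+ e).
Proof.
move=> [F [L [phi [rng phi1 galL abelG]]]].
have e_gt0 : (0 < #|'Gal({:L} / 1)%g|)%N := cardG_gt0 _.
exists #|'Gal({:L} / 1)%g| => // f /funfieldE; rewrite -rng => -[x _ <-].
have [zeta prim_z] := C_prim_root_exists e_gt0.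
have : gen_subfield (t |` range (cst_hfrac X)) (cst_hfrac X zeta).
  by apply: sub_gen_smallest; right; exists zeta.
rewrite -phi1 => -[zeta' z1 Dz].
have prim_z' : #|'Gal({:L} / 1)%g|.-primitive_root zeta'.
  by rewrite -(fmorph_primitive_root phi) Dz fmorph_primitive_root.
have [ys [Dx ysP]] := kummer_decomposition galL abelG prim_z' z1 x.
exists (map phi ys); split; first by rewrite Dx rmorph_sum big_map.
move=> _ /mapP[y ysy ->]; split.
  by apply/funfieldE; rewrite -rng; exists y.
apply: gen_subfield_rational_in_t; rewrite -phi1 -rmorphXn.
by exists (y ^+ #|'Gal({:L} / 1)%g|) => //; apply: ysP.
Qed.

Variable P : int -> var_point X.
Hypothesis tP : forall m : int, has_value t (P m) m%:~R.

Lemma point_field_ratio (Q : var_point X) : point_field [set Q] = ratio_field co Q.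
Proof.
rewrite /point_field /ratio_field; congr gen_subfield; apply/seteqP; split=> x /=.
  by move=> [_ -> [i [j [Qj ->]]]]; exists i, j.
by move=> [i [j [Qj ->]]]; exists Q => //; exists i, j.
Qed.

Lemma tP_nat m : value_at ev co t (P m%:Z) m%:R.
Proof. by apply/has_valueE; have := tP m%:Z; rewrite -pmulrn. Qed.

Lemma diversity_abelian : funfieldQ X <> gen_subfield [set t] ->
  (forall a, critical_value t (Some a) -> a \in Crat) ->
  finite_abelian_ext (gen_subfield (t |` range (cst_hfrac X))) (funfield X) ->
  exists D N0 : nat, forall N, (N0 <= N)%N ->
  (N <= D * size (undup [seq point_field [set P i%:Z] | i <- iota 1 N]))%N.
Proof.
move=> Q_neq crit /abelian_kummer[e e_gt0 kum].
have t_tr := transcendental_of_nonconstant t_nc.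
have Qt' : rational_functionQ ev t by apply/funfieldQE.
have subQ := rational_functionQ_subfield ev.
have gen_le : gen_subfield [set t] `<=` funfieldQ X.
  move=> f gf; apply/funfieldQE; move: f gf; apply: smallest_sub; first exact: subQ.
  by move=> _ ->.
have [f0 Qf0 nf0] : exists2 f, funfieldQ X f & ~ gen_subfield [set t] f.
  apply: contrapT => none; apply: Q_neq; apply/seteqP; split=> // f Qf.
  by apply: contrapT => nf; apply: none; exists f.
have Qf0' : rational_functionQ ev f0 by apply/funfieldQE.
have genP (A : {poly rat}) : gen_subfield [set t]
    (map_poly (cst_hfrac X \o (ratr : rat -> algC) : {rmorphism rat -> hfrac X}) A).[t].
  apply: (subfield_horner (gen_subfield_is _)); last exact: sub_gen_smallest.
  exact: (subfield_rat (gen_subfield_is _)).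
have f0_not A B : B != 0 ->
  f0 * (map_poly (cst_hfrac X \o (ratr : rat -> algC) : {rmorphism rat -> hfrac X}) B).[t] <>
  (map_poly (cst_hfrac X \o (ratr : rat -> algC) : {rmorphism rat -> hfrac X}) A).[t].
  move=> B0 rel; apply: nf0.
  have Bt0 : (map_poly (cst_hfrac X \o (ratr : rat -> algC) : {rmorphism rat -> hfrac X}) B).[t] != 0.
    apply/eqP => /(t_trQ t_tr) B0'; by rewrite B0' eqxx in B0.
  rewrite -[f0](mulfK Bt0) rel; exact: (subfieldV (gen_subfield_is _)).
have crit_rat y m alpha q : rational_function ev y -> ~~ (e %| m)%N -> q.[alpha] != 0 ->
    y ^+ e = (map_poly (cst_hfrac X) (('X - alpha%:P) ^+ m * q)).[t] -> alpha \in Crat.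
  by move=> ry em qa Dy; apply: crit; apply: kummer_root_critical_value e_gt0 ry em qa Dy.
have [D [N0 H]] := abelian_case (@to_hfrac_eq0P X) (variety_inhabited X) (@hcoord_neq0 X)
  (@to_hfrac_conj X) (@curve_algebraic_relation X) Qt' t_tr tP_nat e_gt0 kum crit_rat Qf0' f0_not.
exists D, N0 => N le_N; have := H N le_N.
by under eq_map do rewrite -point_field_ratio.
Qed.

End CurveFacts.

Section LargeDegree.
Variables (X : curve) (t : hfrac X).
Local Notation n := (pdim X).+1.
Local Notation ev := (to_hfrac X).
Local Notation co := (@hcoord n (eqns X)).
Hypothesis Qt : funfieldQ X t.
Variable P : int -> var_point X.
Hypothesis tP : forall m : int, has_value t (P m) m%:~R.

(** There are at most n^2 ratios of coordinates for each point, all of degree at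
    most D, and K is the maximum of both bounds. *)
Lemma degree_le_diversity : exists K : nat, forall N d,
  number_field_degree
    (point_field [set P i%:Z | i in [set i : nat | (0 < i <= N)%N]]) d ->
  (d <= K.+2 ^ (K * size (undup [seq point_field [set P i%:Z] | i <- iota 1 N])))%N.
Proof.
have Qt' : rational_functionQ ev t by apply/funfieldQE.
have [D HD] := points_degree (@to_hfrac_eq0P X) (@to_hfrac_conj X)
  (@curve_algebraic_relation X) (rational_functionQW Qt') Qt' (tP_nat tP).
pose gens (i : nat) := [seq co (P i) ab.1 / co (P i) ab.2 |
  ab <- [seq ab <- enum {: 'I_n * 'I_n} | co (P i) ab.2 != 0]].
have gensP i x : x \in gens i <-> exists a b, co (P i) b != 0 /\ x = co (P i) a / co (P i) b.
  split=> [/mapP[[a b]]|[a [b [Pb ->]]]].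
    by rewrite mem_filter /= => /andP[Pb _] ->; exists a, b.
  by apply/mapP; exists (a, b); rewrite // mem_filter Pb mem_enum.
have pf_i i : gen_subfield [set` gens i] = point_field [set P i%:Z].
  rewrite point_field_ratio /ratio_field; congr gen_subfield; apply/seteqP.
  by split=> x /= /gensP.
exists (maxn D #|{: 'I_n * 'I_n}|) => N d dN.
set K := maxn _ _.
have sz_gens i : (size (gens i) <= K)%N.
  rewrite size_map size_filter (leq_trans (count_size _ _)) // -cardE.
  exact: leq_maxr.
have degD i x : (0 < i)%N -> x \in gens i -> degree_le K.+2 x.
  move=> _ /gensP[a [b [Pb ->]]]; apply: degree_le_mono (HD i a b Pb).
  by have : (D <= K)%N := leq_maxl _ _; lia.
have Ekf : point_field [set P i%:Z | i in [set i : nat | (0 < i <= N)%N]] =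
    gen_subfield [set x | exists2 i, (0 < i <= N)%N & x \in gens i].
  rewrite /point_field; congr gen_subfield; apply/seteqP; split=> x /=.
    by move=> [_ [i iN <-] Hx]; exists i => //; apply/gensP.
  by move=> [i iN /gensP Hx]; exists (P i) => //; exists i.
rewrite Ekf in dN; have := compositum_degree sz_gens degD dN.
by under eq_map do rewrite pf_i.
Qed.

End LargeDegree.

Theorem mainTheorem2 (R : realType) :
  (forall (X : curve) (t : hfrac X),
     funfieldQ X t ->
     ~ range (cst_hfrac X) t ->
     funfieldQ X <> gen_subfield [set t] ->
     (exists a : algC, critical_value t (Some a) /\ a \notin Crat) \/
     ~ finite_abelian_ext (gen_subfield (t |` range (cst_hfrac X)))
         (funfield X) ->
     forall P : int -> var_point X,
     (forall n : int, has_value t (P n) n%:~R) ->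
     exists2 c : R, 0 < c &
     exists N0 : nat, forall N : nat, (N0 <= N)%N ->
     exists d : nat,
       number_field_degree
         (point_field [set P i%:Z | i in [set i : nat | (0 < i <= N)%N]]) d /\
       expR (c * N%:R) <= d%:R) ->
  (forall (X : curve) (t : hfrac X),
     funfieldQ X t ->
     ~ range (cst_hfrac X) t ->
     funfieldQ X <> gen_subfield [set t] ->
     forall P : int -> var_point X,
     (forall n : int, has_value t (P n) n%:~R) ->
     exists2 c : R, 0 < c &
     exists N0 : nat, forall N : nat, (N0 <= N)%N ->
     c * N%:R <=
       (size (undup [seq point_field [set P i%:Z] | i <- iota 1 N]))%:R).
Proof.
move=> large_degree X t Qt t_nc Q_neq P tP.
have [hyp|no_hyp] := pselect ((exists a : algC, critical_value t (Some a) /\ a \notin Crat) \/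
     ~ finite_abelian_ext (gen_subfield (t |` range (cst_hfrac X))) (funfield X)).
  have [c c0 [N0 HN]] := large_degree X t Qt t_nc Q_neq hyp P tP.
  have [K HK] := degree_le_diversity Qt tP.
  exists (c / (K.+2 * K.+1)%:R); first by rewrite divr_gt0 ?ltr0n.
  exists N0 => N /HN[d [dN d_ge]]; have d_le := HK N d dN.
  set m := size _ in d_le *.
  (* the degree is at most (K + 2)^(K m), and K + 2 <= expR (K + 2) *)
  have : expR (c * N%:R) <= expR ((K.+2 * (K * m))%:R).
    apply: le_trans d_ge _; rewrite mulnC natrM expRM_natl.
    apply: (@le_trans _ _ ((K.+2 ^ (K * m))%:R)); first by rewrite ler_nat.
    rewrite natrX lerXn2r ?nnegrE ?expR_ge0 ?ler0n //.
    by apply: le_trans (expR_ge1Dx _); rewrite lerDr.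
  rewrite ler_expR => le_cN; rewrite mulrAC ler_pdivrMr ?ltr0n //.
  apply: le_trans le_cN _; rewrite -natrM ler_nat; nia.
have crit a : critical_value t (Some a) -> a \in Crat.
  by move=> ca; apply: contrapT => /negP na; apply: no_hyp; left; exists a.
have abel : finite_abelian_ext (gen_subfield (t |` range (cst_hfrac X))) (funfield X).
  by apply: contrapT => nabel; apply: no_hyp; right.
have [D [N0 HN]] := diversity_abelian Qt t_nc tP Q_neq crit abel.
exists (D.+1%:R^-1); first by rewrite invr_gt0 ltr0n.
exists N0 => N /HN le_N; rewrite mulrC ler_pdivrMr ?ltr0n // -natrM ler_nat.
by rewrite mulnS; lia.
Qed.
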